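(* Let $h:\mathbb{R}^d\to(0,+\infty)$ be a radially symmetric kernel, $h(x)=\varphi(|x|)$, which is positive, bounded and (strictly) decreasing (i.e. $\varphi$ is strictly decreasing). Let $\Omega\subset\mathbb{R}^d$ be a set of positive Lebesgue measure which is either a bounded open set, or a bounded measurable set with finite perimeter. If $\Omega$ has constant nonlocal $h$-mean curvature, then $\Omega$ is a ball (up to a Lebesgue null set).
   Context: The essential boundary $\partial^*\Omega$ of a measurable set $\Omega\subset\mathbb{R}^d$ is the set of points $x\in\mathbb{R}^d$ at which both $\Omega$ and its complement have strictly positive $d$-dimensional upper density. ''$\Omega$ has constant nonlocal $h$-mean curvature'' means that $\Omega$ is $h$-critical: there exists $c>0$ such that $\int_\Omega h(x-y)\,dy=c$ for all $x\in\partial^*\Omega$. *)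

(* Defs.v *)
From HB Require Import structures.
From mathcomp Require Import all_boot all_order all_algebra.
From mathcomp Require Import all_classical all_reals all_analysis.

Set Implicit Arguments.
Unset Strict Implicit.
Unset Printing Implicit Defensive.

Import Order.TTheory GRing.Theory Num.Theory.
Import numFieldNormedType.Exports.

Local Open Scope classical_set_scope.
Local Open Scope ring_scope.

(* Borel sets of R^d: the sigma-algebra generated by the coordinates. *)
Definition rV_display : measure_display. Proof. exact: default_measure_display. Qed.

Section rV_measurable.
Context {R : realType} (d : nat).

Definition rV_coord (i : 'I_d) (x : 'rV[R]_d) : measurableTypeR R := x ord0 i.

Let rV_borel : set (set 'rV[R]_d) := g_sigma_preimage rV_coord.

Let rV_borel0 : rV_borel set0. Proof. exact: sigma_algebra0. Qed.

Let rV_borelC A : rV_borel A -> rV_borel (~` A).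
Proof. exact: sigma_algebraC. Qed.

Let rV_borel_bigcup (F : (set 'rV[R]_d)^nat) :
  (forall i, rV_borel (F i)) -> rV_borel (\bigcup_i F i).
Proof. exact: sigma_algebra_bigcup. Qed.

HB.instance Definition _ := @isMeasurable.Build rV_display 'rV[R]_d
  rV_borel rV_borel0 rV_borelC rV_borel_bigcup.

End rV_measurable.

Section lebesgue.
Context {R : realType}.
Local Notation mR := (measurableTypeR R).

Lemma measurable_rV_coord d (i : 'I_d) :
  measurable_fun [set: 'rV[R]_d] (rV_coord i).
Proof.
move=> _ Y mY; rewrite setTI; apply: sub_sigma_algebra => /=.
rewrite -bigcup_seq/=; exists i => /=; first by rewrite mem_index_enum.
by exists Y => //; rewrite setTI.
Qed.

Lemma measurable_fun_rVP d' (T : measurableType d') d (f : T -> 'rV[R]_d) :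
  (forall i, measurable_fun [set: T] (rV_coord i \o f)) ->
  measurable_fun [set: T] f.
Proof.
move=> mf _ Y mY; rewrite setTI.
suff : g_sigma_preimage (fun i => rV_coord i \o f) `<=` measurable.
  by apply; rewrite g_sigma_preimage_comp; exists Y => //; rewrite setTI.
apply: smallest_sub; first exact: sigma_algebra_measurable.
rewrite -bigcup_seq; apply: bigcup_sub => i _ A [B mB <-]; exact: mf.
Qed.

(* R^(1+d) is identified with R * R^d. *)
Definition rV_cons d (p : mR * 'rV[R]_d) : 'rV[R]_d.+1 :=
  row_mx (p.1 : R)%:M p.2 : 'rV_(1 + d).

Lemma measurable_rV_cons d : measurable_fun [set: mR * 'rV[R]_d] (@rV_cons d).
Proof.
apply: measurable_fun_rVP => i.
have [j ->|j ->] := @fintype.split_ordP 1 d i.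
- rewrite (_ : _ \o _ = fst)//; apply/funext => p.
  have -> : j = ord0 by rewrite ord1.
  by rewrite /= /rV_coord /rV_cons (@row_mxEl R 1 1 d) mxE mulr1n.
- rewrite (_ : _ \o _ = rV_coord j \o snd)//; last first.
    by apply/funext => p; rewrite /= /rV_coord /rV_cons (@row_mxEr R 1 1 d).
  by apply: measurableT_comp => //; exact: measurable_rV_coord.
Qed.

Definition rV_cons_measure d (mu : {measure set 'rV[R]_d -> \bar R}) :
    set 'rV[R]_d.+1 -> \bar R :=
  pushforward (lebesgue_measure \x^ mu)%E (@rV_cons d).

Section rV_cons_measure.
Context d (mu : {measure set 'rV[R]_d -> \bar R}).
Local Open Scope ereal_scope.

Let rV_cons_measure0 : rV_cons_measure mu set0 = 0.
Proof. by rewrite /rV_cons_measure /pushforward preimage_set0 measure0. Qed.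

Let rV_cons_measure_ge0 A : 0 <= rV_cons_measure mu A.
Proof. by rewrite /rV_cons_measure /pushforward. Qed.

Let rV_cons_measure_sigma_additive : semi_sigma_additive (rV_cons_measure mu).
Proof.
have mc := @measurable_rV_cons d => F mF tF mUF.
rewrite /rV_cons_measure /pushforward preimage_bigcup.
apply: measure_semi_sigma_additive.
- by move=> n; rewrite -[X in measurable X]setTI; exact: mc.
- apply/trivIsetP => /= i j _ _ ij; rewrite -preimage_setI.
  by move/trivIsetP : tF => /(_ _ _ _ _ ij) ->//; rewrite preimage_set0.
- by rewrite -preimage_bigcup -[X in measurable X]setTI; exact: mc.
Qed.

HB.instance Definition _ := isMeasure.Build _ _ _ (rV_cons_measure mu)
  rV_cons_measure0 rV_cons_measure_ge0 rV_cons_measure_sigma_additive.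

End rV_cons_measure.

Fixpoint rV_borel_measure d : {measure set 'rV[R]_d -> \bar R} :=
  match d with
  | 0 => dirac (0 : 'rV[R]_0)
  | d'.+1 => rV_cons_measure (rV_borel_measure d')
  end.

Lemma rV_borel_measure_box d (A : 'I_d -> set mR) :
  (forall i, measurable (A i)) ->
  rV_borel_measure d [set x | forall i, A i (rV_coord i x)] =
  (\prod_(i < d) lebesgue_measure (A i))%E.
Proof.
elim: d A => [|d IH] A mA.
  rewrite big_ord0 /= /dirac indicE mem_set//; by case.
rewrite big_ord_recl -(IH (fun i => A (lift ord0 i)))//=.
have mB : measurable [set x : 'rV[R]_d |
    forall i : 'I_d, A (lift ord0 i) (rV_coord i x)].
  rewrite (_ : mkset _ = \big[setI/setT]_(i < d)
      (rV_coord i @^-1` A (lift ord0 i))).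
    apply: bigsetI_measurable => i _; rewrite -[X in measurable X]setTI.
    exact: measurable_rV_coord.
  apply/seteqP; split => x; rewrite -bigcap_seq => Ax i.
    by move=> _; exact: Ax.
  by apply: Ax; rewrite /= mem_index_enum.
rewrite -product_measure2E// /rV_cons_measure /pushforward; congr (_ _).
apply/seteqP; split => -[a x] /=.
  move=> Aax; split => [|i].
    have := Aax ord0; rewrite /rV_coord /rV_cons.
    by rewrite (_ : ord0 = @lshift 1 d ord0) ?(@row_mxEl R 1 1 d) ?mxE ?mulr1n//;
      exact: val_inj.
  have := Aax (lift ord0 i); rewrite /rV_coord /rV_cons.
  by rewrite (_ : lift ord0 i = @rshift 1 d i) ?(@row_mxEr R 1 1 d)//;
    exact: val_inj.
move=> [Aa Ax] i; rewrite /rV_coord /rV_cons.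
have [j ij|j ij] := @fintype.split_ordP 1 d i.
  rewrite [in X in _ _ X]ij (@row_mxEl R 1 1 d).
  have -> : i = ord0 by apply: val_inj; rewrite ij /= ord1.
  by rewrite (ord1 j) mxE mulr1n.
rewrite [in X in _ _ X]ij (@row_mxEr R 1 1 d).
have -> : i = lift ord0 j by apply: val_inj; rewrite ij.
exact: Ax.
Qed.

End lebesgue.

(* Lebesgue measure on R^d; its sigma-algebra, that of the Caratheodory
   measurable sets, is the Lebesgue (complete) one. *)
Definition rV_lebesgue (R : realType) (d : nat) :=
  @completed_measure_extension _ 'rV[R]_d R (rV_borel_measure d).
Arguments rV_lebesgue R d _ : clear implicits.
HB.instance Definition _ (R : realType) (d : nat) :=
  Measure.on (rV_lebesgue R d).

Definition rV_lebesgue_measurable (R : realType) (d : nat)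
    (Omega : set 'rV[R]_d) : Prop :=
  ((rV_borel_measure d)^*)%mu.-cara.-measurable Omega.

Section critical_sets.
Context {R : realType} {d : nat}.
Local Notation E := 'rV[R]_d.
Local Notation leb := (rV_lebesgue R d).
Implicit Types (x y : E) (Omega : set E).

(* The norm `|x| on 'rV[R]_d is the sup norm; it defines the same topology and
   the same bounded sets as the Euclidean norm. *)
Definition enorm x : R := Num.sqrt (\sum_(i < d) x ord0 i ^+ 2).

Definition eball x (r : R) : set E := [set y | enorm (y - x) < r].

Definition upper_density Omega x : \bar R :=
  limf_esup
    (fun r : R => (fine (leb (Omega `&` eball x r)) / fine (leb (eball x r)))%:E)
    (0 : R)^'+.

Definition essential_boundary Omega : set E :=
  [set x | (0 < upper_density Omega x)%E /\ (0 < upper_density (~` Omega) x)%E].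

Definition h_critical (h : E -> R) Omega : Prop :=
  exists2 c : R, 0 < c & forall x, essential_boundary Omega x ->
    (\int[leb]_(y in Omega) (h (x - y))%:E)%E = c%:E.

Definition C1c (T : E -> E) : Prop :=
  [/\ forall x, differentiable T x,
      continuous (jacobian T) &
      compact (closure [set x | T x != 0])].

Definition divergence (T : E -> E) x : R := \tr (jacobian T x).

(* The perimeter in the sense of De Giorgi. *)
Definition perimeter Omega : \bar R :=
  ereal_sup [set (\int[leb]_(x in Omega) (divergence T x)%:E)%E |
    T in [set T : E -> E | C1c T /\ forall x, enorm (T x) <= 1]].

Definition finite_perimeter Omega : Prop := (perimeter Omega < +oo)%E.

Definition equivalent_to_ball Omega : Prop :=
  exists x (r : R), 0 < r /\
    leb ((Omega `\` eball x r) `|` (eball x r `\` Omega)) = 0%E.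

End critical_sets.

(* Main.v *)
(** The proof moves hyperplanes over the potential v x = \int_Omega h (x - y) dy.

    Points at which balls are half filled by Omega lie in the essential boundary and accumulate at
    every point of the measure-theoretic boundary, so by continuity v = c on the latter.

    Fix a unit vector e and let b be the barycenter of Omega. When the part of Omega to the left of
    the hyperplane x.e = l contains, up to a null set, the mirror image of the part to the right,
    v (x) > v (R_l x) for x to the left. This comparison is a closed condition on l, and it holds for
    large l. If it stopped at some l0 > b.e, then v would be strictly decreasing in the direction e
    near the hyperplane x.e = l0: the gain is of order t for a step t e because a set of positive
    measure can be translated along e inside the uncovered part of Omega, and the loss is carried by
    a thin slab. A violation at l slightly below l0 yields two boundary points on a line parallel to
    e, close to that hyperplane, at which v = c: a contradiction. Hence v x is a strictly decreasing
    function of the distance of x to b, the measure-theoretic boundary is contained in a sphere, and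
    Omega is a ball.

    The translated set exists trivially for open Omega; for finite perimeter it follows from
    |Omega \ (Omega + t e)| <= P t, obtained by testing the perimeter with mollified indicators. *)
Require Import Defs.
From HB Require Import structures.
From mathcomp Require Import all_boot all_order all_algebra.
From mathcomp Require Import all_classical all_reals all_analysis.
From mathcomp Require Import measurable_realfun ring lra.
Set Implicit Arguments.
Unset Strict Implicit.
Unset Printing Implicit Defensive.
Import Order.TTheory GRing.Theory Num.Theory.
Import numFieldNormedType.Exports.
Local Open Scope classical_set_scope.
Local Open Scope ring_scope.

(** * Reflections and Euclidean geometry *)

Section euclid.
Context {R : realType} {d : nat}.
Implicit Types x y z e : 'rV[R]_d.

(** The kernel need not be continuous and the boundary has no normal, so v is never differentiated:
    the gain and the loss of order t are both found by cutting a fixed length into steps of length t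
    and telescoping. The equality v = c concerns boundary points, whereas a failure of the
    comparison is a set of positive measure. The link is that a segment from a point that is not
    interior to a point that is not exterior, both up to null sets, crosses the measure-theoretic
    boundary. That boundary may itself have positive measure; its part at level c is discarded
    because v is strictly monotone along lines parallel to e, and a bounded set none of whose points
    returns to it under a short translation along e is null. The barycenter is where strictness can
    fail: if the two sides of a hyperplane are mirror images of each other, the hyperplane passes
    through it. Two points at different distances from b are compared through their bisecting
    hyperplane, which is why every direction e is needed. *)

Definition dotp x y : R := \sum_(i < d) x ord0 i * y ord0 i.

Lemma dotpC x y : dotp x y = dotp y x.
Proof. by apply: eq_bigr => i _; rewrite mulrC. Qed.

Lemma dotpDl x y z : dotp (x + y) z = dotp x z + dotp y z.
Proof. by rewrite -big_split; apply: eq_bigr => i _; rewrite mxE mulrDl. Qed.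

Lemma dotpZl a x y : dotp (a *: x) y = a * dotp x y.
Proof. by rewrite mulr_sumr; apply: eq_bigr => i _; rewrite mxE mulrA. Qed.

Lemma dotpNl x y : dotp (- x) y = - dotp x y.
Proof. by rewrite -scaleN1r dotpZl mulN1r. Qed.

Lemma dotpBl x y z : dotp (x - y) z = dotp x z - dotp y z.
Proof. by rewrite dotpDl dotpNl. Qed.

Lemma dotp0l x : dotp 0 x = 0.
Proof. by rewrite -(scale0r 0) dotpZl mul0r. Qed.

Lemma dotpDr x y z : dotp z (x + y) = dotp z x + dotp z y.
Proof. by rewrite dotpC dotpDl !(dotpC _ z). Qed.

Lemma dotpZr a x y : dotp x (a *: y) = a * dotp x y.
Proof. by rewrite dotpC dotpZl dotpC. Qed.

Lemma dotpNr x y : dotp x (- y) = - dotp x y.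
Proof. by rewrite dotpC dotpNl dotpC. Qed.

Lemma dotpBr x y z : dotp z (x - y) = dotp z x - dotp z y.
Proof. by rewrite dotpDr dotpNr. Qed.

Lemma dotp_ge0 x : 0 <= dotp x x.
Proof. by apply: sumr_ge0 => i _; rewrite -expr2 sqr_ge0. Qed.

Lemma coord_dotp_le x i : x ord0 i ^+ 2 <= dotp x x.
Proof.
rewrite /dotp (bigD1 i)//= -expr2 lerDl; apply: sumr_ge0 => j _.
by rewrite -expr2 sqr_ge0.
Qed.

Lemma enormE x : enorm x = Num.sqrt (dotp x x).
Proof. by congr Num.sqrt; apply: eq_bigr => i _; rewrite expr2. Qed.

Lemma enorm_ge0 x : 0 <= enorm x. Proof. exact: sqrtr_ge0. Qed.

Lemma sqr_enorm x : enorm x ^+ 2 = dotp x x.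
Proof. by rewrite enormE sqr_sqrtr// dotp_ge0. Qed.

Lemma enormN x : enorm (- x) = enorm x.
Proof. by rewrite !enormE dotpNl dotpNr opprK. Qed.

Lemma enormZ a x : enorm (a *: x) = `|a| * enorm x.
Proof.
by rewrite !enormE dotpZl dotpZr mulrA -expr2 sqrtrM ?sqr_ge0// sqrtr_sqr.
Qed.

Lemma enorm0 : enorm (0 : 'rV[R]_d) = 0.
Proof. by rewrite enormE dotp0l sqrtr0. Qed.

Lemma enorm_lt x y : (enorm x < enorm y) = (dotp x x < dotp y y).
Proof. by rewrite -!sqr_enorm ltr_pXn2r// nnegrE enorm_ge0. Qed.

Lemma enorm_le x y : (enorm x <= enorm y) = (dotp x x <= dotp y y).
Proof. by rewrite -!sqr_enorm ler_pXn2r// nnegrE enorm_ge0. Qed.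

Lemma mx_norm_lt_coord x r : 0 < r -> `|x| < r <-> forall i, `|x ord0 i| < r.
Proof.
move=> r0; rewrite -[`|x|]/(mx_norm x) mx_normrE; split => [/bigmax_ltP[_ xr] i|xr].
  exact: (xr (ord0, i)).
by apply/bigmax_ltP; split => // -[i j] _ /=; rewrite (ord1 i).
Qed.

Lemma coord_le_norm x i : `|x ord0 i| <= `|x|.
Proof. by rewrite -[`|x|]/(mx_norm x) mx_normrE; exact: (le_bigmax _ _ (ord0, i)). Qed.

Lemma norm_le_enorm x : `|x| <= enorm x.
Proof.
rewrite -[`|x|]/(mx_norm x) mx_normrE; apply/bigmax_leP; split; first exact: enorm_ge0.
move=> -[i j] _ /=; rewrite (ord1 i).
by rewrite -(@ler_pXn2r _ 2)// ?nnegrE ?enorm_ge0// sqr_enorm real_normK ?num_real// coord_dotp_le.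
Qed.

Lemma enorm_le_norm x : enorm x <= d%:R * `|x|.
Proof.
rewrite -(@ler_pXn2r _ 2)// ?nnegrE ?enorm_ge0// ?mulr_ge0// sqr_enorm.
apply: (@le_trans _ _ (\sum_(i < d) `|x| ^+ 2)).
  apply: ler_sum => i _; rewrite -expr2 -real_normK ?num_real//.
  by rewrite ler_pXn2r// ?nnegrE// coord_le_norm.
rewrite sumr_const card_ord -[X in X <= _]mulr_natl exprMn ler_wpM2r ?sqr_ge0//.
by rewrite expr2 -natrM ler_nat; case: (d) => // n; rewrite leq_pmulr.
Qed.

Lemma dotp_eq0 x : dotp x x = 0 -> x = 0.
Proof.
move=> x0; have : `|x| <= 0 by rewrite (le_trans (norm_le_enorm _))// enormE x0 sqrtr0.
by rewrite normr_le0 => /eqP.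
Qed.

Lemma dotp_le_norm x y : `|dotp x y| <= `|x| * (d%:R * `|y|).
Proof.
apply: (le_trans (ler_norm_sum _ _ _)).
apply: (@le_trans _ _ (\sum_(i < d) `|x| * `|y|)).
  by apply: ler_sum => i _; rewrite normrM ler_pM// coord_le_norm.
by rewrite sumr_const card_ord -[X in X <= _]mulr_natl mulrCA.
Qed.

(** Reflection in the hyperplane x.e = l, for a unit vector [e]. *)
Definition hrefl e l x : 'rV[R]_d := x - (2 * (dotp x e - l)) *: e.

Section hrefl.
Variable e : 'rV[R]_d.
Hypothesis e1 : dotp e e = 1.

Lemma dotp_hrefl l x : dotp (hrefl e l x) e = 2 * l - dotp x e.
Proof. by rewrite /hrefl dotpBl dotpZl e1; ring. Qed.

Lemma hreflK l : involutive (hrefl e l).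
Proof.
move=> x; rewrite {1}/hrefl dotp_hrefl /hrefl -addrA -opprD -scalerDl.
by rewrite [X in X *: _](_ : _ = 0) ?scale0r ?subr0//; ring.
Qed.

Lemma hreflB l x y : hrefl e l x - hrefl e l y = hrefl e 0 (x - y).
Proof.
rewrite /hrefl dotpBl opprD opprK addrACA; congr (_ + _).
by rewrite -![- (_ *: e)]scaleNr -scalerDl; congr (_ *: _); ring.
Qed.

Lemma dotp_hrefl0 x : dotp (hrefl e 0 x) (hrefl e 0 x) = dotp x x.
Proof. by rewrite /hrefl !(dotpBl,dotpBr,dotpZl,dotpZr) e1 (dotpC e x); ring. Qed.

Lemma enorm_hreflB l x y : enorm (hrefl e l x - hrefl e l y) = enorm (x - y).
Proof. by rewrite hreflB !enormE dotp_hrefl0. Qed.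

Lemma hrefl_comp l l' x : hrefl e l (hrefl e l' x) = x + (2 * (l - l')) *: e.
Proof.
rewrite {1}/hrefl dotp_hrefl /hrefl -addrA; congr (_ + _).
by rewrite -opprD -scalerDl -scaleNr; congr (_ *: _); ring.
Qed.

Lemma hreflE l x : hrefl e l x = hrefl e 0 x + (2 * l) *: e.
Proof.
rewrite /hrefl -addrA; congr (_ + _).
by rewrite -![- (_ *: e)]scaleNr -scalerDl; congr (_ *: _); ring.
Qed.

Lemma hrefl0D x y : hrefl e 0 (x + y) = hrefl e 0 x + hrefl e 0 y.
Proof.
rewrite /hrefl dotpDl addrACA; congr (_ + _).
by rewrite -![- (_ *: e)]scaleNr -scalerDl; congr (_ *: _); ring.
Qed.

Lemma hrefl_shift l x t : hrefl e l (x + t *: e) = hrefl e l x - t *: e.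
Proof.
rewrite /hrefl dotpDl dotpZl e1 mulr1 -!addrA; congr (_ + _).
by rewrite -![- (_ *: e)]scaleNr -!scalerDl; congr (_ *: _); ring.
Qed.

(** The squared distances differ by 4 (x.e - l) (y.e - l), a product of two negative factors. *)
Lemma hrefl_far l x y : dotp x e < l -> dotp y e < l ->
  enorm (x - y) < enorm (hrefl e l x - y).
Proof.
move=> xl yl; rewrite enorm_lt -subr_gt0.
have -> : hrefl e l x - y = (x - y) - (2 * (dotp x e - l)) *: e.
  by rewrite /hrefl addrAC.
rewrite [X in X - _](_ : _ = dotp (x - y) (x - y) +
    4 * ((dotp x e - l) * (dotp y e - l))); last first.
  have := dotpBl x y e; move: (x - y) => w wE.
  by rewrite !(dotpBl, dotpBr, dotpZl, dotpZr) e1 (dotpC e) wE; ring.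
by rewrite addrAC subrr add0r mulr_gt0// nmulr_rgt0 subr_lt0.
Qed.

End hrefl.
End euclid.

(** * Borel measurability of the vector operations *)

Section measurability.
Context {R : realType}.
Local Notation mR := (measurableTypeR R).

Lemma measurable_coord d (i : 'I_d) :
  measurable_fun [set: 'rV[R]_d] (fun x => x ord0 i).
Proof. exact: measurable_rV_coord. Qed.

Lemma measurable_dotp d (e : 'rV[R]_d) :
  measurable_fun [set: 'rV[R]_d] (fun x => dotp x e).
Proof.
apply: measurable_sum => i; apply: measurable_funM => //.
exact: measurable_coord.
Qed.

Lemma measurable_rVD d : measurable_fun [set: 'rV[R]_d * 'rV[R]_d] (fun p => p.1 + p.2).
Proof.
apply: measurable_fun_rVP => i.
rewrite (_ : _ \o _ = fun p : 'rV[R]_d * 'rV[R]_d => p.1 ord0 i + p.2 ord0 i); last first.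
  by apply/funext => p /=; rewrite /rV_coord mxE.
apply: measurable_funD.
  by apply: (measurableT_comp (measurable_coord i)).
by apply: (measurableT_comp (measurable_coord i)).
Qed.

Lemma measurable_rVB d : measurable_fun [set: 'rV[R]_d * 'rV[R]_d] (fun p => p.1 - p.2).
Proof.
apply: measurable_fun_rVP => i.
rewrite (_ : _ \o _ = fun p : 'rV[R]_d * 'rV[R]_d => p.1 ord0 i - p.2 ord0 i); last first.
  by apply/funext => p /=; rewrite /rV_coord !mxE.
apply: measurable_funB.
  by apply: (measurableT_comp (measurable_coord i)).
by apply: (measurableT_comp (measurable_coord i)).
Qed.

Lemma measurable_rV_shift d (z : 'rV[R]_d) : measurable_fun [set: 'rV[R]_d] (fun x => x + z).
Proof.
apply: measurable_fun_rVP => i.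
rewrite (_ : _ \o _ = fun x : 'rV[R]_d => x ord0 i + z ord0 i); last first.
  by apply/funext => p /=; rewrite /rV_coord !mxE.
by apply: measurable_funD => //; exact: measurable_coord.
Qed.

Lemma measurable_rV_opp d : measurable_fun [set: 'rV[R]_d] (fun x => - x).
Proof.
apply: measurable_fun_rVP => i.
rewrite (_ : _ \o _ = fun x : 'rV[R]_d => - x ord0 i); last first.
  by apply/funext => p /=; rewrite /rV_coord !mxE.
by apply: measurableT_comp => //; exact: measurable_coord.
Qed.

Lemma measurable_rV_subl d (x : 'rV[R]_d) : measurable_fun [set: 'rV[R]_d] (fun y => x - y).
Proof.
rewrite (_ : (fun y => x - y) = (fun y => y + x) \o -%R); last first.
  by apply/funext => y /=; rewrite addrC.
by apply: measurableT_comp; [exact: measurable_rV_shift|exact: measurable_rV_opp].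
Qed.

Lemma measurable_hrefl d (e : 'rV[R]_d) l : measurable_fun [set: 'rV[R]_d] (hrefl e l).
Proof.
apply: measurable_fun_rVP => i.
rewrite (_ : _ \o _ = fun x : 'rV[R]_d => x ord0 i - (2 * (dotp x e - l)) * e ord0 i);
  last first.
  by apply/funext => p /=; rewrite /rV_coord !mxE.
apply: measurable_funB; first exact: measurable_coord.
apply: measurable_funM => //; apply: measurable_funM => //.
by apply: measurable_funB => //; exact: measurable_dotp.
Qed.

Lemma measurable_enorm d : measurable_fun [set: 'rV[R]_d] enorm.
Proof.
rewrite /enorm.
apply: (@measurableT_comp _ _ _ _ _ _ (@Num.sqrt R)).
  by apply: continuous_measurable_fun => x; exact: sqrt_continuous.
apply: measurable_sum => i; apply: measurable_funX; exact: measurable_coord.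
Qed.

End measurability.

(** * Boxes, balls and a countable base *)

Section rV_basis.
Context {R : realType} {d : nat}.
Local Notation E := 'rV[R]_d.

Lemma ball_rVE (x : E) r : ball x r = [set y | `|x - y| < r].
Proof. by rewrite mx_norm_ball. Qed.

Lemma continuous_rV_epsilon (f : E -> R) :
  (forall x eps, 0 < eps ->
    exists2 del, 0 < del & forall y, `|y - x| < del -> `|f y - f x| < eps) ->
  continuous f.
Proof.
move=> H x B /nbhs_ballP[eps /= eps0 epsB].
have [del del0 fdel] := H x eps eps0.
apply/nbhs_ballP; exists del => //= y xy; apply: epsB.
rewrite -ball_normE/= distrC; apply: fdel.
by move: xy; rewrite ball_rVE/= distrC.
Qed.

Lemma continuous_rV_norm (f : E -> R) x eps : continuous f -> 0 < eps ->
  exists2 del, 0 < del & forall y, `|y - x| < del -> `|f y - f x| < eps.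
Proof.
move=> fc eps0; have := fc x (ball (f x) eps) (nbhsx_ballx _ _ eps0).
move=> /nbhs_ballP[r /= r0 H]; exists r => // y yx.
have xy : ball x r y by rewrite ball_rVE/= distrC.
by have := H y xy; rewrite /preimage/= -ball_normE/= distrC.
Qed.

Definition box (A : 'I_d -> set R) : set E := [set x | forall i, A i (x ord0 i)].

Lemma box_bigcap A : box A = \big[setI/setT]_(i < d) ((fun x : E => x ord0 i) @^-1` A i).
Proof.
apply/seteqP; split => x; rewrite -bigcap_seq => Ax i; first by move=> _; exact: Ax.
by apply: Ax; rewrite /= mem_index_enum.
Qed.

Lemma measurable_box A : (forall i, measurable (A i)) -> measurable (box A).
Proof.
move=> mA; rewrite box_bigcap; apply: bigsetI_measurable => i _.
by rewrite -[X in measurable X]setTI; exact: measurable_coord.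
Qed.

Lemma ball_box (x : E) r : 0 < r -> ball x r = box (fun i => `]x ord0 i - r, x ord0 i + r[%classic).
Proof.
move=> r0; rewrite ball_rVE; apply/seteqP; split => y /=.
  by move=> /(mx_norm_lt_coord _ r0) xy i /=; have := xy i; rewrite !mxE in_itv/= ltr_distlC.
by move=> xy; apply/(mx_norm_lt_coord _ r0) => i; have := xy i; rewrite /= !mxE in_itv/= ltr_distlC.
Qed.

Lemma ball_rV0 (x : E) r : r <= 0 -> ball x r = set0.
Proof. by move=> r0; apply/seteqP; split => // y; rewrite ball_rVE/= ltNge (le_trans r0). Qed.

Lemma measurable_ball_rV (x : E) r : measurable (ball x r).
Proof.
have [r0|r0] := leP r 0; first by rewrite ball_rV0.
by rewrite ball_box//; apply: measurable_box => i; exact: measurable_itv.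
Qed.

(** A countable base of the topology: [n] encodes a rational center and a radius 1/(m+1), and a
    number that encodes nothing gives the empty set. It puts open sets in the sigma-algebra
    generated by the coordinates and reduces local nullity to countable unions. *)
Definition rat_ball (n : nat) : set E :=
  if @unpickle ('rV[rat]_d * nat)%type n is Some p then
    ball (map_mx ratr p.1 : E) (p.2.+1%:R^-1) else set0.

Lemma measurable_rat_ball n : measurable (rat_ball n).
Proof. by rewrite /rat_ball; case: unpickle => // p; exact: measurable_ball_rV. Qed.

Lemma open_rat_ball (A : set E) x : open A -> A x -> exists2 n, rat_ball n x & rat_ball n `<=` A.
Proof.
move=> oA Ax; have : nbhs x A by exact: open_nbhs_nbhs.
move=> /nbhs_ballP[e /= e0 xeA].
have [n /= ne] : exists n : nat, n.+1%:R^-1 < e / 2.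
  have [n _ /(_ _ (leqnn n))] := near_infty_natSinv_lt (PosNum (divr_gt0 e0 (ltr0n _ 2))).
  by exists n.
have qP i : exists q : rat, `|x ord0 i - ratr q| < n.+1%:R^-1.
  have [q] : exists q : rat, ratr q \in `]x ord0 i - n.+1%:R^-1, x ord0 i + n.+1%:R^-1[.
    by apply: rat_in_itvoo; rewrite -subr_gt0 opprD opprK addrACA subrr add0r addr_gt0.
  by rewrite in_itv/= => qx; exists q; rewrite distrC ltr_distl.
pose q : 'rV[rat]_d := \row_i xchoose (qP i).
have xq : `|map_mx ratr q - x| < n.+1%:R^-1.
  apply/mx_norm_lt_coord => // i; rewrite !mxE distrC; exact: (xchooseP (qP i)).
exists (pickle (q, n)); rewrite /rat_ball pickleK /=; first by rewrite ball_rVE.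
move=> y; rewrite ball_rVE/= => qy; apply: xeA; rewrite ball_rVE/=.
rewrite -(subrKA (map_mx ratr q)) (le_lt_trans (ler_normD _ _))// [e]splitr ltrD//.
  by rewrite distrC (lt_trans xq).
by rewrite (lt_trans qy).
Qed.

Lemma open_bigcup_rat_ball (A : set E) : open A ->
  A = \bigcup_(n in [set n | rat_ball n `<=` A]) rat_ball n.
Proof.
move=> oA; apply/seteqP; split => [x Ax|x [n /= nA]]; last exact: nA.
by have [n nx nA] := open_rat_ball oA Ax; exists n.
Qed.

Lemma open_measurable_rV (A : set E) : open A -> measurable A.
Proof.
move=> /open_bigcup_rat_ball ->; apply: bigcup_measurable => n _.
exact: measurable_rat_ball.
Qed.

Lemma continuous_measurable_rV (f : E -> R) : continuous f -> measurable_fun setT f.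
Proof.
move=> fc; apply: (measurability _ (RGenOInfty.measurableE R)) => _ [_ [a ->] <-].
rewrite setTI; apply: open_measurable_rV; apply: open_comp; first by move=> x _; exact: fc.
rewrite (_ : mkset _ = [set r | a < r]); first exact: open_gt.
by apply/seteqP; split => r /=; rewrite in_itv/= andbT.
Qed.

Lemma measurable_sublevel (f : E -> R) r :
  measurable_fun setT f -> measurable [set x | f x < r].
Proof.
move=> mf; rewrite (_ : mkset _ = f @^-1` `]-oo, r[%classic); last first.
  by apply/seteqP; split => x /=; rewrite in_itv.
by rewrite -[X in measurable X]setTI; apply: mf => //; exact: measurable_itv.
Qed.

Lemma measurable_sublevelW (f : E -> R) r :
  measurable_fun setT f -> measurable [set x | f x <= r].
Proof.
move=> mf; rewrite (_ : mkset _ = f @^-1` `]-oo, r]%classic); last first.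
  by apply/seteqP; split => x /=; rewrite in_itv.
by rewrite -[X in measurable X]setTI; apply: mf => //; exact: measurable_itv.
Qed.

Lemma measurable_eball (x : E) r : measurable (eball x r).
Proof.
rewrite (_ : eball x r = (fun y => y + (- x)) @^-1` [set y | enorm y < r])//.
rewrite -[X in measurable X]setTI; apply: measurable_rV_shift => //.
by apply: measurable_sublevel; exact: measurable_enorm.
Qed.

(** A constant standing for the recursively defined Borel measure, so that sigma-finiteness,
    required by Tonelli, can be attached to it. *)
Definition lebd : set E -> \bar R := rV_borel_measure d.
HB.instance Definition _ := Measure.on lebd.

Lemma lebd_box A : (forall i, measurable (A i)) ->
  lebd (box A) = (\prod_(i < d) lebesgue_measure (A i : set (measurableTypeR R)))%E.
Proof. by move=> mA; rewrite -rV_borel_measure_box. Qed.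

Lemma prodEFin (F : 'I_d -> R) : (\prod_(i < d) (F i)%:E = (\prod_(i < d) F i)%:E)%E.
Proof. by elim/big_rec2: _ => // i a b _ ->. Qed.

Lemma lebd_ball x r : 0 < r -> lebd (ball x r) = ((2 * r) ^+ d)%:E.
Proof.
move=> r0; rewrite ball_box// lebd_box//.
under eq_bigr => i _.
  rewrite lebesgue_measure_itv/= lte_fin -subr_gt0 opprD opprK addrACA subrr add0r addr_gt0//.
  rewrite -EFinD (_ : _ + _ = 2 * r); last by ring.
  over.
by rewrite prodEFin prodr_const card_ord.
Qed.

Lemma lebd_sigma_finite : sigma_finite setT lebd.
Proof.
exists (fun n => ball (0 : E) n.+1%:R).
  apply/esym/seteqP; split => // x _; exists (Num.truncn `|x|) => //.
  by rewrite ball_rVE/= sub0r normrN truncnS_gt.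
move=> n; split; first exact: measurable_ball_rV.
by rewrite lebd_ball// ltry.
Qed.

HB.instance Definition _ := Measure_isSigmaFinite.Build _ _ _ lebd lebd_sigma_finite.

End rV_basis.
Arguments lebd {R} d.

(** * Invariance of Lebesgue measure *)

Section pushforward.
Context {R : realType} {d : nat}.
Local Notation E := 'rV[R]_d.

Definition push (f : E -> E) (mf : measurable_fun setT f) : {measure set E -> \bar R} :=
  measure_function_pushforward__canonical__measure_function_Measure (lebd d) mf.

Lemma pushE f mf A : @push f mf A = lebd d (f @^-1` A).
Proof. by []. Qed.

Lemma rV_measurableE : measurable =
  <<s [set B : set E | exists2 A : 'I_d -> set R, (forall i, measurable (A i)) & B = box A] >>.
Proof.
apply/seteqP; split; last first.
  apply: smallest_sub; first exact: sigma_algebra_measurable.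
  by move=> _ [A mA ->]; exact: measurable_box.
apply: smallest_sub; first exact: smallest_sigma_algebra.
move=> B; rewrite -bigcup_seq => -[i _ [A mA]]; rewrite setTI => <-.
apply: sub_sigma_algebra; exists (fun j => if j == i then A else setT).
  by move=> j; case: ifP => // _; exact: measurableT.
apply/seteqP; split => [x Ax j|x /(_ i)]; last by rewrite eqxx.
by case: eqP => // ->.
Qed.

(** Boxes are stable under intersection and generate the Borel sets; the balls of integer radius are
    boxes of finite measure exhausting the space. *)
Lemma lebd_unique (m : {measure set E -> \bar R}) :
  (forall A : 'I_d -> set R, (forall i, measurable (A i)) -> m (box A) = lebd d (box A)) ->
  forall A, measurable A -> m A = lebd d A.
Proof.
move=> mbox A mA.
apply/esym/(measure_unique [set B : set E | exists2 A : 'I_d -> set R, (forall i, measurable (A i))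
    & B = box A] (fun n => ball 0 n.+1%:R)) => //.
- exact: rV_measurableE.
- move=> _ _ [B mB ->] [C mC ->]; exists (fun i => B i `&` C i).
    by move=> i; exact: measurableI.
  apply/seteqP; split => [x [Bx Cx] i|x BCx]; first by split; [exact: Bx|exact: Cx].
  by split => i; case: (BCx i).
- move=> n; rewrite ball_box//; eexists; last reflexivity.
  by move=> i; exact: measurable_itv.
- apply/seteqP; split => // x _; exists (Num.truncn `|x|) => //.
  by rewrite ball_rVE/= sub0r normrN truncnS_gt.
- by move=> _ [B mB ->]; exact/esym/mbox.
- by move=> n; rewrite /= lebd_ball// ltry.
Qed.

Lemma lebesgue_shift (z : R) (A : set R) : measurable A ->
  lebesgue_measure ((fun x : R => x + z) @^-1` A : set (measurableTypeR R)) =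
  lebesgue_measure (A : set (measurableTypeR R)).
Proof.
move=> mA; have mz : measurable_fun [set: measurableTypeR R] ((fun x => x + z) : _ -> measurableTypeR R).
  by apply: measurable_funD.
apply/esym; apply: (@lebesgue_measure_unique R
  (measure_function_pushforward__canonical__measure_function_Measure lebesgue_measure mz)) => //.
move=> _ [[a b] _ <-] /=; rewrite /pushforward.
rewrite (_ : _ @^-1` _ = `]a - z, b - z]%classic); last first.
  by apply/seteqP; split => x /=; rewrite !in_itv/= ltrBlDr lerBrDr.
rewrite !lebesgue_measure_itv/= !lte_fin ltrD2r; case: ifP => // _.
by rewrite -!EFinD; congr (_%:E); ring.
Qed.

Lemma lebd_shift (z : E) A : measurable A -> lebd d ((fun x => x + z) @^-1` A) = lebd d A.
Proof.
move=> mA; rewrite -(pushE (measurable_rV_shift z)); apply: lebd_unique => // {mA}A mA.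
rewrite pushE.
have -> : (fun x => x + z) @^-1` box A = box (fun i => (fun s => s + z ord0 i) @^-1` A i).
  by apply/seteqP; split => x Ax i; have := Ax i; rewrite /= mxE.
rewrite !lebd_box//; first by apply: eq_bigr => i _; rewrite lebesgue_shift.
move=> i; rewrite -[X in measurable X]setTI.
have mz : measurable_fun [set: measurableTypeR R] ((fun x => x + z ord0 i) : _ -> measurableTypeR R).
  by apply: measurable_funD.
by apply: mz => //; exact: mA.
Qed.

Lemma tonelli_indic (m1 m2 : {sigma_finite_measure set E -> \bar R}) (A : set (E * E)) :
  measurable A ->
  (\int[m1]_x m2 [set y | A (x, y)] = \int[m2]_y m1 [set x | A (x, y)])%E.
Proof.
move=> mA; have := indic_fubini_tonelli m1 m2 mA.
rewrite indic_fubini_tonelli_FE// indic_fubini_tonelli_GE// => AE.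
transitivity (\int[m1]_x (m2 \o xsection A) x)%E; first apply: eq_integral.
  by move=> x _ /=; congr (m2 _); apply/seteqP; split => y; rewrite /xsection/= inE.
rewrite [LHS]AE; apply: eq_integral => y _ /=.
by congr (m1 _); apply/seteqP; split => x; rewrite /ysection/= inE.
Qed.

(* Both sides equal the double integral of 1_A(x + y) 1_B(y) against m1(dx) m2(dy). *)
Lemma shift_invariant_prod (m1 m2 : {sigma_finite_measure set E -> \bar R}) (A B : set E) :
  (forall (z : E) (C : set E), measurable C -> m1 ((fun x => x + z) @^-1` C) = m1 C) ->
  (forall (z : E) (C : set E), measurable C -> m2 ((fun x => x + z) @^-1` C) = m2 C) ->
  measurable A -> measurable B ->
  (m1 A * m2 B = m2 A * m1 (-%R @^-1` B))%E.
Proof.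
move=> m1s m2s mA mB.
have mAD : measurable ((fun p : E * E => p.1 + p.2) @^-1` A).
  by rewrite -[X in measurable X]setTI; exact: measurable_rVD.
have mBs : measurable (snd @^-1` B : set (E * E)).
  by rewrite -[X in measurable X]setTI; exact: measurable_snd.
have mBB : measurable ((fun p : E * E => p.2 - p.1) @^-1` B).
  rewrite -[X in measurable X]setTI.
  rewrite (_ : (fun p : E * E => p.2 - p.1) = (fun p : E * E => p.1 - p.2) \o @unstable.swap E E)//.
  apply: measurableT_comp => //; first exact: measurable_rVB.
  exact: measurable_swap.
have mAs : measurable (snd @^-1` A : set (E * E)).
  by rewrite -[X in measurable X]setTI; exact: measurable_snd.
have iC (m : {measure set E -> \bar R}) (C : set E) (k : \bar R) : measurable C -> (0 <= k)%E ->
    (\int[m]_x ((\1_C x)%:E * k) = m C * k)%E.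
  move=> mC k0; rewrite ge0_integralZr//; last exact/measurable_EFinP.
  by rewrite integral_indic// setIT.
have iE (m : {measure set E -> \bar R}) (C D : set E) x :
    m ([set y | C y] `&` [set y | D x]) = ((\1_D x)%:E * m C)%E.
  rewrite indicE; case: (boolP (x \in D)) => [/set_mem Dx|/negP Dx].
    by rewrite mul1e; congr (m _); apply/seteqP; split => // y [].
  rewrite mul0e (_ : _ `&` _ = set0) ?measure0//.
  by apply/seteqP; split => // y [_ /= /mem_set].
have e1 := tonelli_indic m1 m2 (measurableI _ _ mAD mBs).
have e2 := tonelli_indic m1 m2 (measurableI _ _ mAs mBB).
transitivity (\int[m2]_y m1 [set x | A (x + y)%R /\ B y])%E.
  rewrite muleC -(iC m2)//; apply: eq_integral => y _.
  by rewrite -(m1s y A)// -iE.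
rewrite [LHS](_ : _ = \int[m1]_x m2 [set y | A (x + y)%R /\ B y])%E; last exact/esym/e1.
transitivity (\int[m1]_x m2 [set y | A y /\ B (y - x)%R])%E.
  apply: eq_integral => x _; rewrite -(m2s x [set y | A y /\ B (y - x)]).
    by congr (m2 _); apply/seteqP; split => y; rewrite /= addrK (addrC x).
  apply: measurableI => //; rewrite -[X in measurable X]setTI.
  by apply: measurable_rV_shift.
rewrite [LHS](_ : _ = \int[m2]_y m1 [set x | A y /\ B (y - x)%R])%E; last exact: e2.
have mB' : measurable (-%R @^-1` B).
  by rewrite -[X in measurable X]setTI; apply: measurable_rV_opp.
rewrite -(iC m2)//; apply: eq_integral => y _.
rewrite -iE -[RHS](m1s (- y)); last first.
  rewrite (_ : _ `&` _ = if `[< A y >] then -%R @^-1` B else set0).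
    by case: ifP.
  by apply/seteqP; split => x /=; case: asboolP => Ay //= [].
by congr (m1 _); apply/seteqP; split => x /=; rewrite opprD opprK (addrC (- x)) => -[].
Qed.


End pushforward.

Section hrefl_invariance.
Context {R : realType} {d : nat}.
Local Notation E := 'rV[R]_d.
Local Notation mu := (lebd d).

Lemma measurable_hrefl_preimage (e : E) l A : measurable A -> measurable (hrefl e l @^-1` A).
Proof. by move=> mA; rewrite -[X in measurable X]setTI; exact: measurable_hrefl. Qed.

Lemma eball_sub_ball (x : E) r : eball x r `<=` ball x r.
Proof.
by move=> y /= xy; rewrite ball_rVE/= distrC (le_lt_trans (norm_le_enorm _)).
Qed.

Lemma ball_sub_eball (x : E) r : 0 < r -> ball x r `<=` eball x (d.+1%:R * r).
Proof.
move=> r0 y; rewrite ball_rVE/= distrC => xy.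
rewrite /eball/= (le_lt_trans (enorm_le_norm _))//.
rewrite (@le_lt_trans _ _ (d%:R * r))//; first by rewrite ler_wpM2l// ltW.
by rewrite ltr_pM2r// ltr_nat.
Qed.

Lemma lebd_eball_lty (x : E) r : (mu (eball x r) < +oo)%E.
Proof.
apply: (@le_lt_trans _ _ (mu (ball x (`|r| + 1)))); last first.
  by rewrite lebd_ball ?ltry// ltr_wpDl.
apply: le_measure; rewrite ?inE; [exact: measurable_eball|exact: measurable_ball_rV|].
move=> y yr; apply: eball_sub_ball; apply: (lt_le_trans yr).
by rewrite (le_trans (ler_norm _))// lerDl.
Qed.

Lemma lebd_eball_gt0 (x : E) r : 0 < r -> (0 < mu (eball x r))%E.
Proof.
move=> r0; have r'0 : 0 < r / d.+1%:R by rewrite divr_gt0.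
apply: (@lt_le_trans _ _ (mu (ball x (r / d.+1%:R)))).
  by rewrite lebd_ball// lte_fin exprn_gt0// mulr_gt0.
apply: le_measure; rewrite ?inE; [exact: measurable_ball_rV|exact: measurable_eball|].
by move=> y /(ball_sub_eball r'0); rewrite mulrC divfK.
Qed.

(** The image of Lebesgue measure under the reflection is again translation invariant, hence
    proportional to it by [shift_invariant_prod]. The Euclidean unit ball is preserved and has
    finite positive measure, so the factor is 1; no determinant is involved. *)
Lemma lebd_hrefl0 (e : E) A : dotp e e = 1 -> measurable A ->
  mu (hrefl e 0 @^-1` A) = mu A.
Proof.
move=> e1 mA.
have sf : sigma_finite setT (push (measurable_hrefl e 0)).
  have [F TF mF] := @lebd_sigma_finite R d.
  exists (fun n => hrefl e 0 @^-1` F n).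
    by rewrite -preimage_bigcup -TF preimage_setT.
  move=> n; have [mFn Fn] := mF n; split; first exact: measurable_hrefl_preimage.
  rewrite pushE (_ : _ @^-1` _ = F n)//.
  by apply/seteqP; split => x /=; rewrite hreflK.
pose m2 : {sigma_finite_measure set E -> \bar R} :=
  HB.pack_for (SigmaFiniteMeasure.type E R) (Measure.sort (push (measurable_hrefl e 0)))
    (Measure_isSigmaFinite.Build _ _ _ _ sf).
have m2E C : m2 C = mu (hrefl e 0 @^-1` C) by [].
have := @shift_invariant_prod R d mu m2 A (eball 0 1).
have -> : -%R @^-1` eball (0 : E) 1 = eball 0 1.
  by apply/seteqP; split => x; rewrite /eball/= !subr0 enormN.
rewrite !m2E.
have -> : hrefl e 0 @^-1` eball (0 : E) 1 = eball 0 1.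
  by apply/seteqP; split => x; rewrite /eball/= !subr0 !enormE dotp_hrefl0.
have mus (z : E) (C : set E) : measurable C -> mu ((fun x => x + z) @^-1` C) = mu C.
  by move=> mC; exact: lebd_shift.
have m2s (z : E) (C : set E) : measurable C -> m2 ((fun x => x + z) @^-1` C) = m2 C.
  move=> mC; rewrite !m2E -[RHS](lebd_shift (hrefl e 0 z)); last exact: measurable_hrefl_preimage.
  congr (mu _); apply/seteqP; split => x /=; congr (C _).
    by rewrite hrefl0D hreflK.
  by rewrite hrefl0D hreflK.
move=> /(_ mus m2s mA (measurable_eball _ _)) H; apply/esym.
have [r r0 rE] : exists2 r, 0 < r & mu (eball (0 : E) 1) = r%:E.
  have := lebd_eball_lty (0 : E) 1; have := lebd_eball_gt0 (0 : E) ltr01.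
  by case: (mu _) => [r| |]//; rewrite lte_fin => r0 _; exists r.
have Er (k : \bar R) : k = (k * r%:E * (r^-1)%:E)%E.
  by rewrite -muleA -EFinM mulfV ?mule1// gt_eqF.
by rewrite [LHS]Er [RHS]Er -rE H.
Qed.

Lemma lebd_hrefl (e : E) l A : dotp e e = 1 -> measurable A ->
  mu (hrefl e l @^-1` A) = mu A.
Proof.
move=> e1 mA; rewrite -[RHS](lebd_shift ((2 * l) *: e))// -[RHS](lebd_hrefl0 e1).
  by congr (mu _); apply/seteqP; split => x; rewrite /= (hreflE e l).
by rewrite -[X in measurable X]setTI; apply: measurable_rV_shift.
Qed.

End hrefl_invariance.

(** * Volume of bounded Borel sets *)

Section volume.
Context {R : realType} {d : nat}.
Local Notation E := 'rV[R]_d.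
Local Notation mu := (lebd d).
Implicit Types (A B C : set E) (x y z e : E).

Definition bborel A := measurable A /\ exists M : R, forall x, A x -> `|x| < M.

(* On a set of infinite measure vol is 0; it is only meaningful on bounded Borel sets. *)
Definition vol A : R := fine (mu A).

Lemma bborel_measurable A : bborel A -> measurable A. Proof. by case. Qed.

Lemma sub_bborel A B : bborel B -> measurable A -> A `<=` B -> bborel A.
Proof. by move=> [_ [M BM]] mA AB; split => //; exists M => x /AB; exact: BM. Qed.

Lemma bborelI A B : bborel A -> measurable B -> bborel (A `&` B).
Proof.
move=> bA mB; apply: (sub_bborel bA) => [|x []//].
by apply: measurableI => //; exact: bborel_measurable.
Qed.

Lemma bborelIr A B : measurable A -> bborel B -> bborel (A `&` B).
Proof. by rewrite setIC => *; exact: bborelI. Qed.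

Lemma bborelD A B : bborel A -> measurable B -> bborel (A `\` B).
Proof.
move=> bA mB; apply: (sub_bborel bA) => [|x []//].
by apply: measurableD => //; exact: bborel_measurable.
Qed.

Lemma bborelU A B : bborel A -> bborel B -> bborel (A `|` B).
Proof.
move=> [mA [M AM]] [mB [N BN]]; split; first exact: measurableU.
by exists (Num.max M N) => x [/AM|/BN] h; rewrite lt_max h ?orbT.
Qed.

Lemma bborel0 : bborel set0.
Proof. by split => //; exists 0. Qed.

Lemma bborel_ball x r : bborel (ball x r).
Proof.
split; first exact: measurable_ball_rV.
exists (r + `|x|) => y; rewrite ball_rVE/= distrC => xy.
by rewrite -(subrK x y) (le_lt_trans (ler_normD _ _))// ltrD2r.
Qed.

Lemma bborel_lty A : bborel A -> (mu A < +oo)%E.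
Proof.
move=> [mA [M AM]]; apply: (@le_lt_trans _ _ (mu (ball 0 (`|M| + 1)))); last first.
  by rewrite lebd_ball ?ltry// ltr_wpDl.
apply: le_measure; rewrite ?inE//; first exact: measurable_ball_rV.
move=> x /AM xM; rewrite ball_rVE/= sub0r normrN (lt_le_trans xM)//.
by rewrite (le_trans (ler_norm _))// lerDl.
Qed.

Lemma volE A : bborel A -> mu A = (vol A)%:E.
Proof.
move=> bA; rewrite /vol fineK// fin_numElt bborel_lty// andbT.
by rewrite (lt_le_trans (ltNyr 0)).
Qed.

Lemma vol_ge0 A : 0 <= vol A.
Proof. by rewrite fine_ge0. Qed.

Lemma vol0 : vol set0 = 0.
Proof. by rewrite /vol measure0. Qed.

Lemma le_vol A B : bborel B -> measurable A -> A `<=` B -> vol A <= vol B.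
Proof.
move=> bB mA AB; have bA := sub_bborel bB mA AB.
rewrite -lee_fin -!volE//; apply: le_measure; rewrite ?inE//.
exact: bborel_measurable.
Qed.

Lemma volDI A B : bborel A -> measurable B -> vol A = vol (A `\` B) + vol (A `&` B).
Proof.
move=> bA mB; have bI := bborelI bA mB; have bD := bborelD bA mB.
apply: EFin_inj; rewrite EFinD -!volE//.
by rewrite -measureDI//; exact: bborel_measurable.
Qed.

Lemma volU A B : bborel A -> bborel B -> [disjoint A & B] -> vol (A `|` B) = vol A + vol B.
Proof.
move=> bA bB AB; rewrite (volDI (bborelU bA bB) (bborel_measurable bB)); congr (vol _ + vol _).
  rewrite setDUl setDv setU0; apply/seteqP; split => [x []//|x Ax]; split => // Bx.
  by move/disj_set2P: AB => /seteqP[/(_ x)] + _; apply.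
by apply/seteqP; split => [x []//|x Bx]; split => //; right.
Qed.

Lemma vol_le_add A B C : bborel B -> bborel C -> measurable A -> A `<=` B `|` C ->
  vol A <= vol B + vol C.
Proof.
move=> bB bC mA ABC; have bA := sub_bborel (bborelU bB bC) mA ABC.
rewrite (volDI bA (bborel_measurable bC)); apply: lerD.
  apply: le_vol => //; first by apply: measurableD => //; exact: bborel_measurable.
  by move=> x [/ABC[]].
by apply: le_vol => //; apply: measurableI => //; exact: bborel_measurable.
Qed.

Lemma vol_ball x r : 0 < r -> vol (ball x r) = (2 * r) ^+ d.
Proof. by move=> r0; rewrite /vol lebd_ball. Qed.

Lemma vol_ball_gt0 x r : 0 < r -> 0 < vol (ball x r).
Proof. by move=> r0; rewrite vol_ball// exprn_gt0// mulr_gt0. Qed.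

Lemma vol_eq0 A : bborel A -> vol A = 0 -> mu A = 0%E.
Proof. by move=> bA A0; rewrite volE// A0. Qed.

Lemma le_vol0 A B : bborel B -> measurable A -> A `<=` B -> vol B = 0 -> vol A = 0.
Proof.
by move=> bB mA AB B0; apply/eqP; rewrite eq_le vol_ge0 andbT -B0 le_vol.
Qed.

Definition trs z A : set E := [set y | A (y - z)].

Lemma measurable_trs z A : measurable A -> measurable (trs z A).
Proof. by move=> mA; rewrite -[X in measurable X]setTI; exact: measurable_rV_shift. Qed.

Lemma bborel_trs z A : bborel A -> bborel (trs z A).
Proof.
move=> [mA [M AM]]; split; first exact: measurable_trs.
exists (M + `|z|) => x /= /AM xM.
by rewrite -(subrK z x) (le_lt_trans (ler_normD _ _))// ltrD2r.
Qed.

Lemma lebd_trs z A : measurable A -> mu (trs z A) = mu A.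
Proof. by move=> mA; rewrite -[RHS](lebd_shift (- z)). Qed.

Lemma vol_trs z A : measurable A -> vol (trs z A) = vol A.
Proof. by move=> mA; rewrite /vol lebd_trs. Qed.

Lemma trs_comp z w A : trs z (trs w A) = trs (w + z) A.
Proof. by apply/seteqP; split => x; rewrite /trs/= opprD addrA addrAC. Qed.

Lemma trs0 A : trs 0 A = A.
Proof. by apply/seteqP; split => x; rewrite /trs/= subr0. Qed.

Lemma trsI z A B : trs z (A `&` B) = trs z A `&` trs z B. Proof. by []. Qed.
Lemma trsD z A B : trs z (A `\` B) = trs z A `\` trs z B. Proof. by []. Qed.

Definition mirror e l A : set E := hrefl e l @^-1` A.

Lemma measurable_mirror e l A : measurable A -> measurable (mirror e l A).
Proof. exact: measurable_hrefl_preimage. Qed.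

Lemma vol_mirror e l A : dotp e e = 1 -> measurable A -> vol (mirror e l A) = vol A.
Proof. by move=> e1 mA; rewrite /vol lebd_hrefl. Qed.

Lemma bborel_mirror e l A : dotp e e = 1 -> bborel A -> bborel (mirror e l A).
Proof.
move=> e1 [mA [M AM]]; split; first exact: measurable_mirror.
exists (d%:R * M + `|(2 * l) *: e| + 1) => x /= /AM xM.
rewrite -[in ltLHS](hreflK e1 l x) hreflE (le_lt_trans (ler_normD _ _))//.
rewrite ltr_pwDr// lerD2r (le_trans (norm_le_enorm _))// enormE dotp_hrefl0//.
by rewrite -enormE (le_trans (enorm_le_norm _))// ler_wpM2l// ltW.
Qed.

End volume.

(** * Continuity of translations in measure *)

Section translation_continuity.
Context {R : realType} {d : nat}.
Local Notation E := 'rV[R]_d.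
Local Notation mu := (lebd d).
Implicit Types (A B : set E) (x y z e : E).

Lemma vol_decr_lt (F : (set E)^nat) (eps : R) : 0 < eps -> bborel (F 0%N) ->
  (forall n, measurable (F n)) -> nonincreasing_seq F -> \bigcap_n F n = set0 ->
  exists n, vol (F n) < eps.
Proof.
move=> eps0 bF mF niF F0.
have bFn n : bborel (F n).
  by apply: (sub_bborel bF) => //; apply/subsetPset; exact: niF.
have : mu \o F @ \oo --> mu (\bigcap_n F n).
  apply: nonincreasing_cvg_mu => //; first exact: bborel_lty.
  by rewrite F0.
rewrite F0 measure0 => /fine_cvgP[_] /cvgrPdist_lt/(_ _ eps0)[n _ /(_ n (leqnn n))].
by rewrite sub0r normrN /= => nF; exists n; exact: le_lt_trans (ler_norm _) nF.
Qed.

(** The loss is measured in a window [ball 0 N] because the property has to pass to complements,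
    which are unbounded. *)
Definition shift_cont A := forall (N : nat) (eps : R), 0 < eps ->
  exists2 del, 0 < del & forall z, `|z| < del ->
    vol ((ball 0 N%:R `&` A) `\` trs z A) < eps.

(** Translating by -z turns the points that leave the complement of A into points that leave A; the
    window grows by |z| < 1, hence [N.+1]. *)
Lemma shift_contC A : measurable A -> shift_cont A -> shift_cont (~` A).
Proof.
move=> mA sA N eps eps0; have [del del0 H] := sA N.+1 eps eps0.
exists (Num.min del 1); first by rewrite lt_min del0/=.
move=> z; rewrite lt_min => /andP[zdel z1].
have mS : measurable (ball (0 : E) N%:R `&` ~` A `\` trs z (~` A)).
  apply: measurableD; first by apply: measurableI; [exact: measurable_ball_rV|exact: measurableC].
  by apply: measurable_trs; exact: measurableC.
rewrite -(vol_trs (- z) mS).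
apply: le_lt_trans (H (- z) _); last by rewrite normrN.
apply: le_vol.
- apply: bborelD; last exact: measurable_trs.
  by apply: bborelI => //; exact: bborel_ball.
- exact: measurable_trs.
move=> y [[]]; rewrite ball_rVE/= !sub0r !normrN opprK => yN nAy.
rewrite /trs/= opprK addrK => nnA; split; last exact: nAy.
split; last by apply: contrapT.
rewrite ball_rVE/= sub0r normrN -(addrK z y) (le_lt_trans (ler_normB _ _))//.
by rewrite -natr1 ltrD.
Qed.

(** By continuity from above, finitely many of the sets fill the union in the window up to eps / 2;
    the finite union is treated by induction, halving the error each time. *)
Lemma shift_cont_bigcup (F : (set E)^nat) : (forall n, measurable (F n)) ->
  (forall n, shift_cont (F n)) -> shift_cont (\bigcup_n F n).
Proof.
move=> mF sF N eps eps0.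
have e20 : 0 < eps / 2 by rewrite divr_gt0.
pose W : set E := ball 0 N%:R.
pose G n := (W `&` \bigcup_n F n) `\` \bigcup_(i in `I_n) F i.
have mU n : measurable (\bigcup_(i in `I_n) F i) by exact: bigcup_measurable.
have mUU : measurable (\bigcup_i F i) by exact: bigcupT_measurable.
have bW : bborel W := bborel_ball _ _.
have bG n : bborel (G n) by apply: bborelD => //; exact: bborelI.
have [n Gn] : exists n, vol (G n) < eps / 2.
  apply: vol_decr_lt => //.
  - by move=> n; case: (bG n).
  - move=> m n mn; apply/subsetPset => x [Wx nF]; split => // -[i /= im Fi].
    by apply: nF; exists i => //=; exact: leq_trans im mn.
  - apply/seteqP; split => // x xG; have [[_ [i _ Fi]] _] := xG 0%N I.
    by have [_] := xG i.+1 I; apply; exists i => /=.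
have [del del0 H] : exists2 del, 0 < del & forall z, `|z| < del ->
    vol ((W `&` \bigcup_(i in `I_n) F i) `\` trs z (\bigcup_(i in `I_n) F i)) < eps / 2.
  elim: n {Gn} (eps / 2) e20 => [|n IH] e' e'0.
    exists 1 => // z _; rewrite (_ : _ `\` _ = set0) ?vol0//.
    by apply/seteqP; split => // x [[_ []]].
  have e'20 : 0 < e' / 2 by rewrite divr_gt0.
  have [d1 d10 H1] := IH _ e'20; have [d2 d20 H2] := sF n N _ e'20.
  exists (Num.min d1 d2); first by rewrite lt_min d10.
  move=> z; rewrite lt_min => /andP[/H1 zd1 /H2 zd2].
  rewrite [e']splitr; apply: le_lt_trans (ltrD zd1 zd2).
  have bD A : measurable A -> bborel (W `&` A `\` trs z A).
    by move=> mA; apply: bborelD; [exact: bborelI|exact: measurable_trs].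
  apply: vol_le_add; [exact: bD|exact: bD|by case: (bD _ (mU n.+1))|].
  move=> x [[Wx [i /=]]]; rewrite ltnS leq_eqVlt => /orP[/eqP ->|iln] Fx nF.
    by right; split => // Fz; apply: nF; exists n => /=.
  left; split; first by split => //; exists i.
  by move=> [j /= jn Fj]; apply: nF; exists j => //=; exact: ltnW.
exists del => // z /H Hz; rewrite [eps]splitr; apply: le_lt_trans (ltrD Hz Gn).
apply: vol_le_add => //.
- by apply: bborelD; [exact: bborelI|exact: measurable_trs].
- by apply: measurableD; [apply: measurableI => //; case: bW|exact: measurable_trs].
move=> x [[Wx Fx] nF].
have [Fnx|] := pselect ((\bigcup_(i in `I_n) F i) x); last by right; split.
by left; split => // -[i _ Fi]; apply: nF; exists i.
Qed.

Lemma shift_cont_sigma (S : set (set E)) :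
  S `<=` measurable -> S `<=` shift_cont -> <<s S >> `<=` shift_cont.
Proof.
move=> Sm Ss; suff : <<s S >> `<=` [set A | measurable A /\ shift_cont A].
  by move=> H A /H[].
apply: smallest_sub; last by move=> A SA; split; [exact: Sm|exact: Ss].
split.
- split => // N eps eps0; exists 1 => // z _.
  rewrite (_ : _ `\` _ = set0) ?vol0//.
  by apply/seteqP; split => // x [[_ []]].
- move=> A [mA sA]; rewrite setTD; split; first exact: measurableC.
  exact: shift_contC.
- move=> F mF; split; first by apply: bigcupT_measurable => n; have [] := mF n.
  by apply: shift_cont_bigcup => n; have [] := mF n.
Qed.

(** A small translation only loses points of the slab a < x_i <= a + 1/(n+1), whose volume in the
    window tends to 0. *)
Lemma shift_cont_ray i (a : R) : shift_cont [set x : E | a < x ord0 i].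
Proof.
move=> N eps eps0.
have mray b : measurable [set x : E | b < x ord0 i].
  rewrite (_ : mkset _ = (fun x : E => x ord0 i) @^-1` `]b, +oo[%classic); last first.
    by apply/seteqP; split => x /=; rewrite in_itv/= andbT.
  by rewrite -[X in measurable X]setTI; apply: measurable_coord => //; exact: measurable_itv.
pose G n := (ball (0 : E) N%:R `&` [set x | a < x ord0 i]) `\` [set x | a + n.+1%:R^-1 < x ord0 i].
have bG n : bborel (G n).
  by apply: bborelD; [apply: bborelI; [exact: bborel_ball|exact: mray]|exact: mray].
have [n Gn] : exists n, vol (G n) < eps.
  apply: vol_decr_lt => //.
  - by move=> n; case: (bG n).
  - move=> m n mn; apply/subsetPset => x [Wx nF]; split => //= h; apply: nF => /=.
    apply: le_lt_trans h; rewrite lerD2l lef_pV2 ?posrE//.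
    by rewrite ler_nat.
  - apply/seteqP; split => // x xG; have [[_ /= ax] _] := xG 0%N I.
    have xa0 : 0 < x ord0 i - a by rewrite subr_gt0.
    have [n _ /(_ _ (leqnn n)) nx] := near_infty_natSinv_lt (PosNum xa0).
    by have [_] := xG n I; apply => /=; rewrite -ltrBrDl.
exists n.+1%:R^-1 => // z zn; apply: le_lt_trans Gn; apply: le_vol => //.
  apply: measurableD; last exact: measurable_trs.
  by apply: measurableI => //; exact: measurable_ball_rV.
move=> x [Wx /= nax]; split => //= h; apply: nax.
rewrite /trs/= !mxE ltrBrDr (le_lt_trans _ h)// lerD2l.
by apply: (le_trans (ler_norm _)); rewrite (le_trans (coord_le_norm z i))// ltW.
Qed.

(** Induction over the Borel sigma-algebra from the coordinate half-spaces, which generate it. *)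
Lemma measurable_shift_cont A : measurable A -> shift_cont A.
Proof.
pose S : set (set E) := [set B | exists i, exists a : R, B = [set x : E | a < x ord0 i]].
have Sr i b : [set x : E | b < x ord0 i] = (fun x : E => x ord0 i) @^-1` `]b, +oo[%classic.
  by apply/seteqP; split => x /=; rewrite in_itv/= andbT.
have Sm : S `<=` measurable.
  move=> _ [i [a ->]]; rewrite Sr.
  by rewrite -[X in measurable X]setTI; apply: measurable_coord => //; exact: measurable_itv.
have -> : measurable = <<s S >> :> set (set E).
  apply/seteqP; split; last by apply: smallest_sub => //; exact: sigma_algebra_measurable.
  apply: smallest_sub; first exact: smallest_sigma_algebra.
  move=> B; rewrite -bigcup_seq => -[i _ [C mC]]; rewrite setTI => <-.
  have : <<s @RGenOInfty.G R >> C.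
    by rewrite -[X in X C]/((@RGenOInfty.G R).-sigma.-measurable) -RGenOInfty.measurableE; exact: mC.
  pose H : set (set R) := [set C | <<s S >> (rV_coord i @^-1` C)].
  suff : <<s @RGenOInfty.G R >> `<=` H by apply.
  apply: smallest_sub.
    split.
    - by rewrite /H/= preimage_set0; exact: sigma_algebra0.
    - by move=> D HD; rewrite /H/= setTD preimage_setC; exact: sigma_algebraC.
    - by move=> F HF; rewrite /H/= preimage_bigcup; exact: sigma_algebra_bigcup.
  by move=> _ [a ->]; apply: sub_sigma_algebra; exists i, a; rewrite Sr.
apply: shift_cont_sigma => // _ [i [a ->]]; exact: shift_cont_ray.
Qed.

Lemma vol_shift_lt A (eps : R) : bborel A -> 0 < eps ->
  exists2 del, 0 < del & forall z, `|z| < del -> vol (A `\` trs z A) < eps.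
Proof.
move=> bA eps0; have [mA [M AM]] := bA.
have [del del0 H] := measurable_shift_cont mA (Num.truncn `|M|).+1 eps0.
exists del => // z /H; rewrite (_ : ball _ _ `&` A = A)//.
apply/seteqP; split => [x []//|x Ax]; split => //.
rewrite ball_rVE/= sub0r normrN (lt_trans (AM _ Ax))//.
by rewrite (le_lt_trans (ler_norm _))// truncnS_gt.
Qed.

Lemma vol_shiftC z A : bborel A -> vol (trs z A `\` A) = vol (A `\` trs z A).
Proof.
move=> bA; have mA := bborel_measurable bA; have bz := bborel_trs z bA.
apply: (addIr (vol (A `&` trs z A))); rewrite -volDI//; last exact: measurable_trs.
by rewrite setIC -volDI// vol_trs.
Qed.

Lemma vol_shiftN z A : bborel A -> vol (A `\` trs (- z) A) = vol (A `\` trs z A).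
Proof.
move=> bA; have mA := bborel_measurable bA.
rewrite -(vol_trs z); last by apply: measurableD => //; exact: measurable_trs.
by rewrite trsD trs_comp addNr trs0 vol_shiftC.
Qed.

End translation_continuity.

(** * The measure-theoretic boundary *)

Section null_sets.
Context {R : realType} {d : nat}.
Local Notation E := 'rV[R]_d.
Local Notation mu := (lebd d).
Implicit Types (A B : set E) (x y z e : E).

(** A Lindelof argument: the members of the countable base in which A is null cover A. *)
Lemma locally_null A : measurable A ->
  (forall x, A x -> exists2 r, 0 < r & mu (A `&` ball x r) = 0%E) -> mu A = 0%E.
Proof.
move=> mA H; apply/(negligibleP _ mA).
pose F n := if `[< mu (A `&` rat_ball n) = 0%E >] then A `&` rat_ball n else set0.
apply: (@negligibleS _ _ _ _ (\bigcup_n F n)).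
  move=> x Ax; have [r r0 Ar] := H x Ax.
  have ob : open (ball x r) by exact: ball_open.
  have [n nx nr] := open_rat_ball ob (ballxx x r0).
  exists n => //; rewrite /F ifT//; apply/asboolP.
  apply: subset_measure0 Ar; last by move=> y [Ay /nr]; split.
  - by apply: measurableI => //; exact: measurable_rat_ball.
  - by apply: measurableI => //; exact: measurable_ball_rV.
apply: negligible_bigcup => n; rewrite /F; case: asboolP => [An0|_]; last exact: negligible_set0.
by apply/negligibleP => //; apply: measurableI => //; exact: measurable_rat_ball.
Qed.

(* The translates of A by t_k e, with distinct t_k in [0, eta[, are disjoint. *)
Lemma translates_null A e eta : bborel A -> 0 < eta ->
  (forall x t, A x -> 0 < t -> t < eta -> ~ A (x + t *: e)) -> vol A = 0.
Proof.
move=> bA eta0 H; have mA := bborel_measurable bA.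
pose c (n k : nat) : R := eta * (k%:R / n.+1%:R).
pose U n m := \big[setU/set0]_(k < m) trs (c n k *: e) A.
have UP n m x : U n m x -> exists2 k, (k < m)%N & A (x - c n k *: e).
  by rewrite /U -(bigcup_mkord m (fun k => trs (c n k *: e) A)) => -[k /= km Ax]; exists k.
have [M [M0 AM]] : exists M, 0 < M /\ forall x, A x -> `|x| < M.
  have [_ [M AM]] := bA; exists (Num.max M 1); split; first by rewrite lt_max ltr01 orbT.
  by move=> x /AM xM; rewrite lt_max xM.
pose W : set E := ball 0 (M + eta * `|e|).
have bW : bborel W := bborel_ball _ _.
have UW n m : (m <= n.+1)%N -> U n m `<=` W.
  move=> mn x /UP[k km Ax]; rewrite /W ball_rVE/= sub0r normrN.
  rewrite -(subrK (c n k *: e) x) (le_lt_trans (ler_normD _ _))// ltr_leD//; first exact: AM.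
  rewrite normrZ ler_wpM2r// ger0_norm; last by rewrite mulr_ge0 ?divr_ge0// ltW.
  rewrite /c ler_piMr ?(ltW eta0)// ler_pdivrMr// mul1r ler_nat.
  by rewrite (leq_trans (ltnW km)).
have mU n m : measurable (U n m).
  by apply: bigsetU_measurable => k _; exact: measurable_trs.
have volUE n m : (m <= n.+1)%N -> vol (U n m) = m%:R * vol A.
  elim: m => [|m IH] mn; first by rewrite /U big_ord0 vol0 mul0r.
  rewrite {1}/U big_ord_recr/= volU.
  - by rewrite IH ?(ltnW mn)// vol_trs// -natr1 mulrDl mul1r.
  - by apply: (sub_bborel bW); [exact: mU|exact/UW/ltnW].
  - exact: bborel_trs.
  apply/disj_set2P/seteqP; split => // x [/UP[k km Ax] Ax'].
  apply: (H _ (c n m - c n k) Ax').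
  - by rewrite subr_gt0 /c ltr_pM2l// ltr_pM2r ?invr_gt0// ltr_nat.
  - rewrite (@le_lt_trans _ _ (c n m))//.
      by rewrite gerBl mulr_ge0 ?divr_ge0// ltW.
    by rewrite /c gtr_pMr// ltr_pdivrMr// mul1r ltr_nat.
  by rewrite scalerBl addrA subrK.
apply/eqP; rewrite eq_le vol_ge0 andbT leNgt; apply/negP => A0.
have [n nW] : exists n : nat, vol W / vol A < n%:R.
  by exists (Num.truncn (vol W / vol A)).+1; rewrite truncnS_gt.
move: nW; rewrite ltr_pdivrMr// -(volUE n n)// ltNge => /negP; apply.
by apply: le_vol => //; exact: UW.
Qed.

Lemma hyperplane_null A e l : dotp e e = 1 -> bborel A ->
  A `<=` [set x | dotp x e = l] -> vol A = 0.
Proof.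
move=> e1 bA Al; apply: (translates_null (e := e) bA ltr01) => x t /Al/= xl t0 _ /Al/=.
by rewrite dotpDl dotpZl e1 mulr1 xl => /eqP; rewrite -subr_eq0 addrAC subrr add0r gt_eqF.
Qed.

(** Interior up to null sets; [inn] of the complement is the corresponding exterior. *)
Definition inn A : set E := [set x | exists2 r, 0 < r & mu (ball x r `\` A) = 0%E].

Lemma inn_open A : measurable A -> open (inn A).
Proof.
move=> mA; rewrite openE => x [r r0 xr].
apply/nbhs_ballP; exists (r / 2) => /=; first by rewrite divr_gt0.
move=> y xy; exists (r / 2); first by rewrite divr_gt0.
apply: subset_measure0 xr; try by apply: measurableD => //; exact: measurable_ball_rV.
move=> z [yz nAz]; split => //; apply: ball_split xy yz.
Qed.

Lemma inn_disjoint A x : measurable A -> inn A x -> inn (~` A) x -> False.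
Proof.
move=> mA [r r0 xr] [s s0 xs].
have m0 : 0 < Num.min r s by rewrite lt_min r0.
have mb := @measurable_ball_rV R d.
have sub t : Num.min r s <= t -> ball x (Num.min r s) `<=` ball x t.
  by move=> st; exact: le_ball.
have h1 : mu (ball x (Num.min r s) `\` A) = 0%E.
  apply: subset_measure0 xr; try by apply: measurableD.
  by move=> y [/(sub r) xy nAy]; split => //; apply: xy; rewrite ge_min lexx.
have h2 : mu (ball x (Num.min r s) `&` A) = 0%E.
  apply: subset_measure0 xs; [exact: measurableI|by apply: measurableD => //; exact: measurableC|].
  by move=> y [/(sub s) xy Ay]; split => //; apply: xy; rewrite ge_min lexx orbT.
have := vol_ball_gt0 x m0; rewrite (volDI (bborel_ball _ _) mA).
by rewrite /vol h1 h2 addr0 ltxx.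
Qed.

Lemma measurable_inn A : measurable A -> measurable (inn A).
Proof. by move=> mA; apply: open_measurable_rV; exact: inn_open. Qed.

(** There is no converse: A may exceed [inn A] by a set of positive measure inside [mbd A]. Later
    arguments must therefore treat points of [mbd] separately, through the level set v = c. *)
Lemma innD_null A : measurable A -> mu (inn A `\` A) = 0%E.
Proof.
move=> mA; have mi := measurable_inn mA.
apply: locally_null; first exact: measurableD.
move=> x [[r r0 xr] _]; exists r => //.
apply: subset_measure0 xr; last by move=> y [[_ nAy] xy].
- by apply: measurableI; [exact: measurableD|exact: measurable_ball_rV].
- by apply: measurableD => //; exact: measurable_ball_rV.
Qed.

(* The topological boundary of A, up to null sets. *)
Definition mbd A : set E := [set x | ~ inn A x /\ ~ inn (~` A) x].

(** If the segment missed [mbd A], then on it [inn A] would coincide with the complement of the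
    exterior of A and so be open and closed; it would contain the end y, hence all of the connected
    segment, including x. *)
Lemma segment_mbd A x y : measurable A -> ~ inn A x -> ~ inn (~` A) y ->
  exists s, [/\ 0 <= s, s <= 1 & mbd A (x + s *: (y - x))].
Proof.
move=> mA nx ny; apply: contrapT => nm.
pose g (s : R) := x + s *: (y - x).
have gc : continuous g.
  move=> s; apply: cvgD; first exact: cvg_cst.
  by apply: cvgZr_tmp; exact: cvg_id.
have nmg s : s \in `[0, 1] -> ~ inn (~` A) (g s) -> inn A (g s).
  rewrite in_itv/= => /andP[s0 s1] h; apply: contrapT => h'.
  by apply: nm; exists s; split => //.
have seg : connected `[0 : R, 1]%classic by exact: segment_connected.
have BE : `[0 : R, 1]%classic `&` (g @^-1` inn A) = `[0, 1]%classic.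
  apply: seg.
  - exists 1; split; first by rewrite /= in_itv/= ler01 lexx.
    by apply: nmg; rewrite ?in_itv/= ?ler01 ?lexx// /g scale1r addrC subrK.
  - exists (g @^-1` inn A) => //; apply: open_comp; last exact: inn_open.
    by move=> s _; exact: gc.
  - exists (~` (g @^-1` inn (~` A))).
      apply: open_closedC; apply: open_comp; last by apply: inn_open; exact: measurableC.
      by move=> s _; exact: gc.
    apply/seteqP; split => s [s01 gs]; split => //; last exact: nmg.
    by move=> gs'; exact: inn_disjoint gs gs'.
have : (`[0 : R, 1]%classic `&` (g @^-1` inn A)) 0.
  by rewrite BE /= in_itv/= lexx ler01.
by move=> [_]; rewrite /g/= scale0r addr0.
Qed.

End null_sets.

(** * Half-filled balls and the essential boundary *)

Section half_density.
Context {R : realType} {d : nat}.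
Local Notation E := 'rV[R]_d.
Local Notation mu := (lebd d).
Implicit Types (A B : set E) (x y z e : E).

Lemma measurable_section (S : set (E * E)) : measurable S ->
  measurable_fun setT (fun x => mu [set y | S (x, y)]).
Proof.
move=> mS; have : measurable_fun setT (mu \o xsection S) by exact: measurable_fun_xsection.
apply: eq_measurable_fun => x _ /=; congr (mu _).
by apply/seteqP; split => y; rewrite /xsection/= inE.
Qed.

Lemma integral_indic_cst A (k : R) : bborel A -> 0 <= k ->
  (\int[mu]_x ((\1_A x * k)%:E) = (vol A * k)%:E)%E.
Proof.
move=> bA k0; have mA := bborel_measurable bA.
under eq_integral do rewrite EFinM.
rewrite ge0_integralZr//; last exact/measurable_EFinP.
by rewrite integral_indic// setIT EFinM -volE.
Qed.

(* Averaging mu (ball a rho `\` B) over a in B gives mu (ball 0 rho) times the mean over small z of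
   mu {a in B | a + z notin B}, which is small by continuity of translations. *)
Lemma dense_ball B : bborel B -> 0 < vol B ->
  exists2 del, 0 < del & forall rho, 0 < rho -> rho < del ->
    exists2 a, B a & vol (ball a rho `\` B) < vol (ball a rho `&` B).
Proof.
move=> bB B0; have mB := bborel_measurable bB.
have B40 : 0 < vol B / 4 by rewrite divr_gt0.
have [del del0 H] := vol_shift_lt bB B40.
exists del => // rho rho0 rhodel; apply: contrapT => nex.
have b2 a : B a -> vol (ball a rho) <= 2 * vol (ball a rho `\` B).
  move=> Ba; rewrite (volDI (bborel_ball _ _) mB) mulr2n mulrDl mul1r lerD2l leNgt.
  by apply/negP => h; apply: nex; exists a.
pose v := (2 * rho) ^+ d; have v0 : 0 < v by rewrite exprn_gt0// mulr_gt0.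
pose S : set (E * E) := ((fst @^-1` B) `&` (snd @^-1` ball 0 rho)) `\`
  ((fun p : E * E => p.1 + p.2) @^-1` B).
have mS : measurable S.
  apply: measurableD; [apply: measurableI|]; rewrite -[X in measurable X]setTI.
  - exact: measurable_fst.
  - by apply: measurable_snd => //; exact: measurable_ball_rV.
  - exact: measurable_rVD.
pose S' : set (E * E) := [set p | S (p.2, p.1)].
have mS' : measurable S'.
  by rewrite -[X in measurable X]setTI; exact: measurable_swap.
have SE a : B a -> mu [set z | S (a, z)] = (vol (ball a rho `\` B))%:E.
  move=> Ba; rewrite -volE; last by apply: bborelD => //; exact: bborel_ball.
  rewrite -[RHS](lebd_shift a); last by apply: measurableD => //; exact: measurable_ball_rV.
  congr (mu _); apply/seteqP; split => z; rewrite /S ball_rVE/= ball_rVE/=.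
    by rewrite (addrC z) opprD addrA subrr => -[[_ zr] nB]; split.
  by rewrite (addrC z) opprD addrA subrr => -[zr nB]; split.
have e1 := tonelli_indic mu mu mS.
(* If every ball of radius rho centered in B were at most half filled, the measure of [S] would be
   at least [vol B * (v / 2)]. Integrating over the translation z first bounds it by
   [v * (vol B / 4)], thanks to the choice of [del]. *)
have : ((vol B * (v / 2))%:E <= (v * (vol B / 4))%:E)%E.
  rewrite -integral_indic_cst ?divr_ge0 ?(ltW v0)//.
  rewrite [X in (_ <= X)%E](_ : _ = (vol (ball (0 : E) rho) * (vol B / 4))%:E); last by rewrite vol_ball.
  rewrite -integral_indic_cst; [|exact: bborel_ball|exact: ltW].
  apply: (@le_trans _ _ (\int[mu]_a mu [set z | S (a, z)])%E).
    apply: ge0_le_integral => //.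
    - by move=> x _; rewrite lee_fin mulr_ge0// ltW// divr_gt0.
    - apply/measurable_EFinP; apply: measurable_funM => //.
    - exact: measurable_section.
    - move=> x _; rewrite indicE; case: (boolP (x \in B)) => [/set_mem Bx|_].
        have vx : v = vol (ball x rho) by rewrite vol_ball.
        by rewrite mul1r SE// lee_fin ler_pdivrMr// mulrC vx; exact: b2.
      by rewrite mul0r.
  rewrite [X in (X <= _)%E](_ : _ = \int[mu]_z mu [set a | S (a, z)])%E; last exact: e1.
  apply: ge0_le_integral => //.
  - exact: (measurable_section mS').
  - apply/measurable_EFinP; apply: measurable_funM => //.
    by apply: measurable_indic; exact: measurable_ball_rV.
  - move=> z _; rewrite indicE; case: (boolP (z \in _)) => [/set_mem zr|/negP nz].
      rewrite mul1r; have zdel : `|z| < del.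
        by move: zr; rewrite ball_rVE/= sub0r normrN => /lt_trans; apply.
      rewrite (_ : [set a | _] = B `\` trs (- z) B); last first.
        apply/seteqP; split => a; rewrite /S /trs/= opprK; first by move=> [[]].
        by move=> [Ba nB]; split.
      rewrite volE; last by apply: bborelD => //; exact: measurable_trs.
      by rewrite lee_fin ltW// H// normrN.
    rewrite mul0r (_ : [set a | _] = set0) ?measure0//.
    by apply/seteqP; split => // a [[_ /= zr] _]; apply: nz; rewrite inE.
rewrite lee_fin => h; have : 0 < vol B * v by rewrite mulr_gt0.
lra.
Qed.

Lemma vol_trs_dist A B z : bborel B -> measurable A ->
  `|vol (trs z B `&` A) - vol (B `&` A)| <= vol (B `\` trs z B).
Proof.
move=> bB mA; have bz := bborel_trs z bB.
have mB := bborel_measurable bB; have mz := bborel_measurable bz.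
rewrite ler_distl; apply/andP; split.
  rewrite lerBlDr; apply: vol_le_add.
  - exact: bborelI.
  - exact: bborelD.
  - exact: measurableI.
  - move=> x [Bx Ax]; have [zx|nzx] := pselect (trs z B x); first by left.
    by right.
rewrite -vol_shiftC//; apply: vol_le_add.
- exact: bborelI.
- exact: bborelD.
- exact: measurableI.
- move=> x [zx Ax]; have [Bx|nBx] := pselect (B x); first by left.
  by right.
Qed.

Lemma ball_trs x r : ball x r = trs x (ball 0 r).
Proof.
by apply/seteqP; split => y; rewrite /trs !ball_rVE/= sub0r opprB.
Qed.

Lemma continuous_vol_ball A rho : measurable A -> continuous (fun x => vol (ball x rho `&` A)).
Proof.
move=> mA; apply: continuous_rV_epsilon => x eps eps0.
have [del del0 H] := vol_shift_lt (bborel_ball x rho) eps0.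
exists del => // y xy.
have -> : ball y rho = trs (y - x) (ball x rho).
  by rewrite ball_trs [in RHS]ball_trs trs_comp addrC subrK.
by apply: le_lt_trans (H (y - x) _) => //; apply: vol_trs_dist => //; exact: bborel_ball.
Qed.

(** [dense_ball] gives two balls of the same radius, one filled mostly by A and the other mostly by
    its complement. Along the segment between their centers the difference of the two volumes is
    continuous and changes sign. *)
Lemma half_ball A x r del : bborel A -> 0 < del ->
  0 < vol (ball x r `&` A) -> 0 < vol (ball x r `\` A) ->
  exists y rho, [/\ ball x r y, 0 < rho, rho < del &
    vol (ball y rho `&` A) = vol (ball y rho `\` A)].
Proof.
move=> bA del0 H1 H2; have mA := bborel_measurable bA.
have bI : bborel (ball x r `&` A) by apply: bborelI => //; exact: bborel_ball.
have bD : bborel (ball x r `\` A) by apply: bborelD => //; exact: bborel_ball.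
have [d1 d10 D1] := dense_ball bI H1; have [d2 d20 D2] := dense_ball bD H2.
pose rho := Num.min del (Num.min d1 d2) / 2.
have m0 : 0 < Num.min del (Num.min d1 d2) by rewrite !lt_min del0 d10.
have rho0 : 0 < rho by rewrite divr_gt0.
have : rho < Num.min del (Num.min d1 d2) by rewrite ltr_pdivrMr// ltr_pMr// ltrDl.
rewrite !lt_min => /and3P[rd r1 r2].
have [a [xa Aa] ha] := D1 _ rho0 r1; have [b [xb Ab] hb] := D2 _ rho0 r2.
have bb y : bborel (ball y rho) := bborel_ball _ _.
have mb y : measurable (ball y rho) := measurable_ball_rV _ _.
pose f (s : R) := vol (ball (a + s *: (b - a)) rho `&` A) - vol (ball (a + s *: (b - a)) rho `&` ~` A).
have fc : continuous f.
  have gc : continuous (fun s : R => a + s *: (b - a)).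
    by move=> s; apply: cvgD; [exact: cvg_cst|apply: cvgZr_tmp; exact: cvg_id].
  have fAc (C : set E) : measurable C -> continuous (fun s : R => vol (ball (a + s *: (b - a)) rho `&` C)).
    move=> mC s; have K : continuous (fun y => vol (ball y rho `&` C)) := @continuous_vol_ball C rho mC.
    exact: continuous_comp (gc s) (K _).
  by move=> s; exact: cvgB (fAc _ mA s) (fAc _ (measurableC mA) s).
have f0 : 0 < f 0.
  rewrite /f scale0r addr0 subr_gt0; apply: (@le_lt_trans _ _ (vol (ball a rho `\` (ball x r `&` A)))).
    apply: le_vol; [by apply: bborelD => //; case: bI|by apply: measurableI => //; exact: measurableC|].
    by move=> y [ay nAy]; split => // -[].
  apply: (lt_le_trans ha); apply: le_vol; [exact: bborelI|by apply: measurableI => //; case: bI|].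
  by move=> y [ay [_ Ay]].
have f1 : f 1 < 0.
  rewrite /f scale1r (addrC a) subrK subr_lt0; apply: (@le_lt_trans _ _ (vol (ball b rho `\` (ball x r `\` A)))).
    apply: le_vol; [by apply: bborelD => //; case: bD|exact: measurableI|].
    by move=> y [ay Ay]; split => // -[].
  apply: (lt_le_trans hb); apply: le_vol.
  - by apply: bborelI => //; exact: measurableC.
  - by apply: measurableI => //; case: bD.
  by move=> y [ay [_ Ay]].
have [s s01 fs] : exists2 s, s \in `[0 : R, 1] & f s = 0.
  apply: IVT => //; first by move=> s; exact: continuous_subspaceT.
  by apply/andP; split; [rewrite ge_min|rewrite le_max]; apply/orP; [right|left]; exact: ltW.
exists (a + s *: (b - a)), rho; split => //; last first.
  by apply/eqP; rewrite -subr_eq0; apply/eqP.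
move: s01; rewrite in_itv/= => /andP[s0 s1].
move: xa xb; rewrite !ball_rVE/= => xa xb.
have -> : x - (a + s *: (b - a)) = (1 - s) *: (x - a) + s *: (x - b).
  by rewrite !scalerBr !scalerBl !scale1r; apply/rowP => i; rewrite !mxE; ring.
have [->|sn0] := eqVneq s 0; first by rewrite subr0 scale0r addr0 scale1r.
have sp : 0 < s by rewrite lt_neqAle eq_sym sn0.
rewrite (le_lt_trans (ler_normD _ _))// !normrZ !ger0_norm ?subr_ge0//.
have -> : r = (1 - s) * r + s * r by ring.
by rewrite ler_ltD// ?ltr_pM2l// ler_wpM2l ?subr_ge0// ltW.
Qed.

End half_density.

Section essential_points.
Context {R : realType} {d : nat}.
Local Notation E := 'rV[R]_d.
Local Notation mu := (lebd d).
Implicit Types (A B : set E) (x y z e : E).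

(** The factor 2 is that of a half-filled ball; [3 ^+ d] is the price of replacing this ball by one
    of triple radius around a limit point. *)
Definition half_dense A x := forall del : R, 0 < del -> exists rho, [/\ 0 < rho, rho < del,
  vol (ball x rho) <= 2 * 3 ^+ d * vol (ball x rho `&` A) &
  vol (ball x rho) <= 2 * 3 ^+ d * vol (ball x rho `\` A)].

(** A single half-filled ball says nothing about densities at its center. Iterating [half_ball]
    inside the previous ball, with the radius at least quartered each time, gives centers converging
    to a point p at distance at most 2 r_n from the n-th one, so that the ball of radius 3 r_n about
    p contains the n-th half-filled ball. *)
Lemma half_ball_limit A x0 r0 : bborel A -> 0 < r0 ->
  vol (ball x0 r0 `&` A) = vol (ball x0 r0 `\` A) ->
  exists2 p, `|p - x0| <= 2 * r0 & half_dense A p.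
Proof.
move=> bA r00 h0; have mA := bborel_measurable bA.
pose good (q : E * R) := 0 < q.2 /\ vol (ball q.1 q.2 `&` A) = vol (ball q.1 q.2 `\` A).
have half q : good q -> vol (ball q.1 q.2) = 2 * vol (ball q.1 q.2 `&` A) /\
    vol (ball q.1 q.2) = 2 * vol (ball q.1 q.2 `\` A).
  move=> [q0 qE]; rewrite (volDI (bborel_ball _ _) mA); move: qE; lra.
(* Stated for every pair, with the requirement conditional on [good q], so that the recursion can
   choose without carrying a proof. *)
have step (q : E * R) : exists q' : E * R, good q ->
    [/\ good q', `|q'.1 - q.1| <= q.2 & q'.2 <= q.2 / 4].
  have [gq|ng] := pselect (good q); last by exists q => /ng.
  have [q0 _] := gq; have [h1 h2] := half q gq; have v0 := vol_ball_gt0 q.1 q0.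
  have q40 : 0 < q.2 / 4 by rewrite divr_gt0.
  have [||y [rho [qy rho0 rhoq yh]]] := half_ball (x := q.1) (r := q.2) bA q40.
  - by move: v0; rewrite h1 pmulr_rgt0.
  - by move: v0; rewrite h2 pmulr_rgt0.
  exists (y, rho) => _; split => //=; last exact: ltW.
  by move: qy; rewrite ball_rVE/= distrC => /ltW.
pose q := fix q n := if n is m.+1 then projT1 (cid (step (q m))) else (x0, r0).
have gq n : good (q n).
  elim: n => [|n IH]; first by split.
  by rewrite /=; case: cid => q' /= /(_ IH)[].
have qS n : `|(q n.+1).1 - (q n).1| <= (q n).2 /\ (q n.+1).2 <= (q n).2 / 4.
  by rewrite /=; case: cid => q' /= /(_ (gq n))[].
have r_gt0 n : 0 < (q n).2 by have [] := gq n.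
have r_le n : (q n).2 <= r0 / n.+1%:R.
  elim: n => [|n IH]; first by rewrite /= divr1.
  have [_ /le_trans] := qS n; apply.
  rewrite ler_pdivrMr// (le_trans IH)// ler_pdivrMr//.
  rewrite [leRHS](_ : _ = r0 * (4 * n.+1%:R / n.+2%:R)); last by ring.
  rewrite ler_peMr ?(ltW r00)//.
  by rewrite ler_pdivlMr// mul1r -natrM ler_nat mulSn -addn1 leq_add2l.
have dist n k : `|(q (n + k)%N).1 - (q n).1| <= 2 * (q n).2 - 2 * (q (n + k)%N).2.
  elim: k => [|k IH]; first by rewrite addn0 !subrr normr0.
  have [h1 h2] := qS (n + k)%N; rewrite addnS.
  rewrite -(subrKA (q (n + k)%N).1) (le_trans (ler_normD _ _))//.
  apply: (le_trans (lerD h1 IH)); have := r_gt0 (n + k)%N; lra.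
have distC n k : `|(q k).1 - (q n).1| <= 2 * (q n).2 + 2 * (q k).2.
  wlog nk : n k / (n <= k)%N => [H|].
    have [nk|/ltnW kn] := leqP n k; first exact: H.
    by rewrite distrC [leRHS]addrC; exact: H.
  have D := dist n (k - n)%N; rewrite subnKC// in D; apply: (le_trans D).
  by have := r_gt0 k; lra.
(* In each coordinate the intervals of center q_n and half-length 2 r_n have all lower ends below
   all upper ends; the limit is the supremum of the lower ends. *)
pose p : E := \row_i sup [set (q n).1 ord0 i - 2 * (q n).2 | n in setT].
have ub i k : ubound [set (q n).1 ord0 i - 2 * (q n).2 | n in setT] ((q k).1 ord0 i + 2 * (q k).2).
  move=> _ [n _ <-]; have := le_trans (coord_le_norm _ i) (distC k n).
  by rewrite !mxE ler_norml => /andP[]; lra.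
have pq n : `|p - (q n).1| <= 2 * (q n).2.
  rewrite -[`|_|]/(mx_norm _) mx_normrE; apply/bigmax_leP; split.
    by rewrite mulr_ge0// ltW.
  move=> [i j] _ /=; rewrite (ord1 i) !mxE ler_distl; apply/andP; split.
    by apply: ub_le_sup; [exists ((q 0%N).1 ord0 j + 2 * (q 0%N).2); exact: ub|exists n].
  by apply: ge_sup; [exists ((q n).1 ord0 j - 2 * (q n).2); exists n|exact: ub].
exists p; first exact: (pq 0%N).
move=> del del0.
have [n ndel] : exists n, 3 * (q n).2 < del.
  exists (Num.truncn (3 * r0 / del)).
  apply: (@le_lt_trans _ _ (3 * (r0 / (Num.truncn (3 * r0 / del)).+1%:R))).
    by rewrite ler_pM2l.
  by rewrite mulrA ltr_pdivrMr// (mulrC del) -ltr_pdivrMr// truncnS_gt.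
have sub : ball (q n).1 (q n).2 `<=` ball p (3 * (q n).2).
  move=> y; rewrite !ball_rVE/= => qy.
  rewrite -(subrKA (q n).1) (le_lt_trans (ler_normD _ _))//.
  rewrite (_ : 3 * (q n).2 = 2 * (q n).2 + (q n).2); last by ring.
  by rewrite ler_ltD.
have [h1 h2] := half _ (gq n).
have q3 : 0 < 3 * (q n).2 by rewrite mulr_gt0.
have vE : vol (ball p (3 * (q n).2)) = 3 ^+ d * vol (ball (q n).1 (q n).2).
  by rewrite !vol_ball// mulrCA exprMn.
exists (3 * (q n).2); split => //.
  rewrite vE h1 mulrA (mulrC 2) ler_pM2l; last by rewrite mulr_gt0// exprn_gt0.
  apply: le_vol; [by apply: bborelI => //; exact: bborel_ball| |].
    by apply: measurableI => //; exact: measurable_ball_rV.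
  by move=> y [/sub].
rewrite vE h2 mulrA (mulrC 2) ler_pM2l; last by rewrite mulr_gt0// exprn_gt0.
apply: le_vol; [by apply: bborelD => //; exact: bborel_ball| |].
  by apply: measurableD => //; exact: measurable_ball_rV.
by move=> y [/sub].
Qed.

Lemma mbd_half_dense A x eps : bborel A -> mbd A x -> 0 < eps ->
  exists2 p, `|p - x| < eps & half_dense A p.
Proof.
move=> bA [nix nox] eps0; have mA := bborel_measurable bA.
(* The half-filled ball has its center within eps / 4 of x and radius below eps / 4, and p lies
   within two radii of that center. *)
have e40 : 0 < eps / 4 by rewrite divr_gt0.
have bI : bborel (ball x (eps / 4) `&` A) by apply: bborelI => //; exact: bborel_ball.
have bD : bborel (ball x (eps / 4) `\` A) by apply: bborelD => //; exact: bborel_ball.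
have vI : 0 < vol (ball x (eps / 4) `&` A).
  rewrite lt_neqAle vol_ge0 andbT eq_sym; apply/eqP => v0; apply: nox.
  by exists (eps / 4) => //; rewrite setDE setCK; exact: vol_eq0.
have vD : 0 < vol (ball x (eps / 4) `\` A).
  rewrite lt_neqAle vol_ge0 andbT eq_sym; apply/eqP => v0; apply: nix.
  by exists (eps / 4) => //; exact: vol_eq0.
have [y [rho [xy rho0 rhoe hy]]] := half_ball bA e40 vI vD.
have [p py hp] := half_ball_limit bA rho0 hy; exists p => //.
rewrite -(subrKA y) (le_lt_trans (ler_normD _ _))//.
move: xy; rewrite ball_rVE/= distrC => xy.
apply: (le_lt_trans (lerD py (ltW xy))); lra.
Qed.

End essential_points.

Section essential_boundary_mbd.
Context {R : realType} {d : nat}.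
Local Notation E := 'rV[R]_d.
Local Notation mu := (lebd d).
Local Notation leb := (rV_lebesgue R d).

Lemma lebE (A : set E) : measurable A -> leb A = mu A.
Proof. by move=> mA; exact: measurable_mu_extE. Qed.

(** Densities are taken over Euclidean balls while the hypothesis concerns sup-norm balls; passing
    from radius rho to (d+1) rho contributes the factor (d+1)^d. Two sets B and C appear because the
    density is that of the Lebesgue set and the volumes are those of its Borel hull. *)
Lemma upper_density_gt0 (B C : set E) x (k : R) : 0 < k ->
  (forall F, measurable F -> leb (B `&` F) = mu (C `&` F)) ->
  measurable C ->
  (forall del, 0 < del -> exists rho, [/\ 0 < rho, rho < del &
    vol (ball x rho) <= k * vol (ball x rho `&` C)]) ->
  (0 < upper_density B x)%E.
Proof.
move=> k0 BC mC H.
have c0 : 0 < (k * d.+1%:R ^+ d)^-1 by rewrite invr_gt0 mulr_gt0// exprn_gt0.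
apply: (@lt_le_trans _ _ ((k * d.+1%:R ^+ d)^-1)%:E); first by rewrite lte_fin.
apply: le_ereal_inf_tmp => _ [V V0 <-].
have [del /= del0 Vdel] : nbhs (0 : R)^'+ V by exact: V0.
have [rho [rho0 rhodel hrho]] := H (del / d.+1%:R) (divr_gt0 del0 (ltr0Sn _ _)).
pose r := d.+1%:R * rho; have r0 : 0 < r by rewrite mulr_gt0.
have Vr : V r.
  apply: Vdel => //=; rewrite sub0r normrN gtr0_norm// /r mulrC.
  by rewrite -ltr_pdivlMr.
apply: le_trans (ereal_sup_ubound _); last by exists r.
rewrite lee_fin BC; last exact: measurable_eball.
rewrite lebE; last exact: measurable_eball.
rewrite -![fine (mu _)]/(vol _).
have be : bborel (eball x r).
  by apply: (sub_bborel (bborel_ball x r)); [exact: measurable_eball|exact: eball_sub_ball].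
have v0 : 0 < vol (eball x r).
  by rewrite -lte_fin -volE//; exact: lebd_eball_gt0.
rewrite ler_pdivlMr// mulrC ler_pdivrMr; last by rewrite mulr_gt0// exprn_gt0.
apply: (@le_trans _ _ (vol (ball x r))).
  by apply: le_vol; [exact: bborel_ball|exact: measurable_eball|exact: eball_sub_ball].
have vE : vol (ball x r) = d.+1%:R ^+ d * vol (ball x rho).
  by rewrite !vol_ball// /r mulrCA exprMn.
rewrite vE [leRHS](_ : _ = d.+1%:R ^+ d * (k * vol (C `&` eball x r))); last by ring.
rewrite ler_pM2l ?exprn_gt0// (le_trans hrho)// ler_pM2l//; apply: le_vol.
- exact: bborelIr.
- by apply: measurableI => //; exact: measurable_ball_rV.
- by move=> y [xy Cy]; split => //; exact: ball_sub_eball xy.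
Qed.

Lemma half_dense_essential (Om A : set E) x : bborel A ->
  (forall F, measurable F -> leb (Om `&` F) = mu (A `&` F)) ->
  (forall F, measurable F -> leb (~` Om `&` F) = mu (~` A `&` F)) ->
  half_dense A x -> essential_boundary Om x.
Proof.
move=> bA h1 h2 hx; have mA := bborel_measurable bA.
have k0 : 0 < 2 * 3 ^+ d :> R by rewrite mulr_gt0// exprn_gt0.
split; first apply: (upper_density_gt0 k0 h1 mA) => del del0.
  by have [rho [? ? ? _]] := hx del del0; exists rho.
apply: (upper_density_gt0 k0 h2 (measurableC mA)) => del del0.
by have [rho [? ? _ ?]] := hx del del0; exists rho.
Qed.

End essential_boundary_mbd.

(** * Integrals of bounded functions on bounded Borel sets *)

Section bounded_integrals.
Context {R : realType} {d : nat}.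
Local Notation E := 'rV[R]_d.
Local Notation mu := (lebd d).
Implicit Types (A B : set E) (x y z e : E) (f g : E -> R).

Lemma bborel_integrable A f M : bborel A -> measurable_fun setT f ->
  (forall x, A x -> `|f x| <= M) -> mu.-integrable A (EFin \o f).
Proof.
move=> bA mf fM; apply: measurable_bounded_integrable.
- exact: bborel_measurable.
- exact: bborel_lty.
- exact: measurable_funTS.
exists M; split; first exact: num_real.
by move=> K MK x Ax; exact: le_trans (fM x Ax) (ltW MK).
Qed.

Lemma Rint_setDI A B f M : bborel A -> measurable B -> measurable_fun setT f ->
  (forall x, A x -> `|f x| <= M) ->
  \int[mu]_(x in A) f x = \int[mu]_(x in A `\` B) f x + \int[mu]_(x in A `&` B) f x.
Proof.
move=> bA mB mf fM; have mA := bborel_measurable bA.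
have AE : A = (A `\` B) `|` (A `&` B).
  apply/seteqP; split => [x Ax|x [[]|[]]//].
  by have [Bx|nBx] := pselect (B x); [right|left].
rewrite {1}AE Rintegral_setU//.
- exact: measurableD.
- exact: measurableI.
- by rewrite -AE; exact: (bborel_integrable bA mf fM).
- by apply/disj_set2P/seteqP; split => // x [[_ nB] [_ /nB]].
Qed.

Lemma Rint_le A f g M : bborel A -> measurable_fun setT f -> measurable_fun setT g ->
  (forall x, A x -> `|f x| <= M) -> (forall x, A x -> `|g x| <= M) ->
  (forall x, A x -> f x <= g x) -> \int[mu]_(x in A) f x <= \int[mu]_(x in A) g x.
Proof.
move=> bA mf mg fM gM fg; apply: le_Rintegral => //.
- exact: bborel_measurable.
- exact: (bborel_integrable bA mf fM).
- exact: (bborel_integrable bA mg gM).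
Qed.

Lemma Rint_cst A (k : R) : bborel A -> \int[mu]_(x in A) k = k * vol A.
Proof. by move=> bA; rewrite Rintegral_cst//; exact: bborel_measurable. Qed.

Lemma Rint_abs_le A f M : bborel A -> measurable_fun setT f ->
  (forall x, A x -> `|f x| <= M) -> `|\int[mu]_(x in A) f x| <= M * vol A.
Proof.
move=> bA mf fM.
apply: (@le_trans _ _ (\int[mu]_(x in A) `|f x|)).
  apply: le_normr_Rintegral; first exact: bborel_measurable.
  exact: (bborel_integrable bA mf fM).
rewrite -Rint_cst//; apply: (Rint_le (M := M)) => //.
- exact: measurableT_comp.
- by move=> x Ax; rewrite normr_id; exact: fM.
- by move=> x Ax; rewrite ger0_norm//; exact: le_trans (normr_ge0 _) (fM x Ax).
Qed.

Lemma Rint_null A f M : bborel A -> measurable_fun setT f ->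
  (forall x, A x -> `|f x| <= M) -> vol A = 0 -> \int[mu]_(x in A) f x = 0.
Proof.
move=> bA mf fM A0; have := Rint_abs_le bA mf fM.
by rewrite A0 mulr0 normr_le0 => /eqP.
Qed.

Lemma Rint_ae A B f M : bborel A -> bborel B -> measurable_fun setT f ->
  (forall x, (A `|` B) x -> `|f x| <= M) -> vol (A `\` B) = 0 -> vol (B `\` A) = 0 ->
  \int[mu]_(x in A) f x = \int[mu]_(x in B) f x.
Proof.
move=> bA bB mf fM AB BA; have [mA _] := bA; have [mB _] := bB.
rewrite (@Rint_setDI A B f M)//; last by move=> x Ax; apply: fM; left.
rewrite [RHS](@Rint_setDI B A f M)//; last by move=> x Bx; apply: fM; right.
rewrite setIC; congr (_ + _).
rewrite !(@Rint_null _ f M)//.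
- exact: bborelD.
- by move=> x [Bx _]; apply: fM; right.
- exact: bborelD.
- by move=> x [Ax _]; apply: fM; left.
Qed.

Lemma Rint_push (g : E -> E) A f M : measurable_fun setT g ->
  (forall B, measurable B -> mu (g @^-1` B) = mu B) ->
  bborel A -> measurable_fun setT f -> (forall x, A x -> `|f x| <= M) ->
  \int[mu]_(x in g @^-1` A) f (g x) = \int[mu]_(x in A) f x.
Proof.
move=> mg gmu bA mf fM; have [mA _] := bA.
rewrite /Rintegral; congr fine.
have muE B : measurable B -> push mg B = mu B by move=> mB; rewrite pushE gmu.
transitivity (\int[push mg]_(x in A) (f x)%:E)%E; last first.
  by apply: eq_measure_integral => B mB _; exact: muE.
apply/esym.
have mgA : measurable (g @^-1` A) by rewrite -[X in measurable X]setTI; apply: (mg measurableT).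
have gAoo : (mu (g @^-1` A) < +oo)%E by rewrite gmu//; exact: bborel_lty.
rewrite (integral_pushforward mg) => //; first exact/measurable_EFinP.
apply: measurable_bounded_integrable => //.
- by apply: measurable_funTS; exact: measurableT_comp.
exists M; split; first exact: num_real.
by move=> K MK x Ax; exact: le_trans (fM _ Ax) (ltW MK).
Qed.

(** By continuity from above, g - f exceeds some 1/(n+1) on a subset of positive volume. *)
Lemma Rint_lt A f g M : bborel A -> measurable_fun setT f -> measurable_fun setT g ->
  (forall x, A x -> `|f x| <= M) -> (forall x, A x -> `|g x| <= M) ->
  (forall x, A x -> f x < g x) -> 0 < vol A ->
  \int[mu]_(x in A) f x < \int[mu]_(x in A) g x.
Proof.
move=> bA mf mg fM gM fg A0; have mA := bborel_measurable bA.
pose F n := A `&` [set x | g x - f x <= n.+1%:R^-1].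
have mgf : measurable_fun setT (fun x => g x - f x) by exact: measurable_funB.
have mF n : measurable (F n) by apply: measurableI => //; exact: measurable_sublevelW.
have [n Fn] : exists n, vol (F n) < vol A.
  apply: vol_decr_lt => //.
  - by apply: (sub_bborel bA) => // x [].
  - move=> m n mn; apply/subsetPset => x [Ax /= h]; split => //=.
    by apply: (le_trans h); rewrite lef_pV2 ?posrE// ler_nat.
  - apply/seteqP; split => // x xF; have [Ax _] := xF 0%N I.
    have xx : 0 < g x - f x by rewrite subr_gt0 fg.
    have [n _ /(_ _ (leqnn n)) nx] := near_infty_natSinv_lt (PosNum xx).
    by have [_] := xF n I; rewrite /= leNgt nx.
have bF := bborelI bA (@measurable_sublevelW R d _ n.+1%:R^-1 mgf).
have bD : bborel (A `\` F n) by exact: bborelD.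
have D0 : 0 < vol (A `\` F n).
  have := volDI bA (mF n); rewrite (_ : A `&` F n = F n); last first.
    by apply/seteqP; split => [x []//|x [Ax ?]].
  by move: Fn => + vE; rewrite vE ltrDr.
rewrite (@Rint_setDI A (F n) f M)// [ltRHS](@Rint_setDI A (F n) g M)//.
apply: ltr_leD; last first.
  apply: (Rint_le (M := M)) => //; first exact: bborelI.
  - by move=> x [/fM].
  - by move=> x [/gM].
  - by move=> x [/fg /ltW].
rewrite -subr_gt0 -RintegralB//; last 3 first.
- exact: bborel_measurable.
- by apply: (bborel_integrable (M := M)) => // x [/gM].
- by apply: (bborel_integrable (M := M)) => // x [/fM].
apply: (@lt_le_trans _ _ (n.+1%:R^-1 * vol (A `\` F n))).
  by rewrite mulr_gt0// invr_gt0.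
rewrite -Rint_cst//; apply: (Rint_le (M := `|n.+1%:R^-1| + (M + M))) => //.
- by move=> x [/fM h _]; rewrite lerDl addr_ge0// (le_trans _ h).
- move=> x [Ax _]; rewrite (le_trans (ler_normB _ _))//.
  by rewrite (le_trans (lerD (gM _ Ax) (fM _ Ax)))// lerDr.
- move=> x [Ax nF]; rewrite leNgt; apply/negP => h; apply: nF; split => //=.
  exact: ltW.
Qed.

Lemma Rint_sum A (I : Type) (s : seq I) (F : I -> E -> R) K : bborel A ->
  (forall i, measurable_fun setT (F i)) -> (forall i x, A x -> `|F i x| <= K) ->
  \int[mu]_(x in A) (\sum_(i <- s) F i x) = \sum_(i <- s) \int[mu]_(x in A) F i x.
Proof.
move=> bA mF FK; elim: s => [|i s IH].
  rewrite big_nil (@eq_Rintegral _ _ _ mu A (fun=> 0)) ?Rint_cst ?mul0r//.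
  by move=> x _; rewrite big_nil.
rewrite big_cons -IH (@eq_Rintegral _ _ _ mu A (fun x => F i x + \sum_(j <- s) F j x)); last first.
  by move=> x _; rewrite big_cons.
apply: RintegralD; first exact: bborel_measurable.
- by apply: (bborel_integrable (M := K)) => // x Ax; exact: FK.
- apply: (bborel_integrable (M := \sum_(j <- s) K)) => //; first exact: measurable_sum.
  move=> x Ax; apply: (le_trans (ler_norm_sum _ _ _)); apply: ler_sum => j _; exact: FK.
Qed.

Lemma EFin_Rintegral A (f : E -> R) M : bborel A -> measurable_fun setT f ->
  (forall x, A x -> `|f x| <= M) ->
  (\int[mu]_(x in A) f x)%:E = (\int[mu]_(x in A) (f x)%:E)%E.
Proof.
move=> bA mf fM; rewrite /Rintegral fineK//.
exact: (integrable_fin_num (bborel_measurable bA) (bborel_integrable bA mf fM)).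
Qed.

End bounded_integrals.

(** * Potentials and moving hyperplanes *)

Section potential.
Context {R : realType} {d : nat}.
Local Notation E := 'rV[R]_d.
Local Notation mu := (lebd d).
Implicit Types (A B : set E) (x y z e : E).

Definition radial_kernel (M : R) (h : E -> R) := [/\ measurable_fun setT h,
  forall x, 0 < h x <= M, forall x y, enorm x = enorm y -> h x = h y &
  forall x y, enorm x < enorm y -> h y < h x].

Variables (h : E -> R) (M : R).
Hypothesis hM : radial_kernel M h.

Let mh : measurable_fun setT h. Proof. by case: hM. Qed.
Let h_gt0 x : 0 < h x. Proof. by case: hM => _ /(_ x)/andP[]. Qed.
Let h_le x : h x <= M. Proof. by case: hM => _ /(_ x)/andP[]. Qed.
Let h_norm x : `|h x| <= M. Proof. by rewrite gtr0_norm. Qed.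
Let hrad x y : enorm x = enorm y -> h x = h y. Proof. by case: hM => _ _ + _; apply. Qed.
Let hdec x y : enorm x < enorm y -> h y < h x. Proof. by case: hM => _ _ _; apply. Qed.
Let hdecW x y : enorm x <= enorm y -> h y <= h x.
Proof. by rewrite le_eqVlt => /predU1P[/hrad ->|/hdec /ltW]. Qed.

Lemma kernel_bound_ge0 : 0 <= M.
Proof. exact: le_trans (ltW (h_gt0 0)) (h_le 0). Qed.

Let mhB x : measurable_fun setT (fun y => h (x - y)).
Proof. by apply: (measurableT_comp mh); exact: measurable_rV_subl. Qed.

Definition pot A x : R := \int[mu]_(y in A) h (x - y).

Lemma pot_setDI A B x : bborel A -> measurable B -> pot A x = pot (A `\` B) x + pot (A `&` B) x.
Proof. by move=> bA mB; apply: (@Rint_setDI R d A B _ M). Qed.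

Lemma pot_ge0 A x : 0 <= pot A x.
Proof. by apply: Rintegral_ge0 => y _; exact: ltW. Qed.

Lemma pot_le_vol A x : bborel A -> pot A x <= M * vol A.
Proof.
move=> bA; apply: (le_trans (ler_norm _)).
by apply: Rint_abs_le.
Qed.

Lemma pot_null A x : bborel A -> vol A = 0 -> pot A x = 0.
Proof. by move=> bA A0; apply: (@Rint_null R d A _ M). Qed.

Lemma pot_ae A B x : bborel A -> bborel B -> vol (A `\` B) = 0 -> vol (B `\` A) = 0 ->
  pot A x = pot B x.
Proof. by move=> bA bB AB BA; apply: (@Rint_ae R d A B _ M). Qed.

Lemma pot_trs A x z : bborel A -> pot (trs z A) x = pot A (x - z).
Proof.
move=> bA; rewrite -[RHS](@Rint_push R d (fun y => y - z) A (fun y => h (x - z - y)) M)//.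
- by apply: eq_Rintegral => y _; congr h; rewrite opprB addrA subrK.
- exact: measurable_rV_shift.
- by move=> B mB; exact: lebd_trs.
Qed.

Lemma pot_mirror A x e l : dotp e e = 1 -> bborel A ->
  pot (mirror e l A) x = pot A (hrefl e l x).
Proof.
move=> e1 bA; rewrite -[RHS](@Rint_push R d (hrefl e l) A (fun y => h (hrefl e l x - y)) M)//.
- by apply: eq_Rintegral => y _; apply: hrad; rewrite enorm_hreflB.
- exact: measurable_hrefl.
- by move=> B mB; exact: lebd_hrefl.
Qed.

Lemma pot_mono A x x' : bborel A -> (forall y, A y -> enorm (x - y) <= enorm (x' - y)) ->
  pot A x' <= pot A x.
Proof. by move=> bA xx'; apply: (@Rint_le R d A _ _ M) => // y /xx'; exact: hdecW. Qed.

Lemma pot_strict A x x' : bborel A -> (forall y, A y -> enorm (x - y) < enorm (x' - y)) ->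
  0 < vol A -> pot A x' < pot A x.
Proof. by move=> bA xx' A0; apply: (@Rint_lt R d A _ _ M) => // y /xx'; exact: hdec. Qed.

(** Moving the point amounts to translating the set, and the two potentials then differ only through
    the parts of A and of its translate that do not overlap. Thus the potential is continuous
    although h need not be. *)
Lemma pot_shift_dist A x z : bborel A -> `|pot A (x - z) - pot A x| <= M * vol (A `\` trs z A).
Proof.
move=> bA; have bz := bborel_trs z bA; have [mA _] := bA; have [mz _] := bz.
rewrite -pot_trs// (pot_setDI _ bz mA) (pot_setDI _ bA mz) setIC.
rewrite opprD addrACA subrr addr0.
have h1 := pot_le_vol x (bborelD bA mz); have h2 := pot_le_vol x (bborelD bz mA).
rewrite vol_shiftC// in h2.
have h3 := pot_ge0 (A `\` trs z A) x; have h4 := pot_ge0 (trs z A `\` A) x.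
by rewrite ler_norml; apply/andP; split; lra.
Qed.

Lemma pot_continuous A : bborel A -> continuous (pot A).
Proof.
move=> bA; apply: continuous_rV_epsilon => x eps eps0.
have M1 : 0 < M + 1 by rewrite ltr_pwDr// kernel_bound_ge0.
have e0 : 0 < eps / (M + 1) by rewrite divr_gt0.
have [del del0 H] := vol_shift_lt bA e0; exists del => // y xy.
rewrite -[y in pot A y](subKr x) (le_lt_trans (pot_shift_dist _ _ bA))//.
have := H (x - y); rewrite distrC => /(_ xy); rewrite ltr_pdivlMr// mulrC.
apply: le_lt_trans; rewrite ler_wpM2r ?vol_ge0//; lra.
Qed.

Lemma measurable_pot_level A (c : R) : bborel A -> measurable [set x | pot A x = c].
Proof.
move=> bA; rewrite -[X in measurable X]setCK; apply: measurableC; apply: open_measurable_rV.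
rewrite (_ : ~` _ = pot A @^-1` (~` [set c])); last by [].
apply: open_comp; first by move=> x _; exact: pot_continuous.
by apply: closed_openC; exact: closed_eq.
Qed.

End potential.

Lemma vol_null_setI (R : realType) (d : nat) (A N : set 'rV[R]_d) :
  bborel A -> measurable N -> lebd d N = 0%E -> vol (A `&` N) = 0.
Proof.
move=> [mA _] mN N0; rewrite /vol (subset_measure0 _ mN _ N0)//.
exact: measurableI.
Qed.

(** * Comparison of the potential with its reflection *)

Section moving_plane.
Context {R : realType} {d : nat}.
Local Notation E := 'rV[R]_d.
Local Notation mu := (lebd d).
Implicit Types (A B : set E) (x y z : E).
Variables (h : E -> R) (M : R).
Hypothesis hM : radial_kernel M h.
Variables (Om : set E) (e : E).
Hypothesis bOm : bborel Om.
Hypothesis e1 : dotp e e = 1.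

Local Notation v := (pot h Om).

Let mOm : measurable Om. Proof. by case: bOm. Qed.

Definition lside l : set E := [set x | dotp x e < l].

Lemma continuous_dotp : continuous (fun x => dotp x e).
Proof.
apply: continuous_rV_epsilon => z eps eps0.
have e0 : 0 < d%:R * `|e| + 1 by rewrite ltr_wpDl// mulr_ge0.
exists (eps / (d%:R * `|e| + 1)); first by rewrite divr_gt0.
move=> w; rewrite ltr_pdivlMr// -dotpBl => wz.
apply: (le_lt_trans (dotp_le_norm _ _)); apply: le_lt_trans wz.
by rewrite ler_wpM2l// lerDl.
Qed.

Lemma open_lside l : open (lside l).
Proof.
rewrite (_ : lside l = (fun x => dotp x e) @^-1` [set y | y < l])//.
by apply: open_comp; [move=> x _; exact: continuous_dotp|exact: open_lt].
Qed.

Lemma measurable_lside l : measurable (lside l).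
Proof. by apply: measurable_sublevel; exact: measurable_dotp. Qed.

(** On the left of the hyperplane, [capG] is the gain: points of Om whose mirror image is not in Om.
    [capD] is the defect: points outside Om whose mirror image is in Om. The comparison at level l
    is [vol (capD l) = 0]. *)
Definition capG l := (Om `&` lside l) `\` mirror e l Om.
Definition capD l := (mirror e l Om `&` lside l) `\` Om.

Lemma bborel_capG l : bborel (capG l).
Proof.
apply: bborelD; last exact: measurable_mirror.
by apply: bborelI => //; exact: measurable_lside.
Qed.

Lemma bborel_capD l : bborel (capD l).
Proof.
apply: bborelD => //; apply: bborelI; last exact: measurable_lside.
exact: bborel_mirror.
Qed.

Let capC l := (Om `&` lside l) `&` mirror e l Om.

Lemma mirror_side l : vol (mirror e l (Om `\` lside l) `\` (mirror e l Om `&` lside l)) = 0.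
Proof.
apply: (hyperplane_null (l := l) e1).
  apply: bborelD; first by apply: bborel_mirror => //; apply: bborelD => //; exact: measurable_lside.
  by apply: measurableI; [exact: measurable_mirror|exact: measurable_lside].
move=> x [[Rx nR] nI]; apply/eqP; rewrite eq_le; apply/andP; split.
  by rewrite leNgt; apply/negP => xl; apply: nR; rewrite /lside/= dotp_hrefl//; lra.
by rewrite leNgt; apply/negP => xl; apply: nI; split.
Qed.

(** The left part of Om is made of [capG] and the common part [capC]; the right part is, up to the
    hyperplane, the mirror image of [capD] and [capC], and its potential is moved to the reflected
    point. In v (x) - v (R x) the contributions of [capC] cancel. *)
Let vE l x : v x = (pot h (capG l) x + pot h (capC l) x) +
  (pot h (capD l) (hrefl e l x) + pot h (capC l) (hrefl e l x)).
Proof.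
have ml := measurable_lside l; have mm := measurable_mirror e l mOm.
have bm : bborel (mirror e l Om) by exact: bborel_mirror.
rewrite (pot_setDI hM x bOm ml) addrC; congr (_ + _).
  by rewrite (pot_setDI hM x (bborelI bOm ml) mm).
rewrite -[x in LHS](hreflK e1 l x) -(pot_mirror hM)//; last exact: bborelD.
rewrite (@pot_ae _ _ _ _ hM _ (mirror e l Om `&` lside l))//.
- rewrite (pot_setDI hM _ (bborelI bm ml) mOm); congr (_ + pot h _ _).
  by apply/seteqP; split => y [[? ?] ?].
- by apply: bborel_mirror => //; exact: bborelD.
- exact: bborelI.
- exact: mirror_side.
- rewrite (_ : _ `\` _ = set0) ?vol0//; apply/seteqP; split => // y [[Ry yl] nR].
  apply: nR; split => //; rewrite /lside/= dotp_hrefl//; move: yl; rewrite /lside/=; lra.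
Qed.

Lemma pot_hrefl_diff l x : v x - v (hrefl e l x) =
  (pot h (capG l) x - pot h (capG l) (hrefl e l x)) -
  (pot h (capD l) x - pot h (capD l) (hrefl e l x)).
Proof. by rewrite (vE l x) (vE l (hrefl e l x)) hreflK//; ring. Qed.

Lemma pot_hrefl_lt l x : vol (capD l) = 0 -> 0 < vol (capG l) -> dotp x e < l ->
  v (hrefl e l x) < v x.
Proof.
move=> D0 G0 xl; rewrite -subr_gt0 pot_hrefl_diff.
rewrite !(pot_null hM _ (bborel_capD l) D0) subrr subr0 subr_gt0.
apply: (pot_strict hM) => //; first exact: bborel_capG.
by move=> y [[_ yl] _]; exact: hrefl_far.
Qed.

Lemma hrefl_mid x t : hrefl e (dotp x e + t / 2) x = x + t *: e.
Proof. by rewrite /hrefl -scaleNr; congr (_ + _ *: _); field. Qed.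

(** The level is that of the hyperplane bisecting x and x + t e, so that these two points are mirror
    images. *)
Lemma pot_decr x t : 0 < t -> vol (capD (dotp x e + t / 2)) = 0 ->
  0 < vol (capG (dotp x e + t / 2)) -> v (x + t *: e) < v x.
Proof.
move=> t0 D0 G0; have := pot_hrefl_lt D0 G0 (x := x).
by rewrite hrefl_mid; apply; rewrite ltrDl divr_gt0.
Qed.

(** Null caps make Om symmetric up to null sets, and the reflection turns x.e into 2 l - x.e. Read
    contrapositively, beyond the barycenter [capG] has positive volume whenever [capD] is null; this
    keeps the comparison strict. *)
Lemma symmetric_bary l : vol (capD l) = 0 -> vol (capG l) = 0 ->
  \int[mu]_(y in Om) dotp y e = l * vol Om.
Proof.
move=> D0 G0; have mm := measurable_mirror e l mOm.
have bm : bborel (mirror e l Om) by exact: bborel_mirror.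
have O0 : vol (Om `\` mirror e l Om) = 0.
  apply/eqP; rewrite eq_le vol_ge0 andbT.
  have -> : 0 = vol (capG l) + vol (mirror e l (capD l)).
    by rewrite G0 vol_mirror ?D0 ?addr0//; case: (bborel_capD l).
  apply: vol_le_add; [exact: bborel_capG|by apply: bborel_mirror => //; exact: bborel_capD|exact: measurableD|].
  move=> x [Ox nRx]; have [xl|xl|xl] := ltgtP (dotp x e) l; first by left.
    right; split => //; split; rewrite /mirror/= ?hreflK//.
    by rewrite /lside/= dotp_hrefl//; lra.
  by exfalso; apply: nRx; rewrite /mirror/= /hrefl xl subrr mulr0 scale0r subr0.
have O1 : vol (mirror e l Om `\` Om) = 0.
  rewrite -(vol_mirror l e1); last exact: measurableD.
  rewrite (_ : mirror e l _ = Om `\` mirror e l Om)//.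
  by apply/seteqP; split => x; rewrite /mirror/= hreflK.
have [N NOm] : exists N, forall x, (Om `|` mirror e l Om) x -> `|dotp x e| <= N.
  have [_ [N HN]] := bborelU bOm bm; exists (N * (d%:R * `|e|)) => x /HN xN.
  by rewrite (le_trans (dotp_le_norm _ _))// ler_wpM2r ?mulr_ge0// ltW.
have md := measurable_dotp e.
have i1 : mu.-integrable Om (EFin \o (fun x => dotp x e)).
  by apply: (bborel_integrable (M := N)) => // x Ox; apply: NOm; left.
have i2 : mu.-integrable Om (EFin \o cst (2 * l)).
  by apply: (bborel_integrable (M := `|2 * l|)).
have E1 := Rint_ae bOm bm md NOm O0 O1.
have E2 : \int[mu]_(x in mirror e l Om) dotp x e = \int[mu]_(x in Om) (2 * l - dotp x e).
  rewrite -[RHS](@Rint_push R d (hrefl e l) Om _ (`|2 * l| + N))//.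
  - by apply: eq_Rintegral => x _; rewrite dotp_hrefl//; ring.
  - exact: measurable_hrefl.
  - by move=> B mB; exact: lebd_hrefl.
  - exact: measurable_funB.
  - by move=> x Ox; rewrite (le_trans (ler_normB _ _))// lerD2l NOm//; left.
move: E1; rewrite E2 RintegralB// Rint_cst//; lra.
Qed.

Lemma mirror_shift l t A : mirror e (l + t) A = trs ((2 * t) *: e) (mirror e l A).
Proof.
apply/funext => x; rewrite /mirror /trs/=; congr (A _).
rewrite -scaleNr hrefl_shift// scaleNr opprK /hrefl -addrA; congr (_ + _).
by rewrite -![- (_ *: e)]scaleNr -scalerDl; congr (_ *: _); ring.
Qed.

Lemma hrefl_subl l t x : hrefl e (l - t) x = hrefl e l x - (2 * t) *: e.
Proof.
rewrite /hrefl -addrA -![- (_ *: e)]scaleNr -scalerDl; congr (_ + _ *: _); ring.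
Qed.

(** Mirror images of Om at nearby levels are translates of one another, so continuity of
    translations carries the comparison to the limit level. *)
Lemma capD_closed l : (forall l', l < l' -> vol (capD l') = 0) -> vol (capD l) = 0.
Proof.
move=> H; apply/eqP; rewrite eq_le vol_ge0 andbT; apply/ler_addgt0Pl => eps eps0.
have bm : bborel (mirror e l Om) by exact: bborel_mirror.
have [del del0 Hd] := vol_shift_lt bm eps0.
pose t := del / (2 * (`|e| + 1)) / 2.
have e20 : 0 < `|e| + 1 by rewrite ltr_wpDl.
have t0 : 0 < t by rewrite !divr_gt0// mulr_gt0.
have zt : `|(2 * t) *: e| < del.
  rewrite normrZ gtr0_norm; last by rewrite mulr_gt0.
  rewrite (_ : 2 * t = del / (2 * (`|e| + 1))); last by rewrite /t; field; rewrite gt_eqF.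
  rewrite mulrAC ltr_pdivrMr; last by rewrite mulr_gt0.
  rewrite ltr_pM2l//; have := normr_ge0 e; lra.
have lt : l < l + t by rewrite ltrDl.
rewrite addr0 -[eps]add0r -(H (l + t) lt).
apply: (@le_trans _ _ (vol (capD (l + t)) + vol (mirror e l Om `\` trs ((2 * t) *: e) (mirror e l Om)))).
  apply: vol_le_add.
  - exact: bborel_capD.
  - by apply: bborelD => //; apply: measurable_trs; case: bm.
  - by case: (bborel_capD l).
  - move=> x [[mx xl] nx]; rewrite -mirror_shift.
    have [mtx|nmtx] := pselect (mirror e (l + t) Om x); last by right.
    by left; split => //; split => //; exact: lt_trans xl lt.
by rewrite lerD2l ltW// Hd.
Qed.

Section level.
Variable c : R.
Hypothesis vc : forall x, mbd Om x -> v x = c.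

(** By [pot_decr], no two points of S lie on a line parallel to e. *)
Lemma level_null l0 S : (forall l, l0 <= l -> vol (capD l) = 0) ->
  (forall l, l0 <= l -> 0 < vol (capG l)) -> bborel S ->
  S `<=` [set x | v x = c /\ l0 <= dotp x e] -> vol S = 0.
Proof.
move=> D0 G0 bS Sc; apply: (translates_null (e := e) bS ltr01) => x t Sx t0 _ St.
have [vx xl] := Sc x Sx; have [vxt _] := Sc _ St.
have lt : l0 <= dotp x e + t / 2 by rewrite (le_trans xl)// lerDl divr_ge0// ltW.
by have := pot_decr t0 (D0 _ lt) (G0 _ lt); rewrite vx vxt ltxx.
Qed.

(** Reflections are isometries for the Euclidean norm only; in the sup norm, which defines [ball],
    they are Lipschitz with constant d. This is the origin of the radii divided by [d%:R + 1]
    below. *)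
Lemma norm_hreflB l x y : `|hrefl e l x - hrefl e l y| <= d%:R * `|x - y|.
Proof. by rewrite (le_trans (norm_le_enorm _))// enorm_hreflB// enorm_le_norm. Qed.

(** When the defect is null, the left part covers the mirror image of the right part, so interior
    points are carried to the left; dually, exterior points are carried to the right by
    [out_mirror]. *)
Lemma inn_mirror l x : vol (capD l) = 0 -> dotp x e < l ->
  inn Om (hrefl e l x) -> inn Om x.
Proof.
move=> D0 xl [r r0 Or].
have ol : open (lside l) := @open_lside l.
have /nbhs_ballP[s /= s0 sl] : nbhs x (lside l) by apply: open_nbhs_nbhs; split.
have d0 : 0 < d%:R + 1 :> R by rewrite ltr_wpDl.
pose q := Num.min s (r / (d%:R + 1)).
have q0 : 0 < q by rewrite lt_min s0 divr_gt0.
exists q => //; apply: vol_eq0; first by apply: bborelD => //; exact: bborel_ball.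
apply/eqP; rewrite eq_le vol_ge0 andbT.
have bD : bborel (ball (hrefl e l x) r `\` Om) by apply: bborelD => //; exact: bborel_ball.
have -> : 0 = vol (mirror e l (ball (hrefl e l x) r `\` Om)) + vol (capD l).
  by rewrite D0 vol_mirror ?/(vol (_ `\` Om)) ?Or ?addr0//; case: bD.
apply: vol_le_add; [exact: bborel_mirror|exact: bborel_capD| |].
  by apply: measurableD => //; exact: measurable_ball_rV.
move=> y [xy nOy]; have [Ry|nRy] := pselect (mirror e l Om y).
  right; split => //; split => //; apply: sl; apply: le_ball xy.
  by rewrite ge_min lexx.
left; split => //; rewrite /mirror/= ball_rVE/=.
rewrite (le_lt_trans (norm_hreflB _ _ _))//.
move: xy; rewrite ball_rVE/= lt_min => /andP[_]; rewrite ltr_pdivlMr// mulrC.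
by apply: le_lt_trans; rewrite ler_wpM2r// lerDl.
Qed.

Lemma out_mirror l x : vol (capD l) = 0 -> dotp x e < l ->
  inn (~` Om) x -> inn (~` Om) (hrefl e l x).
Proof.
move=> D0 xl [r r0 Or].
have ol : open (lside l) := @open_lside l.
have /nbhs_ballP[s /= s0 sl] : nbhs x (lside l) by apply: open_nbhs_nbhs; split.
have d0 : 0 < d%:R + 1 :> R by rewrite ltr_wpDl.
have rs0 : 0 < Num.min r s by rewrite lt_min r0.
pose q := Num.min r s / (d%:R + 1).
exists q; first by rewrite divr_gt0.
have mOc := measurableC mOm.
apply: vol_eq0; first by apply: bborelD => //; exact: bborel_ball.
apply/eqP; rewrite eq_le vol_ge0 andbT.
have bD : bborel (ball x r `\` ~` Om) by apply: bborelD => //; exact: bborel_ball.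
have -> : 0 = vol (mirror e l (ball x r `\` ~` Om)) + vol (mirror e l (capD l)).
  rewrite vol_mirror//; last by case: bD.
  rewrite vol_mirror//; last by case: (bborel_capD l).
  by rewrite D0 addr0 /(vol (_ `\` ~` Om)) Or.
apply: vol_le_add; [exact: bborel_mirror|by apply: bborel_mirror => //; exact: bborel_capD| |].
  by apply: measurableD => //; exact: measurable_ball_rV.
move=> y [xy /contrapT Oy].
have Ryx : `|x - hrefl e l y| < Num.min r s.
  rewrite -[x in ltLHS](hreflK e1 l) (le_lt_trans (norm_hreflB _ _ _))//.
  move: xy; rewrite ball_rVE/= ltr_pdivlMr// mulrC.
  by apply: le_lt_trans; rewrite ler_wpM2r// lerDl.
have [Ry|nRy] := pselect (Om (hrefl e l y)).
  left; split; last by apply.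
  by rewrite ball_rVE/=; apply: (lt_le_trans Ryx); rewrite ge_min lexx.
right; split => //; split; first by rewrite /mirror/= hreflK.
by apply: sl; rewrite ball_rVE/=; apply: (lt_le_trans Ryx); rewrite ge_min lexx orbT.
Qed.

(** By continuity v differs from c in a whole ball around x0, which therefore contains no point of
    [mbd Om]; a short segment from a non-interior to a non-exterior point in that ball would produce
    one. *)
Lemma no_mbd_near x0 : v x0 != c -> exists2 r, 0 < r &
  forall x w, ~ inn Om x -> ~ inn (~` Om) (x + w) -> `|x - x0| + `|w| < r -> False.
Proof.
move=> vx; have vx0 : 0 < `|v x0 - c| by rewrite normr_gt0 subr_eq0.
have /(_ x0 (ball (v x0) `|v x0 - c|)) : continuous v by exact: (pot_continuous hM).
move=> /(_ (nbhsx_ballx _ _ vx0)) /nbhs_ballP[r /= r0 H]; exists r => // x w nx nw xwr.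
have [s [s0 s1 ms]] := segment_mbd mOm nx nw.
have zr : ball x0 r (x + s *: (x + w - x)).
  rewrite ball_rVE/= distrC (addrC x w) addrK addrAC.
  rewrite (le_lt_trans (ler_normD _ _))// (le_lt_trans _ xwr)// lerD2l normrZ.
  by rewrite ger0_norm// ler_piMl.
by have := H _ zr; rewrite /preimage/= (vc ms) -ball_normE/= ltxx.
Qed.

Lemma capD_bounded l0 : exists N, forall l, l0 - 1 <= l -> l <= l0 -> forall y, capD l y -> `|y| <= N.
Proof.
have [_ [N HN]] := bOm; exists (d%:R * N + (2 * (`|l0| + 1)) * `|e|) => l l1 l2 y [[my _] _].
rewrite -[in leLHS](hreflK e1 l y) hreflE (le_trans (ler_normD _ _))// lerD//.
  rewrite (le_trans (norm_le_enorm _))// enormE dotp_hrefl0// -enormE.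
  by rewrite (le_trans (enorm_le_norm _))// ler_wpM2l// ltW// HN.
rewrite normrZ ler_wpM2r// normrM ger0_norm// ler_pM2l//.
have := ler_norm l0; have := lerNnormlW (lexx `|l0|); rewrite ler_norml.
by move=> h1 h2; apply/andP; split; lra.
Qed.

(** Just below l0 a defect can only appear near the hyperplane. A defect point y is, off a null set,
    not interior and has a non-exterior image. Strictly left of the hyperplane this is impossible
    locally for all levels close to l0, and compactness makes the closeness uniform. *)
Lemma capD_strip l0 kappa : vol (capD l0) = 0 -> 0 < vol (capG l0) -> 0 < kappa ->
  exists2 eta, 0 < eta & forall l, l0 - eta < l -> l <= l0 ->
    vol (capD l `&` [set y | dotp y e <= l0 - kappa]) = 0.
Proof.
move=> D0 G0 k0.
have [N NP] := capD_bounded l0.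
pose K : set E := [set y | `|y| <= N].
have cK : compact K.
  apply: bounded_closed_compact; first by exists N; split; [exact: num_real|move=> K' NK y /= yN; exact: le_trans yN (ltW NK)].
  apply: (@closed_comp _ _ (fun y : E => `|y|) [set r | r <= N]); last exact: closed_le.
  by move=> y _; exact: norm_continuous.
pose P (i : R) y := dotp y e <= l0 - kappa -> ~ inn Om y -> ~ inn (~` Om) (hrefl e (l0 - i) y) -> False.
have d0 : 0 < d%:R + 1 :> R by rewrite ltr_wpDl.
have e0 : 0 < 2 * (`|e| + 1) by rewrite mulr_gt0// ltr_wpDl.
have hyp : forall y0, K y0 -> \forall y \near y0 & i \near (0 : R)^'+, P i y.
  move=> y0 _; have [y0l|y0l] := leP l0 (dotp y0 e).
    have : nbhs y0 [set y | l0 - kappa < dotp y e].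
      apply: open_nbhs_nbhs; split; last by rewrite /=; lra.
      rewrite (_ : mkset _ = (fun y => dotp y e) @^-1` [set r | l0 - kappa < r])//.
      by apply: open_comp; [move=> x _; exact: continuous_dotp|exact: open_gt].
    move=> U; exists ([set y | l0 - kappa < dotp y e], setT); first by split => //; exact: filterT.
    by move=> [y i] [/= yl _]; rewrite /P leNgt yl.
  have side (y : E) (i : R) : 0 < i -> i < kappa / 2 -> dotp y e <= l0 - kappa -> l0 < dotp (hrefl e (l0 - i) y) e.
    by move=> i0 ik yl; rewrite dotp_hrefl//; lra.
  have := pot_hrefl_lt D0 G0 y0l.
  (* As v is strictly smaller at the mirror image of y0, it differs from c at y0 or at that
     image. *)
  have [vy0|vy0 vlt] := eqVneq (v y0) c; last first.
    have [r r0 H] := no_mbd_near vy0.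
    have r20 : 0 < r / 2 by rewrite divr_gt0.
    have m0 : 0 < Num.min (kappa / 2) (r / 2 / (2 * (`|e| + 1))).
      by rewrite lt_min !divr_gt0.
    exists (ball y0 (r / 2), [set i | 0 < i < Num.min (kappa / 2) (r / 2 / (2 * (`|e| + 1)))]).
      by split; [exact: nbhsx_ballx|near=> i; rewrite /=; apply/andP; split => //].
    move=> [y i] [/= y0y /andP[i0]]; rewrite lt_min => /andP[ik]; rewrite ltr_pdivlMr// => ir yl nOy nOR.
    (* The non-exterior image at level l0 - i, still right of l0 because i < kappa / 2, is reflected
       back at level l0: this gives y + 2 i e, close to y. *)
    apply: (H y ((2 * i) *: e) nOy).
      move=> h1; apply: nOR.
      have <- := hreflK e1 l0 (hrefl e (l0 - i) y); apply: out_mirror => //.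
        by have := side y i i0 ik yl; rewrite (dotp_hrefl e1 l0); lra.
      by rewrite (hrefl_comp e1) opprB addrCA subrr addr0.
    move: y0y; rewrite ball_rVE/= distrC => y0y.
    rewrite normrZ gtr0_norm ?mulr_gt0//; have := normr_ge0 e; nra.
  rewrite vy0 => vlt; have vR : v (hrefl e l0 y0) != c by rewrite lt_eqF.
  have [r r0 H] := no_mbd_near vR.
  have r20 : 0 < r / 2 by rewrite divr_gt0.
  have m0 : 0 < Num.min (kappa / 2) (r / 2 / (2 * (`|e| + 1))).
    by rewrite lt_min !divr_gt0.
  exists (ball y0 (r / 2 / (d%:R + 1)), [set i | 0 < i < Num.min (kappa / 2) (r / 2 / (2 * (`|e| + 1)))]).
    by split; [apply: nbhsx_ballx; rewrite divr_gt0|near=> i; rewrite /=; apply/andP; split => //].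
  move=> [y i] [/= y0y /andP[i0]]; rewrite lt_min => /andP[ik]; rewrite ltr_pdivlMr// => ir yl nOy nOR.
  (* Here the two points are compared on the right: the image of y at level l0 is not interior by
     [inn_mirror], and the image at level l0 - i is only 2 i |e| away. *)
  apply: (H (hrefl e l0 y) (- ((2 * i) *: e))).
  - by move=> /inn_mirror h1; apply: nOy; apply: h1 => //; lra.
  - by move: nOR; rewrite hrefl_subl.
  have := norm_hreflB l0 y y0; move: y0y; rewrite ball_rVE/= distrC ltr_pdivlMr// => y0y h1.
  rewrite normrN normrZ gtr0_norm ?mulr_gt0//; have := normr_ge0 e; have := normr_ge0 (y - y0); nra.
have [eta /= eta0 HE] := (compact_near_coveringP K).1 cK _ _ P _ hyp.
exists (Num.min eta 1); first by rewrite lt_min eta0 ltr01.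
move=> l; rewrite ltrBlDr -ltrBlDl lt_min => /andP[leta l1 ll0].
have bDl := bborel_capD l.
have mk : measurable [set y : E | dotp y e <= l0 - kappa].
  by apply: measurable_sublevelW; exact: measurable_dotp.
have [->|ll0'] := eqVneq l l0.
  apply: (le_vol0 (bborel_capD l0) _ _ D0); last by move=> y [].
  by apply: measurableI => //; case: (bborel_capD l0).
apply/eqP; rewrite eq_le vol_ge0 andbT.
have i0 : 0 < l0 - l by rewrite subr_gt0 lt_neqAle ll0' ll0.
have Pl : K `<=` P (l0 - l).
  by apply: HE => //=; rewrite sub0r normrN gtr0_norm.
have mN1 : measurable (inn Om `\` Om) by apply: measurableD => //; exact: measurable_inn.
have mOc := measurableC mOm.
have mN2 : measurable (inn (~` Om) `\` ~` Om) by apply: measurableD => //; exact: measurable_inn.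
have N1 := vol_null_setI bDl mN1 (innD_null mOm).
have mN2' := measurable_mirror e l mN2.
have N2 : vol (capD l `&` mirror e l (inn (~` Om) `\` ~` Om)) = 0.
  by apply: vol_null_setI => //; rewrite lebd_hrefl// innD_null.
rewrite -(addr0 0) -{1}N1 -N2; apply: vol_le_add.
- exact: bborelI.
- exact: bborelI.
- by apply: measurableI => //; case: bDl.
move=> y [Dy yl]; have [[mRy yl'] nOy] := Dy.
have Ky : K y by apply: (NP l) => //; lra.
have [iy|niy] := pselect (inn Om y); first by left; split.
have [oy|noy] := pselect (inn (~` Om) (hrefl e l y)).
  by right; split => //; split => //; apply; exact: mRy.
by have := Pl y Ky yl niy; rewrite subKr => /(_ noy).
Unshelve. all: by end_near. Qed.

End level.
End moving_plane.

(** * Potential of thin slabs *)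

Section slab.
Context {R : realType} {d : nat}.
Local Notation E := 'rV[R]_d.
Local Notation mu := (lebd d).
Implicit Types (A B : set E) (x y z : E).
Variables (h : E -> R) (M : R).
Hypothesis hM : radial_kernel M h.
Variables (e : E) (r : R).
Hypothesis e1 : dotp e e = 1.

Definition perp z : E := z - dotp z e *: e.

Lemma perp_shift z s : perp (z + s *: e) = perp z.
Proof.
rewrite /perp dotpDl dotpZl e1 mulr1 scalerDl opprD addrACA subrr addr0.
by [].
Qed.

(** A piece of the cylinder with axis e, of radius r in the sup norm. It is half-open so that
    consecutive slabs are disjoint and [V] is additive. *)
Definition slab a b : set E := [set z | [/\ a <= dotp z e, dotp z e < b & `|perp z| < r]].

Lemma measurable_perp : measurable_fun setT perp.
Proof.
apply: measurable_fun_rVP => i.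
rewrite (_ : _ \o _ = fun x : E => x ord0 i - dotp x e * e ord0 i); last first.
  by apply/funext => x; rewrite /= /rV_coord !mxE.
apply: measurable_funB; first exact: measurable_coord.
by apply: measurable_funM => //; exact: measurable_dotp.
Qed.

Lemma slabE a b : slab a b = ([set z | dotp z e < b] `\` [set z | dotp z e < a]) `&`
  (perp @^-1` ball 0 r).
Proof.
apply/seteqP; split => z /=; rewrite ball_rVE/= sub0r normrN.
  by move=> [az zb zr]; split => //; split => //; apply/negP; rewrite -leNgt.
by move=> [[zb /negP]]; rewrite -leNgt.
Qed.

Lemma measurable_slab a b : measurable (slab a b).
Proof.
rewrite slabE; apply: measurableI.
  by apply: measurableD; apply: measurable_sublevel; exact: measurable_dotp.
by rewrite -[X in measurable X]setTI; apply: measurable_perp => //; exact: measurable_ball_rV.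
Qed.

Lemma bborel_slab a b : bborel (slab a b).
Proof.
split; first exact: measurable_slab.
exists (r + (`|a| + `|b|) * `|e|) => z [az zb zr].
rewrite -(subrK (dotp z e *: e) z) (le_lt_trans (ler_normD _ _))// ltr_leD//.
rewrite normrZ ler_wpM2r// ler_norml; have := ler_norm b; have := ler_norm (- a).
by rewrite normrN; have := normr_ge0 a; have := normr_ge0 b => *; apply/andP; split; lra.
Qed.

Lemma trs_slab a b s : trs (s *: e) (slab a b) = slab (a + s) (b + s).
Proof.
apply/seteqP; split => z; rewrite /trs/slab/= -scaleNr perp_shift dotpDl dotpZl e1 mulr1.
  by move=> [? ? ?]; split => //; lra.
by move=> [? ? ?]; split => //; lra.
Qed.

Definition V a b := pot h (slab a b) 0.

Lemma V_add a b c : a <= b -> b <= c -> V a c = V a b + V b c.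
Proof.
move=> ab bc; rewrite /V (pot_setDI hM _ (bborel_slab a c) (measurable_slab b c)).
congr (pot h _ _ + pot h _ _); apply/seteqP; split => z /=.
- by move=> [[az zc zr] nz]; split => //; rewrite ltNge; apply/negP => bz; apply: nz; split.
- move=> [az zb zr]; split; first by split => //; exact: lt_le_trans bc.
  by move=> [bz _ _]; move: zb; rewrite ltNge bz.
- by move=> [[? ? ?] []].
- by move=> [bz zc zr]; split; split => //; exact: le_trans bz.
Qed.

Lemma V_ge0 a b : 0 <= V a b. Proof. exact: (pot_ge0 hM). Qed.

Lemma V_trs a b s : V (a + s) (b + s) = pot h (slab a b) (- (s *: e)).
Proof. by rewrite /V -trs_slab (pot_trs hM) ?sub0r//; exact: bborel_slab. Qed.

Lemma V_mono a b s : 0 <= s -> b + s <= 0 -> V a b <= V (a + s) (b + s).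
Proof.
move=> s0 bs; rewrite V_trs; apply: (pot_mono hM); first exact: bborel_slab.
move=> y [ay yb _]; rewrite sub0r -opprD !enormN enorm_le.
rewrite !(dotpDl, dotpDr, dotpZl, dotpZr) e1 (dotpC e); nra.
Qed.

Lemma V_reflect t : 0 <= t -> V 0 t <= V (- t) 0.
Proof.
move=> t0; have H0 : hrefl e 0 0 = 0 by rewrite /hrefl dotp0l subrr mulr0 scale0r subr0.
have -> : V 0 t = pot h (mirror e 0 (slab 0 t)) 0.
  by rewrite (pot_mirror hM) ?H0//; exact: bborel_slab.
have bm : bborel (mirror e 0 (slab 0 t)) by apply: bborel_mirror => //; exact: bborel_slab.
have ms := measurable_slab (- t) 0.
rewrite (pot_setDI hM _ bm ms) (@pot_null _ _ _ _ hM (_ `\` _)) ?add0r.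
- rewrite setIC /V (pot_setDI hM 0 (bborel_slab (- t) 0) (bborel_measurable bm)).
  by rewrite lerDr (pot_ge0 hM).
- exact: bborelD.
apply: (hyperplane_null (l := 0) e1); first exact: bborelD.
move=> z [[]]; rewrite dotp_hrefl// mulr0 sub0r => z0 zt.
have -> : perp (hrefl e 0 z) = perp z by rewrite /hrefl -scaleNr perp_shift.
move=> zr nz; apply/eqP; rewrite eq_le; apply/andP; split; first lra.
rewrite leNgt; apply/negP => z1; apply: nz; split => //; lra.
Qed.

Lemma vol_slab_trs a b s : vol (slab (a + s) (b + s)) = vol (slab a b).
Proof. by rewrite -trs_slab vol_trs//; exact: measurable_slab. Qed.

Lemma vol_slab_mul n s : 0 <= s -> vol (slab (- (n%:R * s)) 0) = n%:R * vol (slab (- s) 0).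
Proof.
move=> s0; elim: n => [|n IH].
  rewrite !mul0r oppr0 (_ : slab 0 0 = set0) ?vol0//.
  by apply/seteqP; split => // z [a b _]; move: b; rewrite ltNge a.
have ns : 0 <= n%:R * s by rewrite mulr_ge0.
rewrite (volDI (bborel_slab _ _) (measurable_slab (- (n%:R * s)) 0)).
rewrite -natr1 mulrDl mul1r [RHS]mulrDl mul1r addrC; congr (_ + _).
  rewrite -IH; congr vol; apply/seteqP; split => z; first by move=> [].
  by move=> [a b c]; split; split => //; lra.
rewrite -(vol_slab_trs (- s) 0 (- (n%:R * s))); congr vol; apply/seteqP; split => z /=.
  move=> [[a b c] nz]; split => //; first lra.
  by rewrite add0r ltNge; apply/negP => z1; apply: nz; split.
move=> [a b c]; split; first by split => //; lra.
by move=> [a' _ _]; lra.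
Qed.

(** The volume is bounded without being computed: n = floor (1/s) disjoint translates fit into the
    slab of width 1, and n >= 1 gives 1 < (n+1) s <= 2 n s. *)
Lemma V_bound : exists2 C, 0 < C & forall s, 0 <= s -> s <= 1 -> V (- s) 0 <= C * s.
Proof.
have M0 := kernel_bound_ge0 hM; pose m1 := vol (slab (-1) 0).
have m10 : 0 <= m1 by exact: vol_ge0.
exists (2 * M * m1 + 1); first by rewrite ltr_wpDl// !mulr_ge0.
move=> s s0 s1; apply: (le_trans (pot_le_vol hM _ (bborel_slab _ _))).
have [->|sn0] := eqVneq s 0.
  rewrite oppr0 (_ : slab 0 0 = set0) ?vol0 ?mulr0//.
  by apply/seteqP; split => // z [a b _]; move: b; rewrite ltNge a.
have sp : 0 < s by rewrite lt_neqAle eq_sym sn0.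
pose n := Num.truncn s^-1.
have /andP[n1 n2] : n%:R <= s^-1 < n.+1%:R by apply: truncn_itv; rewrite invr_ge0.
have n0 : (1 <= n)%N.
  rewrite lt0n; apply/negP => /eqP n0; move: n2; rewrite n0 ltNge => /negP; apply.
  by rewrite -[1%:R]invr1 lef_pV2 ?posrE.
have ns1 : n%:R * s <= 1 by rewrite -ler_pdivlMr// mul1r.
have ns2 : 1 < (n%:R + 1) * s by rewrite natr1 -ltr_pdivrMr// mul1r.
have nm : n%:R * vol (slab (- s) 0) <= m1.
  rewrite -vol_slab_mul//; apply: le_vol; [exact: bborel_slab|exact: measurable_slab|].
  by move=> z [a b c]; split => //; lra.
have nn : 1 <= n%:R :> R by rewrite ler1n.
have v0 := vol_ge0 (slab (- s) 0).
have : vol (slab (- s) 0) <= 2 * s * m1.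
  by move: (vol _) v0 nm => w v0 nm; nra.
move=> /(ler_wpM2l M0) hw; apply: (le_trans hw); nra.
Qed.

(* V (- s) 0 / s increases to a finite limit Phi0 as s decreases to 0, so a slab of width t close to
   the hyperplane has nearly the same mass as the one centered on it. *)
Lemma slab_diff eps : 0 < eps -> exists2 kappa, 0 < kappa & forall t, 0 < t -> t < kappa ->
  V (- (t / 2)) (t / 2) - V (- (t / 2) - kappa) (t / 2 - kappa) <= eps * t.
Proof.
move=> eps0; have [C C0 VC] := V_bound.
pose S := [set V (- s) 0 / s | s in [set s : R | 0 < s <= 1]].
have hS : has_sup S.
  split; first by exists (V (- 1) 0 / 1), 1 => //=; rewrite ltr01 lexx.
  by exists C => _ [s /= /andP[s0 s1] <-]; rewrite ler_pdivrMr// VC// ltW.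
have e20 : 0 < eps / 2 by rewrite divr_gt0.
(* At the scale [be] the quotient is within eps / 2 of its supremum. The remaining eps / 2 is spent
   on the slab between -k' and 0, whose potential is at most C k' <= be eps / 2; this dictates
   [kappa]. *)
have [_ [be /= /andP[b0 b1] <-]] := sup_adherent e20 hS; rewrite ltr_pdivlMr// => hbe.
have Sle s : 0 < s -> s <= 1 -> V (- s) 0 <= sup S * s.
  move=> s0 s1; rewrite -ler_pdivrMr//; apply: ub_le_sup; first by case: hS.
  by exists s => //=; rewrite s0.
pose kappa := Num.min (be / 4) (be * eps / (4 * (C + 1))).
have C1 : 0 < 4 * (C + 1) by rewrite mulr_gt0// ltr_wpDl// ltW.
have k0 : 0 < kappa by rewrite lt_min !divr_gt0// mulr_gt0.
have k1 : kappa <= be / 4 by rewrite ge_min lexx.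
have k2 : kappa * (4 * (C + 1)) <= be * eps by rewrite -ler_pdivlMr// ge_min lexx orbT.
exists kappa => // t t0 tk.
(* The slab [I] of width t starts at -k'. Its translates to the left are farther from the origin,
   hence have smaller potential, and n of them with n t <= be cover the range from -be to -k'. This
   bounds I from below. *)
pose k' := kappa + t / 2; pose I := V (- k') (- k' + t).
have k't : t <= k' by rewrite /k'; lra.
have k'b : k' < be by rewrite /k'; lra.
have VI n : V (- k' - n%:R * t) (- k') <= n%:R * I.
  elim: n => [|n IH].
    rewrite !mul0r subr0 /V (_ : slab _ _ = set0) ?(pot_null hM) ?vol0//.
      exact: bborel0.
    by apply/seteqP; split => // z [a b _]; move: b; rewrite ltNge a.
  have nt : 0 <= n%:R * t by rewrite mulr_ge0// ltW.
  rewrite -natr1 !mulrDl !mul1r (@V_add _ (- k' - n%:R * t)); [|lra|lra].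
  rewrite addrC lerD//.
  have := @V_mono (- k' - (n%:R * t + t)) (- k' - n%:R * t) (n%:R * t + t).
  rewrite /I (_ : - k' - (n%:R * t + t) + (n%:R * t + t) = - k'); last by ring.
  rewrite (_ : - k' - n%:R * t + (n%:R * t + t) = - k' + t); last by ring.
  by apply; lra.
pose n := (Num.truncn ((be - k') / t)).+1.
have /andP[n1 n2] : (Num.truncn ((be - k') / t))%:R <= (be - k') / t < n%:R.
  by apply: truncn_itv; rewrite divr_ge0// ?(ltW t0)// subr_ge0 ltW.
move: n1 n2; rewrite ler_pdivlMr// ltr_pdivrMr// => n1 n2.
have nt : n%:R * t <= be.
  by rewrite /n -natr1 mulrDl mul1r; lra.
have I0 : 0 <= I by exact: V_ge0.
have Vbe : V (- be) (- k') <= n%:R * I.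
  apply: le_trans (VI n); rewrite [leRHS](@V_add _ (- be)); [|lra|lra].
  by rewrite lerDr V_ge0.
have Vsplit : V (- be) 0 = V (- be) (- k') + V (- k') 0 by apply: V_add; lra.
have Vk' : V (- k') 0 <= C * k' by apply: VC; lra.
have bI : t * (V (- be) 0 - C * k') <= be * I.
  apply: (@le_trans _ _ (t * (n%:R * I))).
    by rewrite ler_wpM2l// ?(ltW t0)//; lra.
  by rewrite mulrA (mulrC t) ler_wpM2r.
have Vt : V (- (t / 2)) (t / 2) <= sup S * t.
  rewrite (@V_add _ 0); [|lra|lra].
  have h1 : V (- (t / 2)) 0 <= sup S * (t / 2) by apply: Sle; lra.
  have h2 : V 0 (t / 2) <= V (- (t / 2)) 0 by apply: V_reflect; lra.
  lra.
have -> : V (- (t / 2) - kappa) (t / 2 - kappa) = I.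
  by rewrite /I /k'; congr (V _ _); lra.
have hk : C * k' <= be * (eps / 2) by rewrite /k'; nra.
rewrite -(ler_pM2l b0); apply: (@le_trans _ _ (be * (sup S * t) - t * (V (- be) 0 - C * k'))).
  by rewrite mulrBr lerB// ler_pM2l.
have : t * ((sup S - eps / 2) * be) <= t * V (- be) 0 by rewrite ler_wpM2l// ltW.
have : t * (C * k') <= t * (be * (eps / 2)) by rewrite ler_wpM2l// ltW.
lra.
Qed.

End slab.

Lemma half_gap (R : realFieldType) (a b f0 fn g u : R) :
  u = a - b -> a - u / 4 <= fn -> f0 <= b + u / 4 -> fn - f0 <= g -> u / 2 <= g.
Proof. lra. Qed.

(** * Strict decrease of the potential near a critical hyperplane *)

Section critical_position.
Context {R : realType} {d : nat}.
Local Notation E := 'rV[R]_d.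
Local Notation mu := (lebd d).
Implicit Types (A B : set E) (x y z p : E).
Variables (h : E -> R) (M : R).
Hypothesis hM : radial_kernel M h.
Variables (Om : set E) (e : E).
Hypothesis bOm : bborel Om.
Hypothesis e1 : dotp e e = 1.
Variable c : R.
Local Notation v := (pot h Om).
Hypothesis vc : forall x, mbd Om x -> v x = c.
Variable l0 : R.
Hypothesis D0 : forall l, l0 <= l -> vol (capD Om e l) = 0.
Hypothesis G0 : forall l, l0 <= l -> 0 < vol (capG Om e l).

Let mOm : measurable Om. Proof. by case: bOm. Qed.

(* The translates of A by s e, 0 <= s <= ell, lie in capG Om e l0 up to null sets. *)
Definition sweeps A ell := [/\ bborel A, 0 < vol A, 0 < ell,
  forall y, A y -> dotp y e < l0 - 2 * ell &
  forall s, 0 <= s -> s <= ell ->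
    vol (trs (s *: e) A `\` Om) = 0 /\ vol (trs (s *: e) A `&` mirror e l0 Om) = 0].

Variables (A : set E) (ell : R).
Hypothesis HA : sweeps A ell.

Let bA : bborel A. Proof. by case: HA. Qed.
Let mA : measurable A. Proof. by case: bA. Qed.
Let ell0 : 0 < ell. Proof. by case: HA. Qed.
Let Aside y : A y -> dotp y e < l0 - 2 * ell. Proof. by case: HA => _ _ _ + _; apply. Qed.

Lemma enorm_along a s t : s <= t -> s + t <= 2 * dotp a e ->
  enorm (a - t *: e) <= enorm (a - s *: e).
Proof.
move=> st sta; rewrite enorm_le !(dotpBl, dotpBr, dotpZl, dotpZr) e1 (dotpC e).
by have : 0 <= (t - s) * (2 * dotp a e - (s + t)); [rewrite mulr_ge0; lra|nra].
Qed.

Lemma enorm_along_lt a s t : s < t -> s + t < 2 * dotp a e ->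
  enorm (a - t *: e) < enorm (a - s *: e).
Proof.
move=> st sta; rewrite enorm_lt !(dotpBl, dotpBr, dotpZl, dotpZr) e1 (dotpC e).
by have : 0 < (t - s) * (2 * dotp a e - (s + t)); [rewrite mulr_gt0; lra|nra].
Qed.

Lemma pot_along p s t : s <= t -> s + t <= 2 * (dotp p e - l0 + 2 * ell) ->
  pot h A (p - s *: e) <= pot h A (p - t *: e).
Proof.
move=> st stp; apply: (pot_mono hM) => // y Ay.
rewrite addrAC [in leRHS]addrAC; apply: enorm_along => //.
by rewrite dotpBl; have := Aside Ay; lra.
Qed.

(** The mirror image at level l is a translate of the one at l0, so avoiding it after a shift by s e
    means avoiding the latter after a shift by (s + 2 (l0 - l)) e. With s <= ell / 2 and l0 - l <
    ell / 4 this shift stays below [ell]. *)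
Lemma sweep_sub l s : l0 - ell / 4 < l -> l <= l0 -> 0 <= s -> s <= ell / 2 ->
  vol (trs (s *: e) A `\` capG Om e l) = 0.
Proof.
move=> l1 l2 s0 s1; have bt := bborel_trs (s *: e) bA.
have [_ _ _ _ sw] := HA.
have [swO _] : vol (trs (s *: e) A `\` Om) = 0 /\ vol (trs (s *: e) A `&` mirror e l0 Om) = 0.
  by apply: sw => //; lra.
have [_ swm] := sw (s + 2 * (l0 - l)) ltac:(lra) ltac:(lra).
have mm := measurable_mirror e l mOm.
have ml0 := measurable_mirror e l0 mOm.
have mE : vol (trs (s *: e) A `&` mirror e l Om) = 0.
  rewrite (_ : l = l0 + (l - l0)) ?mirror_shift//; last by ring.
  rewrite -[RHS]swm -[RHS](vol_trs ((2 * (l - l0)) *: e)); last first.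
    by apply: measurableI; [exact: measurable_trs|exact: ml0].
  by rewrite trsI trs_comp -scalerDl (_ : s + 2 * (l0 - l) + 2 * (l - l0) = s)//; ring.
apply/eqP; rewrite eq_le vol_ge0 andbT -(addr0 0) -{1}swO -mE; apply: vol_le_add.
- exact: bborelD.
- exact: bborelI.
- by apply: measurableD; [case: bt|case: (bborel_capG e bOm l)].
move=> y [ty nG]; have [Oy|nOy] := pselect (Om y); last by left.
right; split => //; apply: contrapT => nmy; apply: nG; split => //; split => //.
rewrite /lside/=; have := Aside ty; rewrite -scaleNr dotpDl dotpZl e1; lra.
Qed.

(** Up to a null set, the gain contains the translate of A by s e. What remains of it lies left of
    the hyperplane bisecting p and p + t e, so it is nearer to p and its contribution to the
    difference is nonnegative. *)
Lemma capG_sweep_diff p t s : 0 < t -> l0 - ell / 4 < dotp p e + t / 2 ->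
  dotp p e + t / 2 <= l0 -> 0 <= s -> s <= ell / 2 ->
  pot h A (p - s *: e) - pot h A (p + t *: e - s *: e) <=
  pot h (capG Om e (dotp p e + t / 2)) p - pot h (capG Om e (dotp p e + t / 2)) (p + t *: e).
Proof.
move=> t0 l1 l2 s0 s1; set l := dotp p e + t / 2; set G := capG Om e l.
have bG : bborel G := bborel_capG e bOm l.
have bt := bborel_trs (s *: e) bA; have [mt _] := bt; have [mG _] := bG.
have AG := sweep_sub l1 l2 s0 s1.
have GA x : pot h (G `&` trs (s *: e) A) x = pot h A (x - s *: e).
  rewrite -(pot_trs hM)//; apply: (pot_ae hM) => //.
  - exact: bborelI.
  - by rewrite (_ : _ `\` _ = set0) ?vol0//; apply/seteqP; split => // y [[]].
  - rewrite -[RHS]AG; congr vol; apply/seteqP; split => y [ty h1]; split => //.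
      by move=> Gy; apply: h1.
    by move=> [Gy _]; apply: h1.
rewrite !(pot_setDI hM _ bG mt) !GA.
have : pot h (G `\` trs (s *: e) A) (p + t *: e) <= pot h (G `\` trs (s *: e) A) p.
  apply: (pot_mono hM); first exact: bborelD.
  move=> y [[[_ yl] _] _]; rewrite -hrefl_mid ltW//.
  by apply: hrefl_far => //; rewrite ltrDl divr_gt0.
lra.
Qed.

(** The same difference [Gd] bounds the increments of the potential of A along p + t e - k t e for
    all k < n, with n about ell / (2 t). Summing telescopes to the change of this potential over a
    fixed length, at least w / 2, whence Gd >= (w / ell) t. *)
Lemma capG_diff_ge x0 : dotp x0 e = l0 ->
  exists m eta, [/\ 0 < m, 0 < eta & forall p t, `|p - x0| < eta -> 0 < t -> t < eta ->
    dotp p e + t / 2 <= l0 ->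
    m * t <= pot h (capG Om e (dotp p e + t / 2)) p -
             pot h (capG Om e (dotp p e + t / 2)) (p + t *: e)].
Proof.
move=> x0l; have e4 : 0 < ell / 4 by rewrite divr_gt0.
pose w := pot h A (x0 - (ell / 4) *: e) - pot h A x0.
have w0 : 0 < w.
  rewrite subr_gt0; apply: (pot_strict hM) => //; last by case: HA.
  move=> y Ay; rewrite addrAC -[x0 - y in ltRHS]subr0 -(scale0r e).
  by apply: enorm_along_lt; rewrite ?dotpBl//; have := Aside Ay; lra.
have w4 : 0 < w / 4 by rewrite divr_gt0.
have pc : continuous (pot h A) := pot_continuous hM bA.
have [r1 r10 H1] := continuous_rV_norm (x0 - (ell / 4) *: e) pc w4.
have [r2 r20 H2] := continuous_rV_norm x0 pc w4.
have e8 : 0 < ell / 16 by rewrite divr_gt0.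
have [r3 r30 H3] := continuous_rV_norm x0 (@continuous_dotp R d e) e8.
have en := normr_ge0 e.
pose eta := Num.min (Num.min r1 r3) (Num.min (r2 / (1 + `|e|)) (ell / 16)).
have e0 : 0 < 1 + `|e| by lra.
have eta0 : 0 < eta by rewrite !lt_min r10 r30 e8 divr_gt0.
exists (w / ell), eta; split => //; first by rewrite divr_gt0.
move=> p t; rewrite !lt_min => /andP[/andP[p1 p3] /andP[p2 p4]] t0 /andP[/andP[t1 t3] /andP[t2 t4]] pl.
have pl1 : l0 - ell / 16 < dotp p e.
  by have := H3 p p3; rewrite x0l ltr_distl => /andP[].
have pl2 : l0 - ell / 4 < dotp p e + t / 2 by lra.
pose n := Num.truncn (ell / 2 / t).
have /andP[n1 n2] : n%:R <= ell / 2 / t < n.+1%:R.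
  by apply: truncn_itv; rewrite !divr_ge0// ltW.
move: n1 n2; rewrite ler_pdivlMr// ltr_pdivrMr// -[n.+1%:R]natr1 mulrDl mul1r => n1 n2.
set Gd := (X in _ <= X).
pose F (k : nat) := pot h A (p + t *: e - (k%:R * t) *: e).
have FS k : F k.+1 = pot h A (p - (k%:R * t) *: e).
  by rewrite /F -[k.+1%:R]natr1; congr (pot h A _); apply/rowP => i; rewrite !mxE; ring.
have sumF k : (k <= n)%N -> F k - F 0%N <= k%:R * Gd.
  elim: k => [|k IH] kn; first by rewrite subrr mul0r.
  have kt : k%:R * t <= ell / 2.
    by apply: le_trans n1; rewrite ler_pM2r// ler_nat ltnW.
  have h1 : F k.+1 - F k <= Gd.
    by rewrite FS; exact: (capG_sweep_diff t0 pl2 pl (mulr_ge0 (ler0n _ _) (ltW t0)) kt).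
  have := lerD h1 (IH (ltnW kn)).
  by rewrite addrA subrK -[k.+1%:R]natr1 (mulrDl k%:R) mul1r [Gd + _]addrC.
have [n0|n0] := posnP n; first by move: n2; rewrite n0 mul0r; lra.
have Fn : pot h A (x0 - (ell / 4) *: e) - w / 4 <= F n.
  rewrite -(prednK n0) FS; apply: (@le_trans _ _ (pot h A (p - (ell / 4) *: e))).
    have := H1 (p - (ell / 4) *: e); rewrite opprB addrA subrK => /(_ p1).
    by rewrite ltr_distl => /andP[/ltW].
  have nE : n.-1%:R * t = n%:R * t - t by rewrite -{2}(prednK n0) -[n.-1.+1%:R]natr1; ring.
  by apply: pot_along; rewrite nE; lra.
have F0 : F 0%N <= pot h A x0 + w / 4.
  rewrite /F mul0r scale0r subr0.
  suff px0 : `|p + t *: e - x0| < r2.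
    by have := H2 _ px0; rewrite ltr_distl => /andP[_ /ltW].
  rewrite addrAC (le_lt_trans (ler_normD _ _))// normrZ gtr0_norm//.
  by move: p2 t2; rewrite !ltr_pdivlMr// => p2 t2; have := normr_ge0 (p - x0); nra.
have nG := sumF n (leqnn n).
have nG2 : w / 2 <= n%:R * Gd.
  exact: (half_gap erefl Fn F0 nG).
have nn : 0 < n%:R :> R by rewrite ltr0n.
rewrite -(ler_pM2l nn); apply: le_trans nG2.
rewrite (_ : n%:R * (w / ell * t) = w / ell * (n%:R * t)); last by ring.
apply: (@le_trans _ _ (w / ell * (ell / 2))); first by rewrite ler_pM2l// divr_gt0.
by rewrite mulrA divfK ?gt_eqF.
Qed.

(** By [capD_strip] the defect lies, up to a null set, in a slab of width [kappa] left of the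
    hyperplane. The rest of the slab is nearer to p, so the slab has at least the difference of the
    defect. Since the slabs seen from p and from p + t e overlap, only their end pieces of width t
    remain, which [slab_diff] compares. *)
Lemma capD_diff_le x0 m : dotp x0 e = l0 -> 0 < m ->
  exists2 eta, 0 < eta & forall p t, `|p - x0| < eta -> 0 < t -> t < eta ->
    dotp p e + t / 2 <= l0 -> l0 - eta < dotp p e + t / 2 ->
    pot h (capD Om e (dotp p e + t / 2)) p - pot h (capD Om e (dotp p e + t / 2)) (p + t *: e)
      <= m * t.
Proof.
move=> x0l m0.
have [N NP] := capD_bounded bOm e1 l0.
(* Large enough for the cylinder around p to contain every defect set at a level between l0 - 1 and
   l0. *)
pose r := (`|N| + (`|x0| + 1)) * (1 + d%:R * `|e| * `|e|) + 1.
have [kappa k0 Hk] := slab_diff hM r e1 m0.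
have k20 : 0 < kappa / 2 by rewrite divr_gt0.
have [eta eta0 He] := capD_strip hM bOm e1 vc (D0 (lexx l0)) (G0 (lexx l0)) k20.
exists (Num.min (Num.min eta 1) kappa).
  by rewrite !lt_min eta0 ltr01 k0.
move=> p t; rewrite !lt_min => /andP[/andP[_ p1] _] t0 /andP[_ tk] pl.
rewrite ltrBlDr -ltrBlDl !lt_min => /andP[/andP[l1 l2] l3].
set l := dotp p e + t / 2 in pl l1 l2 l3 *; set D := capD Om e l.
have bD : bborel D := bborel_capD bOm e1 l; have [mD _] := bD.
pose S := trs p (slab e r (t / 2 - kappa) (t / 2)).
have bS : bborel S by apply: bborel_trs; exact: bborel_slab.
have [mS _] := bS.
have DS : vol (D `\` S) = 0.
  have mk : measurable [set y : E | dotp y e <= l0 - kappa / 2].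
    by apply: measurable_sublevelW; exact: measurable_dotp.
  apply: (le_vol0 (B := D `&` [set y | dotp y e <= l0 - kappa / 2])).
  - exact: bborelI.
  - exact: measurableD.
  - move=> y [Dy nS]; split => //=; rewrite leNgt; apply/negP => yl; apply: nS.
    have yN : `|y| <= N by apply: (NP l) => //; lra.
    have [[_ yl'] _] := Dy; rewrite /lside/= in yl'.
    have pl' : dotp p e + t / 2 <= l0 := pl.
    rewrite /S/trs/slab/= dotpBl; split; [lra|rewrite /l in yl'; lra|].
    rewrite /perp (le_lt_trans (ler_normB _ _))// normrZ.
    have y1 : `|y - p| <= `|N| + (`|x0| + 1).
      rewrite (le_trans (ler_normB _ _))// lerD//; first exact: le_trans yN (ler_norm _).
      by rewrite -(subrK x0 p) (le_trans (ler_normD _ _))// addrC lerD2l ltW.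
    have y2 := dotp_le_norm (y - p) e.
    have y3 : `|dotp (y - p) e| * `|e| <= `|y - p| * (d%:R * `|e|) * `|e| by rewrite ler_wpM2r.
    have y4 : `|y - p| * (1 + d%:R * `|e| * `|e|) <= (`|N| + (`|x0| + 1)) * (1 + d%:R * `|e| * `|e|).
      by rewrite ler_wpM2r// addr_ge0// !mulr_ge0.
    rewrite /r; lra.
  - by apply: He => //; lra.
have Sside y : S y -> dotp y e < l.
  by rewrite /S/trs/slab/= dotpBl /l => -[_ + _]; lra.
have DE x : pot h D x = pot h (S `&` D) x.
  rewrite (pot_setDI hM x bD mS) (pot_null hM _ (bborelD bD mS) DS) add0r setIC.
  by [].
have Smono : pot h (S `\` D) (p + t *: e) <= pot h (S `\` D) p.
  apply: (pot_mono hM); first exact: bborelD.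
  move=> y [/Sside yl _]; rewrite -hrefl_mid ltW//.
  by apply: hrefl_far => //; rewrite ltrDl divr_gt0.
have Sp : pot h S p = V h e r (t / 2 - kappa) (t / 2).
  by rewrite /S (pot_trs hM) ?subrr//; exact: bborel_slab.
have Sq : pot h S (p + t *: e) = V h e r (t / 2 - kappa - t) (t / 2 - t).
  rewrite /S (pot_trs hM); last exact: bborel_slab.
  by rewrite addrAC subrr add0r (V_trs hM _ e1) scaleNr opprK.
have Va := @V_add R d h M hM e r (t / 2 - kappa) (- (t / 2)) (t / 2) ltac:(lra) ltac:(lra).
have Vb := @V_add R d h M hM e r (- (t / 2) - kappa) (t / 2 - kappa) (- (t / 2)) ltac:(lra) ltac:(lra).
have h1 := Hk t t0 tk.
have Sd : pot h S p - pot h S (p + t *: e) <= m * t.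
  rewrite Sp Sq (_ : t / 2 - kappa - t = - (t / 2) - kappa); last by field.
  rewrite (_ : t / 2 - t = - (t / 2)); last by field.
  by rewrite Va Vb; lra.
apply: le_trans Sd; rewrite !DE (pot_setDI hM p bS mD) (pot_setDI hM (p + t *: e) bS mD); lra.
Qed.

Lemma pot_decr_near x0 : dotp x0 e = l0 ->
  exists2 eta, 0 < eta & forall p t, `|p - x0| < eta -> 0 < t -> t < eta ->
    v (p + t *: e) < v p.
Proof.
move=> x0l; have [m [eta1 [m0 eta10 H1]]] := capG_diff_ge x0l.
have m20 : 0 < m / 2 by rewrite divr_gt0.
have [eta2 eta20 H2] := capD_diff_le x0l m20.
have e20 : 0 < eta2 / 2 by rewrite divr_gt0.
have [r3 r30 H3] := continuous_rV_norm x0 (@continuous_dotp R d e) eta20.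
exists (Num.min (Num.min eta1 eta2) r3); first by rewrite !lt_min eta10 eta20.
move=> p t; rewrite !lt_min => /andP[/andP[p1 p2] p3] t0 /andP[/andP[t1 t2] t3].
have [l1|l1] := leP l0 (dotp p e + t / 2).
  by apply: (pot_decr hM bOm e1) => //; [exact: D0|exact: G0].
have pl : l0 - eta2 < dotp p e + t / 2.
  by have := H3 p p3; rewrite x0l ltr_distl => /andP[]; lra.
have := pot_hrefl_diff hM bOm e1 (dotp p e + t / 2) p; rewrite hrefl_mid.
have := H1 p t p1 t0 t1 (ltW l1); have := H2 p t p2 t0 t2 (ltW l1) pl.
have : 0 < m * t by rewrite mulr_gt0.
rewrite -subr_gt0; lra.
Qed.

End critical_position.

Lemma convex_comb_itv (R : realFieldType) (s a b : R) : 0 <= s -> s <= 1 -> a <= b ->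
  a <= b + s * (a - b) <= b.
Proof. by move=> s0 s1 ab; apply/andP; split; nra. Qed.

(** * Moving the hyperplane past a critical position *)

Section critical_position.
Context {R : realType} {d : nat}.
Local Notation E := 'rV[R]_d.
Local Notation mu := (lebd d).
Implicit Types (A B : set E) (x y z p : E).
Variables (h : E -> R) (M : R).
Hypothesis hM : radial_kernel M h.
Variables (Om : set E) (e : E).
Hypothesis bOm : bborel Om.
Hypothesis e1 : dotp e e = 1.
Variable c : R.
Local Notation v := (pot h Om).
Hypothesis vc : forall x, mbd Om x -> v x = c.

Let mOm : measurable Om. Proof. by case: bOm. Qed.

Section at_l0.
Variable l0 : R.
Hypothesis D0 : forall l, l0 <= l -> vol (capD Om e l) = 0.
Hypothesis G0 : forall l, l0 <= l -> 0 < vol (capG Om e l).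
Variables (A : set E) (ell : R).
Hypothesis HA : sweeps Om e l0 A ell.

(** Compactness of the bounded part of the hyperplane makes [pot_decr_near] uniform; a point p near
    it is written x + s e with x on the hyperplane. *)
Lemma pot_decr_strip N : exists2 eta, 0 < eta & forall p t, `|p| <= N ->
  `|dotp p e - l0| < eta -> 0 < t -> t < eta -> v (p + t *: e) < v p.
Proof.
pose K : set E := [set x | `|x| <= N + `|e|] `&` [set x | dotp x e = l0].
have cK : compact K.
  apply: bounded_closed_compact.
    exists (N + `|e|); split; first exact: num_real.
    by move=> K' NK y /= [yN _]; exact: le_trans yN (ltW NK).
  apply: closedI.
    apply: (@closed_comp _ _ (fun y : E => `|y|) [set r | r <= N + `|e|]); last exact: closed_le.
    by move=> y _; exact: norm_continuous.
  apply: (@closed_comp _ _ (fun y : E => dotp y e) [set l0]); last exact: closed_eq.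
  by move=> y _; exact: (@continuous_dotp R d e).
pose P (i : R) x := forall s t, `|s| < i -> 0 < t -> t < i ->
  v (x + s *: e + t *: e) < v (x + s *: e).
have e0 : 0 < `|e| + 1 by rewrite ltr_wpDl.
have hyp : forall x0, K x0 -> \forall x \near x0 & i \near (0 : R)^'+, P i x.
  move=> x0 [_ x0l]; have [eta eta0 H] := pot_decr_near hM bOm e1 vc D0 G0 HA x0l.
  have eta20 : 0 < eta / 2 by rewrite divr_gt0.
  exists (ball x0 (eta / 2), [set i | 0 < i < eta / 2 / (`|e| + 1)]).
    have m0 : 0 < eta / 2 / (`|e| + 1) by rewrite divr_gt0.
    by split; [exact: nbhsx_ballx|near=> i; rewrite /=; apply/andP; split => //].
  move=> [x i] /= [x0x /andP[i0]]; rewrite ltr_pdivlMr// => ie s t si t0 ti.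
  apply: H => //; last first.
    by apply: (lt_trans ti); move: ie; rewrite mulrDr mulr1; have := mulr_ge0 (ltW i0) (normr_ge0 e); lra.
  rewrite addrAC (le_lt_trans (ler_normD _ _))// normrZ.
  move: x0x; rewrite ball_rVE/= distrC => x0x.
  have : `|s| * `|e| <= i * `|e| by rewrite ler_wpM2r// ltW.
  by move: ie; rewrite mulrDr mulr1; lra.
have [eta /= eta0 HE] := (compact_near_coveringP K).1 cK _ _ P _ hyp.
have m0 : 0 < Num.min (eta / 2) 1 by rewrite lt_min divr_gt0// ltr01.
exists (Num.min (eta / 2) 1) => // p t pN; rewrite !lt_min => /andP[pl p1] t0 /andP[t1 t2].
have HK : K `<=` P (eta / 2).
  apply: HE; last by rewrite divr_gt0.
  by rewrite /= sub0r normrN gtr0_norm ?divr_gt0// ltr_pdivrMr// ltr_pMr// ltrDl.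
pose s := dotp p e - l0; have Kx : K (p - s *: e).
  split => /=; last by rewrite dotpBl dotpZl e1 /s; ring.
  rewrite (le_trans (ler_normB _ _))// lerD// normrZ ler_piMl//; exact: ltW.
by have := HK _ Kx s t pl t0 t1; rewrite subrK.
Unshelve. all: by end_near. Qed.

(** For a defect point y in the strip, there is one boundary point between y and R_l y, and another
    between R_l y and R_l0 y. They are ordered along e and v = c at both, against the strict
    decrease, unless they coincide with R_l y; that case is confined to a null set. *)
Lemma capD_extend : exists2 eta, 0 < eta & forall l, l0 - eta < l -> l <= l0 ->
  vol (capD Om e l) = 0.
Proof.
have [N NP] := capD_bounded bOm e1 l0.
have [eta eta0 H] := pot_decr_strip (N + 4 * `|e|).
pose kappa := Num.min (eta / 4) 1.
have k0 : 0 < kappa by rewrite lt_min divr_gt0// ltr01.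
have k1 : kappa <= eta / 4 by rewrite ge_min lexx.
have k2 : kappa <= 1 by rewrite ge_min lexx orbT.
have [eta1 eta10 H1] := capD_strip hM bOm e1 vc (D0 (lexx l0)) (G0 (lexx l0)) k0.
have en := normr_ge0 e.
exists (Num.min eta1 kappa); first by rewrite lt_min eta10.
move=> l; rewrite ltrBlDr -ltrBlDl lt_min => /andP[l1 l2] ll0.
have strip := H1 l ltac:(lra) ll0.
have bD : bborel (capD Om e l) := bborel_capD bOm e1 l; have [mD _] := bD.
have mk : measurable [set y : E | dotp y e <= l0 - kappa].
  by apply: measurable_sublevelW; exact: measurable_dotp.
pose B := capD Om e l `\` [set y : E | dotp y e <= l0 - kappa].
have bB : bborel B by exact: bborelD.
have BP y : B y -> [/\ `|y| <= N, dotp y e < l, l0 - kappa < dotp y e & capD Om e l y].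
  move=> [Dy /negP]; rewrite -ltNge => yl; have [[_ yl'] _] := Dy; split => //.
  by apply: (NP l) => //; lra.
have yN y s : B y -> 0 <= s -> s <= 2 * (l0 - dotp y e) -> `|y + s *: e| <= N + 4 * `|e|.
  move=> /BP[yN yl yl' _] s0 s1; rewrite (le_trans (ler_normD _ _))// lerD//.
  by rewrite normrZ ler_wpM2r// ger0_norm//; lra.
have RE l' y : hrefl e l' y = y + (2 * (l' - dotp y e)) *: e.
  by rewrite /hrefl -scaleNr; congr (_ + _ *: _); ring.
(* The images of defect points at which v = c: no two of them lie on a short segment parallel to e,
   so they form a null set. *)
pose S := mirror e l B `&` [set x | v x = c].
have bS : bborel S.
  by apply: bborelI; [exact: bborel_mirror|exact: (measurable_pot_level hM)].
have S0 : vol S = 0.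
  apply: (translates_null (e := e) bS eta0) => x t [Bx vx] t0 t1 [_ vxt].
  have [yN' yl yl' _] := BP _ Bx; rewrite dotp_hrefl// in yl yl'.
  have : v (x + t *: e) < v x.
    apply: H => //; last by rewrite ltr_norml; apply/andP; split; lra.
    rewrite -(hreflK e1 l x) RE; apply: yN => //; rewrite dotp_hrefl//; lra.
  by rewrite vx vxt ltxx.
have mOc := measurableC mOm.
have mN1 : measurable (inn Om `\` Om) by apply: measurableD => //; exact: measurable_inn.
have mN2 : measurable (inn (~` Om) `\` ~` Om) by apply: measurableD => //; exact: measurable_inn.
have N1 := vol_null_setI bB mN1 (innD_null mOm).
have mN2' := measurable_mirror e l mN2.
have N2 : vol (B `&` mirror e l (inn (~` Om) `\` ~` Om)) = 0.
  by apply: vol_null_setI => //; rewrite lebd_hrefl// innD_null.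
have bS' : bborel (mirror e l S) by exact: bborel_mirror.
have N3 : vol (mirror e l S) = 0 by rewrite vol_mirror//; case: bS.
rewrite (volDI bD mk) strip addr0; apply/eqP; rewrite eq_le vol_ge0 andbT.
have b1 : bborel (B `&` (inn Om `\` Om)) by exact: bborelI.
have b2 : bborel (B `&` mirror e l (inn (~` Om) `\` ~` Om)) by exact: bborelI.
apply: (@le_trans _ _ (vol ((B `&` (inn Om `\` Om)) `|` (B `&` mirror e l (inn (~` Om) `\` ~` Om)))
  + vol (mirror e l S))); last first.
  rewrite N3 addr0 -(addr0 0) -{1}N1 -N2; apply: vol_le_add => //.
  by apply: measurableU; [case: b1|case: b2].
apply: vol_le_add => //; [exact: bborelU|by case: bB|].
move=> y By; have [yN' yl yl' Dy] := BP y By; have [[mRy _] nOy] := Dy.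
have [iy|niy] := pselect (inn Om y); first by left; left.
have [oy|noy] := pselect (inn (~` Om) (hrefl e l y)).
  by left; right; split => //; split => //; apply; exact: mRy.
have [vR|vR] := pselect (v (hrefl e l y) = c).
  by right; split; rewrite /mirror/= ?hreflK.
exfalso.
have y0l : dotp y e < l0 by lra.
have niR : ~ inn Om (hrefl e l0 y).
  by move=> /(inn_mirror bOm e1 (D0 (lexx l0)) y0l).
(* The two boundary points are y + s a e and y + (b + s' (a - b)) e; the first displacement is at
   most a and the second at least a. *)
have [s [s0 s1 ms]] := segment_mbd mOm niy noy.
have [s' [s'0 s'1 ms']] := segment_mbd mOm niR noy.
pose a := 2 * (l - dotp y e); pose b := 2 * (l0 - dotp y e).
have pE : y + s *: (hrefl e l y - y) = y + (s * a) *: e.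
  by rewrite RE addrAC subrr add0r scalerA.
have qE : hrefl e l0 y + s' *: (hrefl e l y - hrefl e l0 y) = y + (b + s' * (a - b)) *: e.
  by rewrite !RE -/a -/b; apply/rowP => i; rewrite !mxE; ring.
rewrite pE in ms; rewrite qE in ms'.
have a0 : 0 < a by rewrite /a; lra.
have ab : a <= b by rewrite /a /b; lra.
have sa : s * a <= a by rewrite ler_piMl// ltW.
have sa0 : 0 <= s * a by rewrite mulr_ge0// ltW.
have /andP[sb sb'] := convex_comb_itv s'0 s'1 ab.
(* Equality forces both displacements to be a, so that R_l y itself would be a boundary point, where
   v = c. *)
have [E1|t0] : b + s' * (a - b) - s * a = 0 \/ 0 < b + s' * (a - b) - s * a.
- have : 0 <= b + s' * (a - b) - s * a by lra.
  by rewrite le_eqVlt => /orP[/eqP <-|]; [left|right].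
- apply: vR; rewrite RE (_ : 2 * (l - dotp y e) = s * a); first exact: vc ms.
  by rewrite -/a; lra.
have bb : b < 2 * kappa by rewrite /b; lra.
have : v (y + (s * a) *: e + (b + s' * (a - b) - s * a) *: e) < v (y + (s * a) *: e).
  apply: H => //; [apply: yN => //; rewrite -/b; lra| |lra].
  rewrite dotpDl dotpZl e1 mulr1 ltr_norml; rewrite /b in sb' bb sb ab; apply/andP; split; lra.
rewrite -addrA -scalerDl (_ : s * a + _ = b + s' * (a - b)); last by ring.
by rewrite (vc ms) (vc ms') ltxx.
Qed.

End at_l0.

Hypothesis Om0 : 0 < vol Om.
Hypothesis SW : forall l0, (forall l, l0 <= l -> vol (capD Om e l) = 0) ->
  (forall l, l0 <= l -> 0 < vol (capG Om e l)) -> exists A ell, sweeps Om e l0 A ell.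

Lemma capG_gt0 l : vol (capD Om e l) = 0 -> \int[mu]_(y in Om) dotp y e < l * vol Om ->
  0 < vol (capG Om e l).
Proof.
move=> Dl bl; rewrite lt_neqAle vol_ge0 andbT eq_sym; apply/eqP => Gl.
by move: bl; rewrite (symmetric_bary bOm e1 Dl Gl) ltxx.
Qed.

Lemma capD_null l : \int[mu]_(y in Om) dotp y e < l * vol Om -> vol (capD Om e l) = 0.
Proof.
set b := Rintegral _ _ _ => bl; apply: contrapT => Dl.
pose S := [set l1 : R | b < l1 * vol Om /\ forall l', l1 <= l' -> vol (capD Om e l') = 0].
have [N HN] : exists N, forall l', N <= l' -> capD Om e l' = set0.
  have [_ [N HN]] := bOm; exists (N * (d%:R * `|e|)) => l' l'N.
  apply/seteqP; split => // y [[/HN mRy yl] _].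
  have := dotp_le_norm (hrefl e l' y) e; rewrite dotp_hrefl// => h1.
  have h2 : `|hrefl e l' y| * (d%:R * `|e|) <= N * (d%:R * `|e|).
    by rewrite ler_wpM2r ?mulr_ge0// ltW.
  by rewrite /lside/= in yl; have := ler_norm (2 * l' - dotp y e); lra.
have lS l1 : S l1 -> l <= l1.
  move=> [_ H]; rewrite leNgt; apply/negP => l1l; apply: Dl; exact: H (ltW l1l).
have S1 : S (Num.max N l).
  split; first by apply: (lt_le_trans bl); rewrite ler_pM2r// le_max lexx orbT.
  by move=> l'; rewrite ge_max => /andP[/HN -> _]; rewrite vol0.
have iS : has_inf S by split; [exists (Num.max N l)|exists l => l1 /lS].
pose l0 := inf S; have ll0 : l <= l0 by apply: lb_le_inf => //; exists (Num.max N l).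
have bl0 l' : l0 <= l' -> b < l' * vol Om.
  move=> l0l; apply: (lt_le_trans bl); rewrite ler_pM2r//; exact: le_trans ll0 l0l.
have D1 l' : l0 < l' -> vol (capD Om e l') = 0.
  move=> /(inf_lt (ex_intro _ _ S1))[l1 [_ H] l1l]; exact: H (ltW l1l).
have D0 l' : l0 <= l' -> vol (capD Om e l') = 0.
  by rewrite le_eqVlt => /predU1P[<-|/D1//]; exact: (capD_closed bOm e1).
have G0 l' : l0 <= l' -> 0 < vol (capG Om e l').
  by move=> l0l; apply: capG_gt0; [exact: D0|exact: bl0].
have [A [ell HA]] := SW D0 G0.
have [eta eta0 H] := capD_extend D0 G0 HA.
(* A level below l0, beyond the barycenter and within reach of [capD_extend]: it belongs to [S],
   although l0 is the infimum of [S]. *)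
have [l2 [l2l0 l2b l2eta]] : exists l2, [/\ l2 < l0, b < l2 * vol Om & l0 - eta < l2].
  have bv : b / vol Om < l0 by rewrite ltr_pdivrMr//; exact: bl0.
  exists ((l0 + Num.max (b / vol Om) (l0 - eta)) / 2).
  set m := Num.max _ _; have m1 : b / vol Om <= m by rewrite le_max lexx.
  have m2 : l0 - eta <= m by rewrite le_max lexx orbT.
  have m3 : m < l0 by rewrite gt_max bv/= ltrBlDr ltrDl.
  by split; [lra|rewrite -ltr_pdivrMr//; lra|lra].
have : l0 <= l2.
  apply: inf_lbound; first by case: iS.
  split => // l' l2l; have [l'l0|/D1//] := leP l' l0.
  by apply: H => //; lra.
by rewrite leNgt l2l0.
Qed.

Lemma pot_decr_bary x t : 0 < t -> \int[mu]_(y in Om) dotp y e < (dotp x e + t / 2) * vol Om ->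
  v (x + t *: e) < v x.
Proof.
move=> t0 bx; have Dl := capD_null bx.
by apply: (pot_decr hM bOm e1) => //; exact: capG_gt0.
Qed.

End critical_position.

(** * Sweeping sets *)

Section sweeps.
Context {R : realType} {d : nat}.
Local Notation E := 'rV[R]_d.
Local Notation mu := (lebd d).
Implicit Types (A B : set E) (x y z p : E).
Variables (Om : set E) (e : E).
Hypothesis bOm : bborel Om.
Hypothesis e1 : dotp e e = 1.

Let mOm : measurable Om. Proof. by case: bOm. Qed.

Lemma continuous_hrefl l : continuous (hrefl e l).
Proof.
move=> x B /nbhs_ballP[eps /= eps0 epsB].
have d0 : 0 < d%:R + 1 :> R by rewrite ltr_wpDl.
apply/nbhs_ballP; exists (eps / (d%:R + 1)); first by rewrite /= divr_gt0.
move=> y; rewrite ball_rVE/= ltr_pdivlMr// => xy; apply: epsB; rewrite ball_rVE/=.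
rewrite (le_lt_trans (norm_hreflB e1 _ _ _))// mulrC; apply: le_lt_trans xy.
by rewrite ler_wpM2l// lerDl.
Qed.

(** T consists of the left points of Om whose image is exterior. Other points of the gain have an
    image that is interior but outside Om, a null set, or an image in [mbd Om], at level c on the
    right of the hyperplane and thus in a null set by [level_null]. Hence the open set T is
    nonempty, and a ball inside it can be translated. *)
Lemma sweeps_open (h : E -> R) (M c : R) l0 : radial_kernel M h ->
  (forall x, mbd Om x -> pot h Om x = c) -> open Om ->
  (forall l, l0 <= l -> vol (capD Om e l) = 0) ->
  (forall l, l0 <= l -> 0 < vol (capG Om e l)) -> exists A ell, sweeps Om e l0 A ell.
Proof.
move=> hM vc oOm D0 G0; have mOc := measurableC mOm.
pose T := Om `&` lside e l0 `&` mirror e l0 (inn (~` Om)).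
have mi := measurable_inn mOc.
have oT : open T.
  apply: openI; first by apply: openI => //; exact: open_lside.
  by apply: open_comp; [move=> x _; exact: continuous_hrefl|exact: inn_open].
have bG := bborel_capG e bOm l0; have [mG _] := bG.
have bT : bborel T.
  apply: bborelI; last exact: measurable_mirror.
  by apply: bborelI => //; exact: measurable_lside.
have mN1 : measurable (inn Om `\` Om) by apply: measurableD => //; exact: measurable_inn.
have mN2 : measurable (inn (~` Om) `\` ~` Om) by apply: measurableD.
have N1 : vol (capG Om e l0 `&` mirror e l0 (inn Om `\` Om)) = 0.
  apply: vol_null_setI => //; first exact: measurable_mirror.
  by rewrite lebd_hrefl// innD_null.
pose S := mirror e l0 (capG Om e l0) `&` [set x | pot h Om x = c].
have bS : bborel S.
  by apply: bborelI; [exact: bborel_mirror|exact: (measurable_pot_level hM)].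
have S0 : vol S = 0.
  apply: (level_null (c := c) hM bOm e1 D0 G0 bS) => x [[[_ xl] _] vx]; split => //.
  move: xl; rewrite /lside/= dotp_hrefl//.
  by rewrite ltrBlDr -ltrBlDl (_ : 2 * l0 - l0 = l0); [exact: ltW|ring].
have T0 : 0 < vol T.
  apply: (lt_le_trans (G0 l0 (lexx l0))).
  rewrite -(addr0 (vol T)) -N1 -(addr0 (vol T + _)) -S0 -(vol_mirror l0 e1 (bborel_measurable bS)).
  have bI : bborel (capG Om e l0 `&` mirror e l0 (inn Om `\` Om)).
    by apply: bborelI => //; exact: measurable_mirror.
  apply: (@le_trans _ _ (vol (T `|` (capG Om e l0 `&` mirror e l0 (inn Om `\` Om))) + vol (mirror e l0 S))).
    apply: vol_le_add => //; [exact: bborelU|exact: bborel_mirror|].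
    move=> y Gy; have [[Oy yl] nRy] := Gy.
    have [oR|noR] := pselect (inn (~` Om) (hrefl e l0 y)); first by left; left.
    have [iR|niR] := pselect (inn Om (hrefl e l0 y)); first by left; right.
    right; split; first by rewrite /mirror/= hreflK.
    by apply: vc; split.
  rewrite lerD2r; apply: vol_le_add => //.
  by apply: measurableU; [case: bT|case: bI].
have [y0 Ty0] : T !=set0.
  by apply/set0P; apply/eqP => T00; move: T0; rewrite T00 vol0 ltxx.
have /nbhs_ballP[r /= r0 rT] : nbhs y0 T by apply: open_nbhs_nbhs; split.
have y0l : dotp y0 e < l0 by have [[_]] := Ty0.
have k0 : 0 < (l0 - dotp y0 e) / 4 by rewrite divr_gt0// subr_gt0.
have [del del0 Hd] := continuous_rV_norm y0 (@continuous_dotp R d e) k0.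
have en := normr_ge0 e.
have e0 : 0 < 2 * (`|e| + 1) by rewrite mulr_gt0// ltr_wpDl.
pose ell := Num.min (r / (2 * (`|e| + 1))) ((l0 - dotp y0 e) / 4).
have ell0 : 0 < ell by rewrite lt_min k0 divr_gt0.
have ell1 : ell * (2 * (`|e| + 1)) <= r by rewrite -ler_pdivlMr// ge_min lexx.
have ell2 : ell <= (l0 - dotp y0 e) / 4 by rewrite ge_min lexx orbT.
have q0 : 0 < Num.min (r / 2) del by rewrite lt_min divr_gt0.
have AT s : 0 <= s -> s <= ell -> trs (s *: e) (ball y0 (Num.min (r / 2) del)) `<=` T.
  move=> s0 s1 y; rewrite /trs/= ball_rVE/= lt_min => /andP[yr _].
  apply: rT; rewrite ball_rVE/= -(subrK (y - s *: e) y0) -addrA (le_lt_trans (ler_normD _ _))//.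
  rewrite addrAC subrr add0r normrN normrZ ger0_norm//.
  have : s * `|e| <= ell * `|e| by rewrite ler_wpM2r.
  by move: ell1; rewrite !mulrDr mulr1; lra.
exists (ball y0 (Num.min (r / 2) del)), ell; split => //.
- exact: bborel_ball.
- exact: vol_ball_gt0.
- move=> y; rewrite ball_rVE/= lt_min distrC => /andP[_ /Hd]; rewrite ltr_distl => /andP[_]; lra.
move=> s s0 s1; have bt := bborel_trs (s *: e) (bborel_ball y0 (Num.min (r / 2) del)).
split.
  rewrite (_ : _ `\` _ = set0) ?vol0//; apply/seteqP; split => // y [/(AT s s0 s1)[[Oy _] _]].
  by move=> /(_ Oy).
apply: (le_vol0 (B := trs (s *: e) (ball y0 (Num.min (r / 2) del)) `&` mirror e l0 (inn (~` Om) `\` ~` Om))).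
- by apply: bborelI => //; exact: measurable_mirror.
- by apply: measurableI; [case: bt|exact: measurable_mirror].
- move=> y [ty my]; split => //; have [_ iy] := AT s s0 s1 y ty.
  by split => //; apply; exact: my.
- apply: vol_null_setI => //; first exact: measurable_mirror.
  by rewrite lebd_hrefl// innD_null.
Qed.

Section lipschitz.
Variable C : R.
Hypothesis OmC : forall t, 0 <= t -> vol (Om `\` trs (t *: e) Om) <= C * t.

(* A step t e takes a point of H = Om `\` mirror e l0 Om out of H on a set of measure at most 2 C t, so
   for ell small the points of capG whose translates by all dyadic multiples of ell e below ell stay in
   H have positive measure; continuity of translations extends this to all real steps. *)
Lemma sweeps_lipschitz l0 : 0 < vol (capG Om e l0) -> exists A ell, sweeps Om e l0 A ell.
Proof.
move=> G0; pose G := capG Om e l0; have bG : bborel G := bborel_capG e bOm l0.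
have [mG _] := bG.
have C0 : 0 <= C by have := OmC ler01; rewrite mulr1; exact: le_trans (vol_ge0 _).
have mk k : measurable [set y : E | dotp y e < k].
  by apply: measurable_sublevel; exact: measurable_dotp.
have [k Gk] : exists n : nat, vol (G `\` [set y | dotp y e < l0 - n.+1%:R^-1]) < vol G.
  apply: vol_decr_lt => //.
  - exact: bborelD.
  - by move=> n; apply: measurableD.
  - move=> m n mn; apply/subsetPset => y [Gy /= h]; split => // h'; apply: h => /=.
    by apply: (lt_le_trans h'); rewrite lerD2l lerN2 lef_pV2 ?posrE// ler_nat.
  - apply/seteqP; split => // y yF; have [Gy _] := yF 0%N I; have [[_ yl] _] := Gy.
    have yy : 0 < l0 - dotp y e by rewrite subr_gt0.
    have [n _ /(_ _ (leqnn n)) nx] := near_infty_natSinv_lt (PosNum yy).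
    have nx' : n.+1%:R^-1 < l0 - dotp y e := nx.
    have [_] := yF n I; by apply; rewrite /= ltrBrDr addrC -ltrBrDr.
set kappa := k.+1%:R^-1 in Gk; have kappa0 : 0 < kappa by rewrite invr_gt0.
pose A0 := G `&` [set y | dotp y e < l0 - kappa].
have bA0 : bborel A0 by exact: bborelI.
have [mA0 _] := bA0.
pose a := vol A0; have a0 : 0 < a by have := volDI bG (mk (l0 - kappa)); rewrite -/A0 /a; lra.
pose H := Om `\` mirror e l0 Om.
have mm := measurable_mirror e l0 mOm.
have bm : bborel (mirror e l0 Om) by exact: bborel_mirror.
have bH : bborel H by exact: bborelD.
have [mH _] := bH.
have C4 : 0 < 4 * C + 4 by lra.
(* The first term keeps the translates left of the hyperplane; the second makes the total loss 2 C
   ell at most half of [a]. *)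
pose ell := Num.min (kappa / 2) (a / (4 * C + 4)).
have ell0 : 0 < ell by rewrite lt_min !divr_gt0.
have ell1 : ell <= kappa / 2 by rewrite ge_min lexx.
have ell2 : ell * (4 * C + 4) <= a by rewrite -ler_pdivlMr// ge_min lexx orbT.
(* A point leaves H either by leaving Om or by entering its mirror image. Each event has volume at
   most C t, the second because the reflection reverses the direction of the step. *)
have Hstep t : 0 <= t -> vol (H `\` trs (- (t *: e)) H) <= 2 * C * t.
  move=> t0; apply: (@le_trans _ _ (vol (Om `\` trs (- (t *: e)) Om) +
      vol (trs (- (t *: e)) (mirror e l0 Om) `\` mirror e l0 Om))).
    apply: vol_le_add.
    - by apply: bborelD => //; exact: measurable_trs.
    - by apply: bborelD => //; exact: bborel_trs.
    - by apply: measurableD => //; exact: measurable_trs.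
    - move=> y [[Oy nmy] nH]; have [Oty|nOty] := pselect (trs (- (t *: e)) Om y); last by left.
      by right; split => //; apply: contrapT => nm; apply: nH; split.
  rewrite vol_shiftN// vol_shiftC// vol_shiftN//.
  have -> : mirror e l0 Om `\` trs (t *: e) (mirror e l0 Om) = mirror e l0 (Om `\` trs (- (t *: e)) Om).
    apply/seteqP; split => y; rewrite /mirror/trs/= opprK -scaleNr hrefl_shift// scaleNr opprK//.
  rewrite vol_mirror//; last by apply: measurableD => //; exact: measurable_trs.
  by rewrite vol_shiftN//; have := OmC t0; lra.
pose good k (y : E) := forall j, (j <= 2 ^ k)%N -> H (y + (j%:R * (ell / 2 ^+ k)) *: e).
pose Ak k := A0 `&` [set y | good k y].
have t_gt0 n : 0 < ell / 2 ^+ n by rewrite divr_gt0// exprn_gt0.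
pose upto n t : set E := [set y | forall j, (j <= n)%N -> H (y + (j%:R * t) *: e)].
have mupto n t : measurable (upto n t).
  rewrite (_ : upto n t = \bigcap_(j in `I_n.+1) trs (- ((j%:R * t) *: e)) H).
    by apply: bigcap_measurable; [exists 0%N => /=|move=> j _; exact: measurable_trs].
  by apply/seteqP; split => y yH j jn; have := yH j jn; rewrite /trs/= opprK.
(* The loss grows linearly with the number of steps, so for 2^n steps of length ell / 2^n it does
   not depend on n. *)
have lost n t : 0 <= t -> vol (A0 `\` upto n t) <= n%:R * (2 * C * t).
  move=> t0; elim: n => [|n IH].
    rewrite mul0r (_ : _ `\` _ = set0) ?vol0//; apply/seteqP; split => // y [[Gy _]].
    apply => j; rewrite leqn0 => /eqP ->; rewrite mul0r scale0r addr0.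
    by have [[? _] ?] := Gy; split.
  rewrite -[n.+1%:R]natr1 mulrDl mul1r.
  have bS : bborel (trs (- ((n%:R * t) *: e)) (H `\` trs (- (t *: e)) H)).
    by apply: bborel_trs; apply: bborelD => //; exact: measurable_trs.
  apply: (@le_trans _ _ (vol (A0 `\` upto n t) + vol (trs (- ((n%:R * t) *: e)) (H `\` trs (- (t *: e)) H)))).
    apply: vol_le_add => //; [exact: bborelD|exact: measurableD|].
    move=> y [Ay nu]; have [un|nun] := pselect (upto n t y); last by left.
    right; rewrite /trs/= !opprK; split; first exact: un.
    move=> Hy; apply: nu => j; rewrite leq_eqVlt => /predU1P[->|]; last exact: un.
    by rewrite -natr1 mulrDl mul1r scalerDl addrA.
  apply: lerD => //; rewrite vol_trs; first exact: Hstep.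
  by apply: measurableD => //; exact: measurable_trs.
have mAk n : measurable (Ak n) by apply: measurableI => //; exact: mupto.
have bAk n : bborel (Ak n) by apply: bborelI => //; exact: mupto.
have Ak_ge n : a / 2 <= vol (Ak n).
  have mu_ := mupto (2 ^ n)%N (ell / 2 ^+ n).
  have := volDI bA0 mu_; have := lost (2 ^ n)%N _ (ltW (t_gt0 n)).
  rewrite -[A0 `&` upto _ _]/(Ak n) -/a.
  rewrite (_ : (2 ^ n)%:R * (2 * C * (ell / 2 ^+ n)) = 2 * C * ell); last first.
    by rewrite natrX; field; rewrite expf_neq0.
  lra.
have Ak_dec : nonincreasing_seq Ak.
  apply/nonincreasing_seqP => n; apply/subsetPset => y [Ay gy]; split => // j jn.
  have -> : j%:R * (ell / 2 ^+ n) = (2 * j)%:R * (ell / 2 ^+ n.+1).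
    by rewrite natrM exprS; field; rewrite expf_neq0.
  by apply: gy; rewrite expnS leq_pmul2l.
pose A := \bigcap_n Ak n.
have mA : measurable A by apply: bigcapT_measurable.
have AA0 : A `<=` A0 by move=> y /(_ 0%N I)[].
have bA : bborel A by exact: (sub_bborel bA0).
have A_gt0 : 0 < vol A.
  have a4 : 0 < a / 4 by rewrite divr_gt0.
  have [n Fn] : exists n, vol (Ak n `\` A) < a / 4.
    apply: vol_decr_lt => //.
    - exact: bborelD.
    - by move=> n; apply: measurableD.
    - by move=> m n mn; apply/subsetPset => y [Ay nA]; split => //; exact: (subsetPset _ _ (Ak_dec _ _ mn)).
    - apply/seteqP; split => // y yF; have [_] := yF 0%N I; apply => n _.
      by have [] := yF n I.
  have := volDI (bAk n) mA; have := Ak_ge n.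
  have -> : Ak n `&` A = A by apply/seteqP; split => [y []//|y Ay]; split => //; exact: Ay.
  lra.
have dyad n j : (j <= 2 ^ n)%N -> trs ((j%:R * (ell / 2 ^+ n)) *: e) A `<=` H.
  by move=> jn y /(_ n I)[_ /(_ j jn)]; rewrite subrK.
exists A, ell; split => //.
  by move=> y /AA0[_ /=]; lra.
move=> s s0 s1.
(* The shift s is approximated from below by a dyadic one, whose translate lies in H; continuity of
   translations makes the error arbitrarily small. *)
have sH : vol (trs (s *: e) A `\` H) = 0.
  have bs := bborel_trs (s *: e) bA; have [ms _] := bs.
  apply/eqP; rewrite eq_le vol_ge0 andbT; apply/ler_addgt0Pl => eps eps0; rewrite addr0.
  have [del del0 Hdel] := vol_shift_lt bs eps0.
  have en : 0 < `|e| + 1 by rewrite ltr_wpDl.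
  have [n Hn] : exists n : nat, ell / 2 ^+ n < del / (`|e| + 1).
    pose x := ell / (del / (`|e| + 1)); exists (Num.truncn x).
    have dd : 0 < del / (`|e| + 1) by rewrite divr_gt0.
    rewrite ltr_pdivrMr ?exprn_gt0// mulrC -ltr_pdivrMr//.
    apply: (lt_le_trans (truncnS_gt _)); rewrite -natrX ler_nat; exact: ltn_expl.
  pose j := Num.truncn (s / (ell / 2 ^+ n)).
  have /andP[j1 j2] : j%:R <= s / (ell / 2 ^+ n) < j.+1%:R.
    by apply: truncn_itv; rewrite divr_ge0// ltW.
  move: j1 j2; rewrite ler_pdivlMr// ltr_pdivrMr// -[j.+1%:R]natr1 mulrDl mul1r => j1 j2.
  have jn : (j <= 2 ^ n)%N.
    rewrite -(ler_nat R) natrX -(ler_pM2r (t_gt0 n)) (le_trans j1)// (le_trans s1)//.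
    by rewrite mulrC divfK// expf_neq0.
  have zd : `|(j%:R * (ell / 2 ^+ n) - s) *: e| < del.
    rewrite normrZ distrC ger0_norm; last by rewrite subr_ge0.
    apply: (@le_lt_trans _ _ (ell / 2 ^+ n * (`|e| + 1))).
      by rewrite ler_pM// ?subr_ge0//; [lra|rewrite lerDl].
    by rewrite -ltr_pdivlMr.
  have := Hdel _ zd; rewrite trs_comp -scalerDl addrC subrK => /ltW; apply: le_trans.
  apply: le_vol; [by apply: bborelD => //; exact: measurable_trs|exact: measurableD|].
  by move=> y [sy nH]; split => // /(dyad n j jn).
have bs := bborel_trs (s *: e) bA; have [ms _] := bs.
split.
  apply: (le_vol0 (bborelD bs mH) _ _ sH); first exact: measurableD.
  by move=> y [sy nO]; split => // -[].
apply: (le_vol0 (bborelD bs mH) _ _ sH); first exact: measurableI.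
by move=> y [sy my]; split => // -[].
Qed.

End lipschitz.
End sweeps.

(** * Finite perimeter *)

Section convolution.
Context {R : realType} {d : nat}.
Local Notation E := 'rV[R]_d.
Local Notation mu := (lebd d).
Implicit Types (A B P : set E) (x y z w : E).

(** Convolution of k with the indicator function of P. *)
Definition convk (k : E -> R) P x := \int[mu]_(y in P) k (x - y).

Section kernel.
Variables (k : E -> R) (K : R).
Hypothesis mk : measurable_fun setT k.
Hypothesis kK : forall x, `|k x| <= K.

Lemma measurable_convk_kernel x : measurable_fun setT (fun y => k (x - y)).
Proof. by apply: (measurableT_comp mk); exact: measurable_rV_subl. Qed.

Lemma convk_trs P x z : bborel P -> convk k (trs z P) x = convk k P (x - z).
Proof.
move=> bP; rewrite /convk.
rewrite -[RHS](@Rint_push R d (fun y => y - z) P (fun y => k (x - z - y)) K)//.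
- by apply: eq_Rintegral => y _; congr k; rewrite opprB addrA subrK.
- exact: measurable_rV_shift.
- by move=> B mB; exact: lebd_trs.
- exact: measurable_convk_kernel.
Qed.

Lemma convk_setDI A B x : bborel A -> measurable B ->
  convk k A x = convk k (A `\` B) x + convk k (A `&` B) x.
Proof.
move=> bA mB; apply: (@Rint_setDI R d A B _ K) => //; exact: measurable_convk_kernel.
Qed.

Lemma convk_abs_le A x : bborel A -> `|convk k A x| <= K * vol A.
Proof. by move=> bA; apply: Rint_abs_le => //; exact: measurable_convk_kernel. Qed.

Lemma convk_continuous P : bborel P -> continuous (convk k P).
Proof.
move=> bP; have [mP _] := bP; apply: continuous_rV_epsilon => x eps eps0.
have K0 : 0 <= K by exact: le_trans (normr_ge0 _) (kK 0).
have K1 : 0 < 2 * K + 1 by rewrite ltr_wpDl// mulr_ge0.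
have e0 : 0 < eps / (2 * K + 1) by rewrite divr_gt0.
have [del del0 H] := vol_shift_lt bP e0; exists del => // y xy.
have bz := bborel_trs (x - y) bP; have [mz _] := bz.
rewrite -[y in convk k P y](subKr x) -convk_trs// (convk_setDI x bz mP) (convk_setDI x bP mz) setIC.
rewrite opprD addrACA subrr addr0 (le_lt_trans (ler_normB _ _))//.
have h1 := convk_abs_le x (bborelD bz mP); have h2 := convk_abs_le x (bborelD bP mz).
rewrite vol_shiftC// in h1.
have := H (x - y); rewrite distrC => /(_ xy); rewrite ltr_pdivlMr// => h3.
apply: (le_lt_trans (lerD h1 h2)); apply: le_lt_trans h3.
have := vol_ge0 (P `\` trs (x - y) P); move: (vol _) => u u0; nra.
Qed.

Lemma measurable_convk P : bborel P -> measurable_fun setT (convk k P).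
Proof. by move=> bP; apply: continuous_measurable_rV; exact: convk_continuous. Qed.

End kernel.
End convolution.

(** * A bump function with quadratic Taylor remainder *)

Section bumpr.
Context {R : realType} {d : nat}.
Local Notation E := 'rV[R]_d.
Local Notation mu := (lebd d).
Implicit Types (A B P : set E) (x y z w e : E).
Variable r : R.
Hypothesis r0 : 0 < r.

Let m z := Num.max (r ^+ 2 - dotp z z) 0.

(** The square of the positive part of r^2 - |z|^2: squaring makes it continuously differentiable,
    with gradient [dbumpr] and a quadratic Taylor remainder. *)
Definition bumpr z : R := m z ^+ 2.
Definition dbumpr z : E := (- 4 * m z) *: z.

Let m_ge0 z : 0 <= m z. Proof. by rewrite le_max lexx orbT. Qed.
Let m_le z : m z <= r ^+ 2.
Proof. by rewrite ge_max sqr_ge0 andbT gerBl dotp_ge0. Qed.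

Lemma bumpr_ge0 z : 0 <= bumpr z. Proof. exact: sqr_ge0. Qed.

Lemma bumpr_le z : `|bumpr z| <= r ^+ 4.
Proof.
rewrite ger0_norm ?bumpr_ge0// /bumpr (_ : r ^+ 4 = (r ^+ 2) ^+ 2); last by rewrite -exprM.
by rewrite ler_pXn2r// nnegrE// sqr_ge0.
Qed.

Lemma bumprN z : bumpr (- z) = bumpr z.
Proof. by rewrite /bumpr /m dotpNl dotpNr opprK. Qed.

Lemma bumpr_eq0 z : r <= `|z| -> bumpr z = 0.
Proof.
move=> rz; rewrite /bumpr /m max_r ?expr0n// subr_le0.
rewrite -sqr_enorm ler_pXn2r ?nnegrE ?enorm_ge0 ?(ltW r0)//.
exact: le_trans rz (norm_le_enorm z).
Qed.

Let measurable_m : measurable_fun setT m.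
Proof.
apply: measurable_maxr; last exact: measurable_cst.
apply: measurable_funB; first exact: measurable_cst.
by apply: measurable_sum => i; apply: measurable_funM; exact: measurable_coord.
Qed.

Lemma measurable_bumpr : measurable_fun setT bumpr.
Proof. exact: measurable_funX. Qed.

Lemma measurable_dbumpr i : measurable_fun setT (fun z => dbumpr z ord0 i).
Proof.
rewrite (_ : (fun z => _) = fun z => - 4 * m z * z ord0 i); last first.
  by apply/funext => z; rewrite mxE.
apply: measurable_funM; last exact: measurable_coord.
by apply: measurable_funM => //; exact: measurable_cst.
Qed.

Lemma dbumpr_le z i : `|dbumpr z ord0 i| <= 4 * r ^+ 2 * r.
Proof.
rewrite /dbumpr mxE normrM normrM normrN (ger0_norm (m_ge0 z)) normr_nat.
have [zr|zr] := leP r `|z|.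
  have -> : m z = 0.
    have := bumpr_eq0 zr; rewrite /bumpr => /eqP; rewrite sqrf_eq0 => /eqP //.
  by rewrite mulr0 mul0r !mulr_ge0// ?sqr_ge0// ltW.
apply: ler_pM; rewrite ?mulr_ge0// ?ler_pM2l ?m_le//.
by rewrite (le_trans (coord_le_norm z i))// ltW.
Qed.

(** The function max(u, 0)^2 is convex and its second derivative is at most 2; the middle term is
    its first-order Taylor remainder for the increment -D. *)
Lemma bumpr_taylor_aux (u D : R) :
  0 <= Num.max (u - D) 0 ^+ 2 - Num.max u 0 ^+ 2 + 2 * Num.max u 0 * D <= D ^+ 2.
Proof.
by have [h1|h1] := leP 0 (u - D); have [h2|h2] := leP 0 u;
  apply/andP; split; nra.
Qed.

(** With D = 2 z.w + w.w, the first term bounds D^2 and the second the part 2 m w.w of the linear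
    term that is itself quadratic in w. *)
Definition bumpr_const (b : R) : R := (2 * b * d%:R + d%:R) ^+ 2 + 2 * r ^+ 2 * d%:R.

Lemma bumpr_taylor (B : R) z w : `|z| <= B -> `|w| <= 1 ->
  `|bumpr (z + w) - bumpr z - dotp w (dbumpr z)| <= bumpr_const B * `|w| ^+ 2.
Proof.
move=> zB w1; pose D := 2 * dotp z w + dotp w w; pose u := r ^+ 2 - dotp z z.
have uE : r ^+ 2 - dotp (z + w) (z + w) = u - D.
  by rewrite /u /D !(dotpDl, dotpDr) (dotpC w z); ring.
have /andP[a1 a2] := bumpr_taylor_aux u D.
have mz : Num.max u 0 = m z by [].
have mzw : Num.max (u - D) 0 = m (z + w) by rewrite -uE.
rewrite mz mzw in a1 a2.
have -> : bumpr (z + w) - bumpr z - dotp w (dbumpr z) =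
    (m (z + w) ^+ 2 - m z ^+ 2 + 2 * m z * D) - 2 * m z * dotp w w.
  by rewrite /bumpr /dbumpr dotpZr (dotpC w z) /D; ring.
have w0 := normr_ge0 w; have z0 := normr_ge0 z; have d0 : 0 <= d%:R :> R by [].
have ww : dotp w w <= d%:R * `|w| ^+ 2.
  by apply: (le_trans (ler_norm _)); rewrite (le_trans (dotp_le_norm _ _))// expr2 mulrCA mulrA.
have DD : `|D| <= (2 * B * d%:R + d%:R) * `|w|.
  rewrite /D (le_trans (ler_normD _ _))// [leRHS]mulrDl lerD//.
    rewrite normrM ger0_norm// -!mulrA ler_pM2l// (le_trans (dotp_le_norm _ _))//.
    by rewrite ler_wpM2r// mulr_ge0.
  rewrite (le_trans (dotp_le_norm _ _))//.
  by rewrite ler_piMl// mulr_ge0.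
have D2 : D ^+ 2 <= (2 * B * d%:R + d%:R) ^+ 2 * `|w| ^+ 2.
  by rewrite -exprMn -[D ^+ 2]real_normK ?num_real// ler_pXn2r ?nnegrE//; exact: le_trans DD.
have mw : 2 * m z * dotp w w <= 2 * r ^+ 2 * d%:R * `|w| ^+ 2.
  rewrite -[leRHS]mulrA ler_pM//; [by rewrite mulr_ge0|exact: dotp_ge0|by rewrite ler_pM2l].
have mw0 : 0 <= 2 * m z * dotp w w by rewrite !mulr_ge0// dotp_ge0.
rewrite /bumpr_const [leRHS]mulrDl ler_norml; apply/andP; split; last lra.
have := mulr_ge0 (sqr_ge0 (2 * B * d%:R + d%:R)) (sqr_ge0 `|w|); lra.
Qed.

End bumpr.

Section bumpr_taylor_uniform.
Context {R : realType} {d : nat}.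
Local Notation E := 'rV[R]_d.
Local Notation mu := (lebd d).
Implicit Types (A B P : set E) (x y z w e : E).
Variable r : R.
Hypothesis r0 : 0 < r.

Lemma bumpr_eq0_enorm z : r <= enorm z -> bumpr r z = 0.
Proof.
move=> rz; rewrite /bumpr max_r ?expr0n// subr_le0.
by rewrite -sqr_enorm ler_pXn2r ?nnegrE ?enorm_ge0 ?(ltW r0).
Qed.

Lemma dbumpr_eq0 z : r <= `|z| -> dbumpr r z = 0.
Proof.
move=> rz; have := bumpr_eq0 r0 rz; rewrite /bumpr /dbumpr => /eqP.
by rewrite sqrf_eq0 => /eqP ->; rewrite mulr0 scale0r.
Qed.

Lemma bumpr_gt0 z : enorm z < r -> 0 < bumpr r z.
Proof.
move=> zr; rewrite exprn_gt0// lt_max subr_gt0 -sqr_enorm.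
by rewrite ltr_pXn2r ?nnegrE ?enorm_ge0 ?(ltW r0)// zr.
Qed.

Lemma bumpr_taylor_uniform z w : `|w| <= 1 ->
  `|bumpr r (z + w) - bumpr r z - dotp w (dbumpr r z)| <= bumpr_const (d := d) r (r + 1) * `|w| ^+ 2.
Proof.
move=> w1; have [zr|zr] := leP `|z| (r + 1); first exact: bumpr_taylor.
have rz : r <= `|z| by rewrite (le_trans _ (ltW zr))// lerDl.
rewrite dbumpr_eq0// !bumpr_eq0//; last first.
  have := ler_normB (z + w) w; rewrite addrK; lra.
rewrite dotpC dotp0l !subrr normr0 mulr_ge0 ?sqr_ge0// addr_ge0 ?sqr_ge0//.
by rewrite mulr_ge0// mulr_ge0// sqr_ge0.
Qed.

End bumpr_taylor_uniform.

Section convk_swap.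
Context {R : realType} {d : nat}.
Local Notation E := 'rV[R]_d.
Local Notation mu := (lebd d).
Implicit Types (A B P : set E) (x y z w e : E).
Variables (k : E -> R) (K : R) (B0 : set E).
Hypothesis mk : measurable_fun setT k.
Hypothesis kK : forall x, `|k x| <= K.
Hypothesis k0 : forall x, 0 <= k x.
Hypothesis kN : forall x, k (- x) = k x.
Hypothesis bB : bborel B0.
Hypothesis kB : forall x, ~ B0 x -> k x = 0.

Lemma convk_window P x : bborel P ->
  convk k P x = \int[mu]_(z in B0 `&` trs (- x) P) k z.
Proof.
move=> bP; have [mB _] := bB; have bx := bborel_trs x bB; have [mx _] := bx.
have mkx := measurable_convk_kernel mk x.
rewrite /convk (@Rint_setDI R d P (trs x B0) _ K)//.
rewrite (_ : Rintegral _ _ _ = 0); last first.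
  rewrite (@eq_Rintegral _ _ _ mu _ (fun=> 0)) ?Rint_cst ?mul0r//; first exact: bborelD.
  move=> y; rewrite inE => -[_ nB]; rewrite -kN opprB kB//.
have -> : P `&` trs x B0 = (fun y => y - x) @^-1` (B0 `&` trs (- x) P).
  by apply/seteqP; split => y; rewrite /trs/= opprK subrK => -[].
rewrite add0r -(@Rint_push R d (fun y => y - x) _ k K)//.
- by apply: eq_Rintegral => y _; rewrite -kN opprB.
- exact: measurable_rV_shift.
- by move=> B mBB; exact: lebd_trs.
- by apply: bborelI => //; apply: measurable_trs; case: bP.
Qed.

Lemma convk_ge0 P x : bborel P -> 0 <= convk k P x.
Proof. by move=> bP; apply: Rintegral_ge0. Qed.

(** Tonelli: the integral over A of the mollified indicator of P is the average, weighted by k, of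
    the volumes of the overlaps of A with translates of P. *)
Lemma convk_swap A P : bborel A -> bborel P ->
  \int[mu]_(x in A) convk k P x =
  \int[mu]_(z in B0) (k z * vol (A `&` trs (- z) P)).
Proof.
move=> bA bP; have [mA _] := bA; have [mP _] := bP; have [mB _] := bB.
pose Q : set (E * E) := [set p | [/\ A p.1, B0 p.2 & P (p.1 + p.2)]].
have mQ : measurable Q.
  have -> : Q = fst @^-1` A `&` snd @^-1` B0 `&` ((fun p : E * E => p.1 + p.2) @^-1` P).
    by apply/seteqP; split => p; [move=> [a b c]|move=> [[a b] c]].
  apply: measurableI; [apply: measurableI|]; rewrite -[X in measurable X]setTI.
  - exact: measurable_fst.
  - exact: measurable_snd.
  - exact: measurable_rVD.
pose f (p : E * E) : \bar R := (k p.2 * \1_Q p)%:E.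
have mf : measurable_fun setT f.
  apply/measurable_EFinP; apply: measurable_funM; last exact: measurable_indic.
  by apply: measurableT_comp mk _; exact: measurable_snd.
have f0 p : (0 <= f p)%E by rewrite lee_fin mulr_ge0// indicE.
have := fubini_tonelli (m1 := mu) (m2 := mu) f mf f0.
have inner1 x : (\int[mu]_z f (x, z))%E = ((EFin \o convk k P) \_ A) x.
  rewrite patchE /f; case: ifPn => xA.
    rewrite /= convk_window// (EFin_Rintegral (M := K))//; last first.
      by apply: bborelI => //; exact: measurable_trs.
    rewrite [RHS]integral_mkcond; apply: eq_integral => z _ /=.
    rewrite patchE indicE; rewrite inE in xA.
    have -> : ((x, z) \in Q) = (z \in B0 `&` trs (- x) P).
      by apply/idP/idP; rewrite !inE /Q/trs/= opprK addrC; [move=> []|move=> []].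
    by case: ifPn; rewrite ?mulr1 ?mulr0.
  under eq_integral => z _.
    rewrite (_ : _%:E = 0%E); last first.
      rewrite indicE memNset ?mulr0// => -[/= Ax _ _].
      by move: xA; rewrite notin_setE.
    over.
  by rewrite integral0.
have inner2 z : (\int[mu]_x f (x, z))%E = ((fun z => (k z * vol (A `&` trs (- z) P))%:E) \_ B0) z.
  rewrite patchE /f; case: ifPn => zB.
    have bS : bborel (A `&` trs (- z) P) by apply: bborelI => //; exact: measurable_trs.
    rewrite -(Rint_cst _ bS) (EFin_Rintegral (M := K))// [RHS]integral_mkcond.
    apply: eq_integral => x _ /=; rewrite patchE indicE; rewrite inE in zB.
    have -> : ((x, z) \in Q) = (x \in A `&` trs (- z) P).
      by apply/idP/idP; rewrite !inE /Q/trs/= opprK; [move=> []|move=> []].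
    by case: ifPn; rewrite ?mulr1 ?mulr0.
  under eq_integral => x _.
    rewrite (_ : _%:E = 0%E); last first.
      rewrite indicE memNset ?mulr0// => -[/= _ Bz _].
      by move: zB; rewrite notin_setE.
    over.
  by rewrite integral0.
under eq_integral do rewrite inner1.
under [X in _ = X -> _]eq_integral do rewrite inner2.
by rewrite -!integral_mkcond /Rintegral => ->.
Qed.

End convk_swap.

Section jacobian_of_taylor.
Context {R : realType} {d : nat}.
Local Notation E := 'rV[R]_d.
Implicit Types (x w : E).

Lemma norm_mulmx_le w (A : 'M[R]_d) : `|w *m A| <= d%:R * `|A| * `|w|.
Proof.
rewrite -[leLHS]/(mx_norm _) mx_normrE; apply: bigmax_le; first by rewrite !mulr_ge0.
move=> [i j] _ /=; rewrite mxE (le_trans (ler_norm_sum _ _ _))//.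
apply: (@le_trans _ _ (\sum_(k < d) `|A| * `|w|)); last first.
  by rewrite sumr_const card_ord -[leLHS]mulr_natl mulrA.
apply: ler_sum => k _; rewrite normrM mulrC ler_pM//.
  by rewrite -[leRHS]/(mx_norm _) mx_normrE; exact: (le_bigmax _ _ (k, j)).
by rewrite ord1 coord_le_norm.
Qed.

Lemma continuous_mulmxr (A : 'M[R]_d) : continuous (mulmxr A : E -> E).
Proof.
move=> x B /nbhs_ballP[eps /= eps0 epsB].
have K0 : 0 <= d%:R * `|A| by rewrite mulr_ge0.
have d0 : 0 < d%:R * `|A| + 1 by rewrite ltr_wpDl.
apply/nbhs_ballP; exists (eps / (d%:R * `|A| + 1)); first by rewrite /= divr_gt0.
move=> y; rewrite ball_rVE/= ltr_pdivlMr// => xy; apply: epsB; rewrite ball_rVE/=.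
rewrite -mulmxBl (le_lt_trans (norm_mulmx_le _ _))// mulrC; apply: le_lt_trans xy.
by rewrite ler_wpM2l// lerDl.
Qed.

(** The quadratic bound makes the remainder negligible, and the differential is then determined by
    uniqueness; the matrix acts on row vectors from the right. *)
Lemma jacobian_of_taylor (T : E -> E) (A : 'M[R]_d) C x :
  (forall w, `|w| <= 1 -> `|T (x + w) - T x - w *m A| <= C * `|w| ^+ 2) ->
  differentiable T x /\ jacobian T x = A.
Proof.
move=> TA.
have H : T \o shift x = cst (T x) + mulmxr A +o_ (0 : E) id.
  apply/eqaddoP => eps eps0; apply/nbhs_ballP.
  have C1 : 0 < `|C| + 1 by rewrite ltr_wpDl.
  exists (Num.min 1 (eps / (`|C| + 1))); first by rewrite /= lt_min ltr01 divr_gt0.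
  move=> w; rewrite ball_rVE/= sub0r normrN lt_min => /andP[w1 we].
  rewrite !fctE /= [w + x]addrC opprD addrA (le_trans (TA _ (ltW w1)))// expr2 mulrA.
  rewrite ler_wpM2r//; rewrite ltr_pdivlMr// in we; apply: le_trans (ltW we).
  by rewrite mulrC ler_wpM2l// (le_trans (ler_norm C))// lerDl.
have Hd := diff_unique (@continuous_mulmxr A) H.
split; first by apply/diff_locallyP; rewrite Hd; split=> //; exact: continuous_mulmxr.
apply/matrixP => i j; rewrite /jacobian mxE Hd /=.
by rewrite -rowE mxE.
Qed.

End jacobian_of_taylor.

(** * Mollified indicators as test fields *)

Section mollified_field.
Context {R : realType} {d : nat}.
Local Notation E := 'rV[R]_d.
Local Notation mu := (lebd d).
Implicit Types (x y z w : E).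
Variables (r : R) (P : set E).
Hypotheses (r0 : 0 < r) (bP : bborel P).

Definition moll x : R := convk (bumpr r) P x.
Definition dmoll x : E := \row_i convk (fun z => dbumpr r z ord0 i) P x.

(** The Taylor bound of the bump is uniform in its argument, so it can be integrated over P; this
    takes the place of differentiation under the integral sign. *)
Lemma moll_taylor x w : `|w| <= 1 ->
  `|moll (x + w) - moll x - dotp w (dmoll x)| <=
     bumpr_const (d := d) r (r + 1) * `|w| ^+ 2 * vol P.
Proof.
move=> w1; have mP := bborel_measurable bP.
have mb z := measurable_convk_kernel (measurable_bumpr r) z.
have bl z : `|bumpr r z| <= r ^+ 4 := bumpr_le r z.
have md i := measurable_convk_kernel (measurable_dbumpr r i) x.
have mwd i : measurable_fun setT (fun y => w ord0 i * dbumpr r (x - y) ord0 i).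
  by apply: measurable_funM; [exact: measurable_cst|exact: md].
have wdl i y : P y -> `|w ord0 i * dbumpr r (x - y) ord0 i| <= `|w| * (4 * r ^+ 2 * r).
  by move=> _; rewrite normrM ler_pM// ?coord_le_norm// dbumpr_le.
have -> : dotp w (dmoll x) = \int[mu]_(y in P) (\sum_i w ord0 i * dbumpr r (x - y) ord0 i).
  rewrite (Rint_sum _ bP mwd wdl) /dotp; apply: eq_bigr => i _.
  rewrite mxE /convk RintegralZl//.
  by apply: (bborel_integrable (M := 4 * r ^+ 2 * r)) => // y _; exact: dbumpr_le.
have ms : measurable_fun setT (fun y => \sum_i w ord0 i * dbumpr r (x - y) ord0 i).
  by apply: measurable_sum.
have sl y : P y -> `|\sum_i w ord0 i * dbumpr r (x - y) ord0 i| <= \sum_(i < d) `|w| * (4 * r ^+ 2 * r).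
  by move=> Py; apply: (le_trans (ler_norm_sum _ _ _)); apply: ler_sum => i _; exact: wdl.
have int1 z : mu.-integrable P (EFin \o (fun y => bumpr r (z - y))).
  exact: (bborel_integrable (M := r ^+ 4)).
have int2 := bborel_integrable bP ms sl.
rewrite /moll /convk -RintegralB// -RintegralB//; last first.
  by apply: (bborel_integrable (M := r ^+ 4 + r ^+ 4)) => //;
    [exact: measurable_funB|move=> y _; rewrite (le_trans (ler_normB _ _))// lerD].
apply: Rint_abs_le => //.
  by apply: measurable_funB => //; exact: measurable_funB.
by move=> y _; rewrite (addrAC x w); exact: bumpr_taylor_uniform.
Qed.

Lemma moll_eq0 (M : R) x : (forall y, P y -> `|y| < M) -> M + r <= `|x| -> moll x = 0.
Proof.
move=> PM xM; rewrite /moll /convk (@eq_Rintegral _ _ _ mu P (fun=> 0)) ?Rint_cst ?mul0r//.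
move=> y; rewrite inE => /PM yM; apply: bumpr_eq0 => //.
have := ler_normD (x - y) y; rewrite subrK; lra.
Qed.

Variables (a : R) (e : E).

(** The direction is constant, so the divergence is a multiple of the derivative of the mollified
    indicator along e. *)
Definition moll_field x : E := (a * moll x) *: e.

Lemma jacobian_moll_field x : differentiable moll_field x /\
  jacobian moll_field x = \matrix_(i, j) (a * dmoll x ord0 i * e ord0 j).
Proof.
apply: (jacobian_of_taylor (C := `|a| * (bumpr_const (d := d) r (r + 1) * vol P) * `|e|)) => w w1.
have -> : moll_field (x + w) - moll_field x -
    w *m \matrix_(i, j) (a * dmoll x ord0 i * e ord0 j) =
    (a * (moll (x + w) - moll x - dotp w (dmoll x))) *: e.
  apply/rowP => j; rewrite !mxE !mulrBr !mulrBl; congr (_ - _).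
  rewrite /dotp mulr_sumr mulr_suml; apply: eq_bigr => i _.
  by rewrite !mxE; ring.
rewrite normrZ normrM -[leRHS]mulrA [_ * `|w| ^+ 2]mulrC mulrA ler_wpM2r//.
by rewrite -mulrA ler_wpM2l// mulrAC moll_taylor.
Qed.

Lemma divergence_moll_field x : divergence moll_field x = a * dotp (dmoll x) e.
Proof.
rewrite /divergence (jacobian_moll_field x).2 /mxtrace /dotp mulr_sumr.
by apply: eq_bigr => i _; rewrite !mxE mulrA.
Qed.

Lemma continuous_dmoll i : continuous (fun x => dmoll x ord0 i).
Proof.
rewrite (_ : (fun x => _) = convk (fun z => dbumpr r z ord0 i) P); last first.
  by apply/funext => x; rewrite mxE.
apply: (convk_continuous (K := 4 * r ^+ 2 * r)) => //.
- exact: measurable_dbumpr.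
- by move=> z; exact: dbumpr_le.
Qed.

Lemma C1c_moll_field : C1c moll_field.
Proof.
split.
- by move=> x; exact: (jacobian_moll_field x).1.
- move=> x B /nbhs_ballP[eps /= eps0 epsB].
  have H : \forall y \near x, forall p : 'I_d * 'I_d,
      ball (jacobian moll_field x p.1 p.2) eps (jacobian moll_field y p.1 p.2).
    apply: (@filter_forall _ _ (fun p y => ball (jacobian moll_field x p.1 p.2) eps
      (jacobian moll_field y p.1 p.2)) (nbhs x)) => -[i j] /=.
    have c : {for x, continuous (fun y => jacobian moll_field y i j)}.
      rewrite (_ : (fun y => _) = fun y => a * dmoll y ord0 i * e ord0 j); last first.
        by apply/funext => y; rewrite (jacobian_moll_field y).2 mxE.
      apply: continuousM; last exact: cst_continuous.
      by apply: continuousM; [exact: cst_continuous|exact: continuous_dmoll].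
    exact: c _ (nbhsx_ballx _ _ eps0).
  apply: filterS H => y H; apply: epsB; split=> // i j; exact: (H (i, j)).
- have [_ [M PM]] := bP.
  have cl : closed [set x : E | `|x| <= M + r].
    apply: (@closed_comp _ _ (fun x : E => `|x|) [set s | s <= M + r]).
      by move=> x _; exact: norm_continuous.
    exact: closed_le.
  have sub : closure [set x | moll_field x != 0] `<=` [set x : E | `|x| <= M + r].
    rewrite [X in _ `<=` X](closure_id _).1//; apply: closure_subset => x /=.
    apply: contra_neqT; rewrite -ltNge => /ltW /(moll_eq0 PM) x0.
    by rewrite /moll_field x0 mulr0 scale0r.
  apply: bounded_closed_compact; last exact: closed_closure.
  exists (M + r); split; first exact: num_real.
  by move=> N MN x /sub /= xM; exact: le_trans (ltW MN).
Qed.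

End mollified_field.

Lemma quadratic_gap (R : realFieldType) (D t K k g N : R) : 0 < N -> 0 < g -> k * t ^+ 2 / g < N ->
  D <= N * (t / N * K + k * (t / N) ^+ 2) -> D < g + t * K.
Proof.
move=> N0 g0; rewrite ltr_pdivrMr// => h.
have -> : N * (t / N * K + k * (t / N) ^+ 2) = t * K + k * t ^+ 2 / N.
  by field; rewrite lt0r_neq0.
move=> /le_lt_trans; apply; rewrite [ltRHS]addrC ltrD2l ltr_pdivrMr//.
by rewrite [ltRHS]mulrC.
Qed.

(** * The perimeter bounds the change of volume under translation *)

Section perimeter_lipschitz.
Context {R : realType} {d : nat}.
Local Notation E := 'rV[R]_d.
Local Notation mu := (lebd d).
Implicit Types (A B P : set E) (x y z w e : E).

Lemma bborel_eball x r : bborel (eball x r).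
Proof.
by apply: (sub_bborel (bborel_ball x r)); [exact: measurable_eball|exact: eball_sub_ball].
Qed.

Section mollifier.
Variable r : R.
Hypothesis r0 : 0 < r.
Let B0 : set E := eball 0 r.

(** The bump is not normalized: its total mass is the value taken by the mollification well inside
    P. *)
Definition moll_mass : R := \int[mu]_(z in B0) bumpr r z.

Let kB x : ~ B0 x -> bumpr r x = 0.
Proof. by rewrite /B0/eball/= subr0 => /negP; rewrite -leNgt; exact: bumpr_eq0_enorm. Qed.

Let mb := @measurable_bumpr R d r.
Let bl x : `|bumpr r x| <= r ^+ 4 := bumpr_le r x.
Let b0 x : 0 <= bumpr r x := bumpr_ge0 r x.
Let bB : bborel B0 := bborel_eball 0 r.

Lemma moll_mass_gt0 : 0 < moll_mass.
Proof.
rewrite -[ltLHS](mul0r (vol B0)) -Rint_cst//; apply: (Rint_lt (M := r ^+ 4)) => //.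
- by move=> x _; rewrite normr0 exprn_ge0// ltW.
- by move=> x; rewrite /B0/eball/= subr0; exact: bumpr_gt0.
- by rewrite -lte_fin -volE// lebd_eball_gt0.
Qed.

Lemma moll_le_mass P x : bborel P -> 0 <= moll r P x <= moll_mass.
Proof.
move=> bP; rewrite /moll (convk_ge0 b0 x bP)//=.
have mx := measurable_trs (- x) (bborel_measurable bP).
rewrite (convk_window mb bl (bumprN r) bB kB)// /moll_mass.
by rewrite (Rint_setDI bB mx mb (fun x _ => bl x)) lerDr; exact: Rintegral_ge0.
Qed.

Lemma measurable_vol_trsN A P : measurable A -> measurable P ->
  measurable_fun setT (fun z => vol (A `&` trs (- z) P)).
Proof.
move=> mA mP; pose S : set (E * E) := [set p | A p.2 /\ P (p.1 + p.2)].
have mS : measurable S.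
  apply: measurableI; rewrite -[X in measurable X]setTI.
    exact: measurable_snd.
  exact: measurable_rVD.
have := measurable_section mS => /(measurableT_comp (fine_measurable measurableT)).
apply: eq_measurable_fun => z _ /=; rewrite /vol; congr (fine (mu _)).
by apply/seteqP; split => y; rewrite /trs/S/= opprK addrC.
Qed.

Variables (Om : set E) (e : E) (Mp : R).
Hypotheses (bOm : bborel Om) (e1 : dotp e e = 1).
Hypothesis perim : forall T : E -> E, C1c T -> (forall x, enorm (T x) <= 1) ->
  \int[mu]_(x in Om) divergence T x <= Mp.

Let ee : enorm e = 1. Proof. by rewrite enormE e1 sqrtr1. Qed.

Let I0 := moll_mass_gt0.

Let measurable_dm P : bborel P -> measurable_fun setT (fun x => dotp (dmoll r P x) e).
Proof.
move=> bP; apply: measurable_sum => i; apply: measurable_funM; last exact: measurable_cst.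
by apply: continuous_measurable_rV; exact: continuous_dmoll.
Qed.

Let dm_le P x : bborel P ->
  `|dotp (dmoll r P x) e| <= \sum_(i < d) 4 * r ^+ 2 * r * vol P * `|e|.
Proof.
move=> bP; apply: (le_trans (ler_norm_sum _ _ _)); apply: ler_sum => i _.
rewrite normrM ler_pM ?coord_le_norm// mxE.
apply: convk_abs_le => //; first exact: measurable_dbumpr.
by move=> z; exact: dbumpr_le.
Qed.

(** Divided by the mass, the mollification takes values between 0 and 1, so its product with the
    unit vector e is admissible in the definition of the perimeter. *)
Lemma flux_le P : bborel P -> \int[mu]_(x in Om) dotp (dmoll r P x) e <= Mp * moll_mass.
Proof.
move=> bP; pose T := moll_field r P moll_mass^-1 e.
have := perim (C1c_moll_field r0 bP moll_mass^-1 e) => H.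
rewrite -ler_pdivrMr// mulrC -RintegralZl//; last 2 first.
- exact: bborel_measurable.
- by apply: (bborel_integrable bOm (measurable_dm bP)) => x _; exact: dm_le.
under eq_Rintegral do rewrite -divergence_moll_field//.
apply: H => x; rewrite /moll_field enormZ ee mulr1.
have /andP[m0 m1] := moll_le_mass x bP.
by rewrite ger0_norm ?mulr_ge0 ?invr_ge0 ?(ltW I0)// mulrC ler_pdivrMr// mul1r.
Qed.

Let measurable_m P : bborel P -> measurable_fun setT (moll r P).
Proof.
by move=> bP; apply: (measurable_convk mb bl).
Qed.

Let m_le P x : bborel P -> `|moll r P x| <= moll_mass.
Proof. by move=> /(moll_le_mass x)/andP[a b]; rewrite ger0_norm. Qed.

Let measurable_ms P w : bborel P -> measurable_fun setT (fun x => moll r P (x + w)).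
Proof.
by move=> bP; apply: (measurableT_comp (measurable_m bP)); exact: measurable_rV_shift.
Qed.

Let kap P := bumpr_const (d := d) r (r + 1) * vol P * vol Om.

Let moll_step P (u : R) : bborel P -> 0 <= u <= 1 ->
  \int[mu]_(x in Om) moll r P (x + u *: e) - \int[mu]_(x in Om) moll r P x <=
    u * (Mp * moll_mass) + kap P * u ^+ 2.
Proof.
move=> bP /andP[u0 u1]; have mOm := bborel_measurable bOm.
have ue : `|u *: e| <= u.
  by rewrite normrZ ger0_norm// ler_piMr// -ee norm_le_enorm.
pose c := bumpr_const (d := d) r (r + 1) * u ^+ 2 * vol P.
have c0 : 0 <= bumpr_const (d := d) r (r + 1) * vol P.
  have h := moll_taylor r0 bP 0 (w := const_mx 0); rewrite mulr_ge0 ?vol_ge0//.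
  by rewrite addr_ge0 ?sqr_ge0// mulr_ge0// mulr_ge0// sqr_ge0.
have T x : moll r P (x + u *: e) - moll r P x <= u * dotp (dmoll r P x) e + c.
  have := moll_taylor r0 bP x (le_trans ue u1).
  rewrite dotpZl dotpC => /(le_trans (ler_norm _)); rewrite lerBlDl => /le_trans; apply.
  rewrite lerD2l /c mulrAC [leRHS]mulrAC ler_wpM2l//.
  by rewrite ler_pXn2r ?nnegrE.
rewrite -RintegralB//; last 2 first.
- by apply: (bborel_integrable bOm (measurable_ms _ bP)) => x _; exact: m_le.
- by apply: (bborel_integrable bOm (measurable_m bP)) => x _; exact: m_le.
have md := measurable_dm bP.
have mud : measurable_fun setT (fun x => u * dotp (dmoll r P x) e).
  by apply: measurable_funM => //; exact: measurable_cst.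
have mudc : measurable_fun setT (fun x => u * dotp (dmoll r P x) e + c).
  by apply: measurable_funD => //; exact: measurable_cst.
have [K K1 K2] : exists2 K, (forall x, `|moll r P (x + u *: e) - moll r P x| <= K) &
    (forall x, `|u * dotp (dmoll r P x) e| <= K /\ `|u * dotp (dmoll r P x) e + c| <= K).
  pose D := \sum_(i < d) 4 * r ^+ 2 * r * vol P * `|e|.
  have D0 : 0 <= D by exact: le_trans (dm_le 0 bP).
  have I0' := ltW I0; have uD := mulr_ge0 u0 D0.
  exists (moll_mass + moll_mass + u * D + `|c|) => x.
    rewrite (le_trans (ler_normB _ _))// -!addrA lerD ?m_le// (le_trans (m_le x bP))//.
    by rewrite lerDl addr_ge0.
  have h : `|u * dotp (dmoll r P x) e| <= u * D.
    by rewrite normrM ger0_norm// ler_wpM2l// dm_le.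
  split; first by rewrite (le_trans h)// addrAC addrC -addrA lerDl !addr_ge0.
  rewrite (le_trans (ler_normD _ _))// lerD// (le_trans h)// lerDr addr_ge0//.
apply: (@le_trans _ _ (\int[mu]_(x in Om) (u * dotp (dmoll r P x) e + c))).
  apply: (Rint_le (M := K)) => // [|x _]; last by have [] := K2 x.
  by apply: measurable_funB; [exact: measurable_ms|exact: measurable_m].
rewrite RintegralD//; last 2 first.
- by apply: (bborel_integrable (M := K) bOm mud) => x _; have [] := K2 x.
- by apply: (bborel_integrable (M := `|c|) bOm).
rewrite Rint_cst// lerD//; last by rewrite /kap /c; lra.
rewrite RintegralZl//; last by apply: (bborel_integrable bOm md) => x _; exact: dm_le.
by rewrite ler_wpM2l// flux_le.
Qed.

(* The quadratic Taylor errors of n steps of length t / n add up to O(t^2 / n). *)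
Let moll_total P (t : R) : bborel P -> 0 <= t ->
  \int[mu]_(x in Om) moll r P (x + t *: e) - \int[mu]_(x in Om) moll r P x <=
    t * (Mp * moll_mass).
Proof.
move=> bP t0; pose F s := \int[mu]_(x in Om) moll r P (x + s *: e).
have F0 : F 0 = \int[mu]_(x in Om) moll r P x.
  by apply: eq_Rintegral => x _; rewrite scale0r addr0.
(* The shift by s is absorbed into P, replaced by its translate; as [kap] depends on P only through
   its volume, the error constant is the same at every step. *)
have step s u : 0 <= u <= 1 -> F (s + u) - F s <= u * (Mp * moll_mass) + kap P * u ^+ 2.
  move=> u01; have bs := bborel_trs (- (s *: e)) bP.
  have := moll_step bs u01; rewrite /kap vol_trs; last exact: bborel_measurable.
  have -> : F (s + u) = \int[mu]_(x in Om) moll r (trs (- (s *: e)) P) (x + u *: e).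
    apply: eq_Rintegral => x _.
    by rewrite [RHS]/moll (convk_trs mb bl _ _ bP) opprK scalerDl addrA addrAC.
  have -> // : F s = \int[mu]_(x in Om) moll r (trs (- (s *: e)) P) x.
  by apply: eq_Rintegral => x _; rewrite [RHS]/moll (convk_trs mb bl _ _ bP) opprK.
have steps n u : 0 <= u <= 1 ->
    F (n%:R * u) - F 0 <= n%:R * (u * (Mp * moll_mass) + kap P * u ^+ 2).
  move=> u01; elim: n => [|n IH]; first by rewrite !mul0r subrr.
  have h := step (n%:R * u) u u01; have := lerD h IH.
  rewrite addrA subrK -[n.+1%:R]natr1 (mulrDl n%:R 1 u) mul1r.
  by rewrite (mulrDl n%:R 1 (_ + _)) mul1r [_ + n%:R * _]addrC.
rewrite -F0 -/(F t) leNgt; apply/negP => gap.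
pose g := F t - F 0 - t * (Mp * moll_mass).
have g0 : 0 < g by rewrite subr_gt0.
have [n n1 n2] : exists2 n : nat, t < n.+1%:R & kap P * t ^+ 2 / g < n.+1%:R.
  move: (kap P * t ^+ 2 / g) => q; exists (Num.truncn (t + `|q|)).
    by apply: le_lt_trans (truncnS_gt _); rewrite lerDl.
  apply: le_lt_trans (truncnS_gt _).
  exact: le_trans (ler_norm q) (ler_wpDl t0 (lexx _)).
have N0 : 0 < n.+1%:R :> R by [].
have u01 : 0 <= t / n.+1%:R <= 1.
  apply/andP; split; first exact: divr_ge0 t0 (ltW N0).
  by rewrite (ler_pdivrMr _ _ N0) mul1r; exact: ltW.
have := steps n.+1 _ u01.
have -> : n.+1%:R * (t / n.+1%:R) = t by rewrite mulrC divfK// lt0r_neq0.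
by move=> /(quadratic_gap N0 g0 n2); rewrite /g subrK ltxx.
Qed.

(* The perimeter is tested against the field e moll_P / mass, P being the part of the translate of Om
   outside Om. *)
Lemma moll_perimeter (t del eps : R) : 0 <= t -> r <= del ->
  (forall z, `|z| < del -> vol ((trs (t *: e) Om `\` Om) `\` trs z (trs (t *: e) Om `\` Om)) <= eps) ->
  vol (Om `\` trs (t *: e) Om) <= Mp * t + 2 * eps.
Proof.
move=> t0 rdel; set Q := trs (t *: e) Om; set P := Q `\` Om => Hdel.
have mOm := bborel_measurable bOm.
have bQ : bborel Q by exact: bborel_trs.
have mQ := bborel_measurable bQ.
have bP : bborel P by exact: bborelD.
have bN : bborel (Om `\` Q) by exact: bborelD.
have mP := bborel_measurable bP; have mN := bborel_measurable bN.
have := moll_total bP t0.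
rewrite [X in X - _](_ : _ = \int[mu]_(x in Q) moll r P x); last first.
  rewrite -(@Rint_push R d (fun x => x + t *: e) Q _ moll_mass)//.
  - by congr Rintegral; apply/seteqP; split => x; rewrite /Q/trs/= addrK.
  - exact: measurable_rV_shift.
  - by move=> B mB; exact: lebd_shift.
  - exact: measurable_m.
  - by move=> x _; exact: m_le.
(* The integrals over the common part of Om and its translate Q cancel; only Q minus Om, which is P,
   and Om minus Q remain. *)
rewrite (Rint_setDI bQ mOm (measurable_m bP) (fun x _ => m_le x bP)).
rewrite (Rint_setDI bOm mQ (measurable_m bP) (fun x _ => m_le x bP)) setIC.
rewrite opprD addrACA subrr addr0 -/P.
have mS A : measurable A -> measurable_fun setT (fun z => bumpr r z * vol (A `&` trs (- z) P)).
  by move=> mA; apply: measurable_funM => //; exact: measurable_vol_trsN.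
have Sle A z : bborel A -> `|bumpr r z * vol (A `&` trs (- z) P)| <= r ^+ 4 * vol A.
  move=> bA; rewrite normrM ler_pM// ger0_norm ?vol_ge0// le_vol//.
  by apply: measurableI; [exact: bborel_measurable|exact: measurable_trs].
have Hz z : B0 z -> vol (P `\` trs (- z) P) <= eps.
  rewrite /B0/eball/= subr0 => zr; apply: Hdel; rewrite normrN.
  exact: le_lt_trans (norm_le_enorm z) (lt_le_trans zr rdel).
have mc (k : R) : measurable_fun setT (fun z : E => bumpr r z * k).
  by apply: measurable_funM => //; exact: measurable_cst.
have cle (k : R) z : `|bumpr r z * k| <= r ^+ 4 * `|k| by rewrite normrM ler_pM.
have ibump : mu.-integrable B0 (EFin \o bumpr r) by exact: (bborel_integrable bB mb).
have mB0 := bborel_measurable bB.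
(* For small z the set P overlaps its translate up to eps, so the mollification is nearly full on P;
   on Om minus Q, disjoint from P, it is nearly zero for the same reason. *)
have h1 : moll_mass * (vol P - eps) <= \int[mu]_(x in P) moll r P x.
  rewrite (convk_swap mb bl b0 (bumprN r) bB kB)// -RintegralZr//.
  apply: (Rint_le (M := r ^+ 4 * `|vol P - eps| + r ^+ 4 * vol P)) => //.
  - exact: mS.
  - by move=> z _; rewrite (le_trans (cle _ _))// lerDl mulr_ge0 ?vol_ge0// exprn_ge0// ltW.
  - by move=> z _; rewrite (le_trans (Sle _ _ bP))// lerDr mulr_ge0// exprn_ge0// ltW.
  - move=> z /Hz zP; rewrite ler_wpM2l// {1}(volDI bP (measurable_trs (- z) mP)); lra.
have h2 : \int[mu]_(x in Om `\` Q) moll r P x <= moll_mass * eps.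
  rewrite (convk_swap mb bl b0 (bumprN r) bB kB)// -RintegralZr//.
  apply: (Rint_le (M := r ^+ 4 * `|eps| + r ^+ 4 * vol (Om `\` Q))) => //.
  - exact: mS.
  - by move=> z _; rewrite (le_trans (Sle _ _ bN))// lerDr mulr_ge0// exprn_ge0// ltW.
  - by move=> z _; rewrite (le_trans (cle _ _))// lerDl mulr_ge0 ?vol_ge0// exprn_ge0// ltW.
  - move=> z /Hz zP; rewrite ler_wpM2l// (le_trans _ zP)// -vol_shiftC//.
    apply: le_vol.
    + by apply: bborelD => //; exact: bborel_trs.
    + by apply: measurableI => //; exact: measurable_trs.
    + by move=> x [[Omx nQx] Px]; split=> // -[].
move=> h3; rewrite -(vol_shiftC _ bOm) -/Q -/P.
have := I0; move: moll_mass h1 h2 h3 => I; nra.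
Qed.

End mollifier.

Lemma perimeter_lipschitz Om e (Mp : R) : bborel Om -> dotp e e = 1 ->
  (forall T : E -> E, C1c T -> (forall x, enorm (T x) <= 1) ->
    \int[mu]_(x in Om) divergence T x <= Mp) ->
  forall t, 0 <= t -> vol (Om `\` trs (t *: e) Om) <= Mp * t.
Proof.
move=> bOm e1 H t t0; apply/ler_addgt0Pr => eps eps0.
have bQ := bborel_trs (t *: e) bOm; have mOm := bborel_measurable bOm.
have eps2 : 0 < eps / 2 by rewrite divr_gt0.
have [del del0 D] := vol_shift_lt (bborelD bQ mOm) eps2.
have := moll_perimeter del0 bOm e1 H t0 (lexx del) (fun z zd => ltW (D z zd)).
by rewrite mulrCA divff// mulr1.
Qed.

End perimeter_lipschitz.

(** * Borel hulls *)

Section borel_hull.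
Context {R : realType} {d : nat}.
Local Notation E := 'rV[R]_d.
Local Notation mu := (lebd d).
Local Notation leb := (rV_lebesgue R d).
Implicit Types (A F Om : set E) (x y : E).

Lemma leb_le A F : A `<=` F -> (leb A <= leb F)%E.
Proof. exact: (le_outer_measure ((rV_borel_measure d)^*)%mu). Qed.

Lemma lebU_le A F : (leb (A `|` F) <= leb A + leb F)%E.
Proof. exact: (outer_measureU2 ((rV_borel_measure d)^*)%mu). Qed.

Lemma leb_ge0 A : (0 <= leb A)%E.
Proof. exact: (outer_measure_ge0 ((rV_borel_measure d)^*)%mu). Qed.

Lemma borel_lebesgue_measurable A : measurable A -> rV_lebesgue_measurable A.
Proof. exact: caratheodory_measurable_mu_ext. Qed.

(** Potentials, translations and product measures are handled on Borel sets. A Lebesgue measurable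
    Om is replaced by a Borel set containing it with null excess, which has the same integrals of
    Borel functions and the same densities. *)
Definition borel_hull Om A :=
  [/\ bborel A, Om `<=` A, rV_lebesgue_measurable Om & leb (A `\` Om) = 0%E].

(** The outer measure provides Borel covers of excess 1/(n+1), whose intersection has the measure of
    Om. Since this measure is finite, the Caratheodory condition for Om, tested on the intersection,
    makes the excess null. *)
Lemma exists_borel_hull Om : bounded_set Om -> rV_lebesgue_measurable Om ->
  exists A, borel_hull Om A.
Proof.
move=> [M0 [_ OmM0]] cOm; pose M := `|M0| + 1.
have OmM x : Om x -> `|x| <= M.
  by apply: OmM0; rewrite (le_lt_trans (ler_norm _))// /M ltrDl.
have bM : bborel (ball (0 : E) (M + 1)) := bborel_ball 0 (M + 1).
have OmB : Om `<=` ball (0 : E) (M + 1).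
  by move=> x /OmM xM; rewrite ball_rVE/= sub0r normrN (le_lt_trans xM)// ltrDl.
have Omfin : leb Om \is a fin_num.
  rewrite ge0_fin_numE ?leb_ge0//; apply: le_lt_trans (leb_le OmB) _.
  by rewrite lebE ?bborel_lty//; exact: bborel_measurable.
have cover (n : nat) : exists U, [/\ measurable U, Om `<=` U & (mu U <= leb Om + (n.+1%:R^-1)%:E)%E].
  have : (leb Om < leb Om + (n.+1%:R^-1)%:E)%E by rewrite lteDl// lte_fin invr_gt0.
  move=> /ereal_inf_lt[_ [F [mF OmF] <-] /ltW Fle].
  exists (\bigcup_k F k); split => //; first exact: bigcup_measurable.
  apply: le_trans Fle; apply: measure_sigma_subadditive => //.
  exact: bigcup_measurable.
pose U n := projT1 (cid (cover n)).
have UP n : [/\ measurable (U n), Om `<=` U n & (mu (U n) <= leb Om + (n.+1%:R^-1)%:E)%E].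
  exact: (projT2 (cid (cover n))).
pose A := ball (0 : E) (M + 1) `&` \bigcap_n U n.
have mI : measurable (\bigcap_n U n) by apply: bigcap_measurable => // n _; have [] := UP n.
have bA : bborel A by exact: bborelI.
have OmA : Om `<=` A by move=> x Omx; split; [exact: OmB|move=> n _; have [_ + _] := UP n; exact].
have Ale : (leb A <= leb Om)%E.
  rewrite lebE; last exact: bborel_measurable.
  rewrite volE// -(fineK Omfin) lee_fin; apply/ler_addgt0Pr => eps eps0.
  have [n] : exists n : nat, n.+1%:R^-1 < eps.
    exists (Num.truncn eps^-1); rewrite invf_plt ?posrE//; exact: truncnS_gt.
  move=> /ltW neps; apply: (@le_trans _ _ (fine (leb Om) + n.+1%:R^-1)); last by rewrite lerD2l.
  rewrite -lee_fin -volE// EFinD fineK//; have [mU _ h] := UP n.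
  apply: le_trans h; apply: le_measure; rewrite ?inE//; first exact: bborel_measurable.
  by move=> x [_ /(_ n)]; exact.
exists A; split => //.
have AE : leb A = (leb (A `&` Om) + leb (A `&` ~` Om))%E by exact: cOm.
have Afin : leb (A `\` Om) \is a fin_num.
  rewrite ge0_fin_numE ?leb_ge0//; apply: le_lt_trans (leb_le (@subDsetl _ A Om)) _.
  by rewrite lebE ?bborel_lty//; exact: bborel_measurable.
move: Ale; rewrite AE (setIidr OmA) -setDE -(fineK Omfin) -(fineK Afin).
rewrite -EFinD lee_fin gerDl => h; congr EFin; apply/eqP; rewrite eq_le h.
by rewrite fine_ge0 ?leb_ge0.
Qed.

Variables (Om A : set E).
Hypothesis hA : borel_hull Om A.

Let bA : bborel A. Proof. by case: hA. Qed.
Let mA : measurable A. Proof. exact: bborel_measurable. Qed.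
Let OmA : Om `<=` A. Proof. by case: hA. Qed.
Let cOm : rV_lebesgue_measurable Om. Proof. by case: hA. Qed.
Let AOm0 : leb (A `\` Om) = 0%E. Proof. by case: hA. Qed.

Lemma borel_hull_lebI F : measurable F -> leb (Om `&` F) = mu (A `&` F).
Proof.
move=> mF; rewrite -lebE; last exact: measurableI.
apply/eqP; rewrite eq_le leb_le//=; last by move=> x [/OmA].
rewrite -[leRHS]adde0 -AOm0; apply: le_trans (lebU_le _ _); apply: leb_le.
by move=> x [Ax Fx]; have [?|?] := pselect (Om x); [left|right].
Qed.

Lemma borel_hull_lebIC F : measurable F -> leb (~` Om `&` F) = mu (~` A `&` F).
Proof.
move=> mF; rewrite -lebE; last by apply: measurableI => //; exact: measurableC.
apply/eqP; rewrite eq_le andbC leb_le//=; last by move=> x [nA Fx]; split => // /OmA.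
rewrite -[leRHS]adde0 -AOm0; apply: le_trans (lebU_le _ _); apply: leb_le.
by move=> x [Omx Fx]; have [?|?] := pselect (A x); [right|left].
Qed.

Local Notation caraE := (caratheodory_type ((rV_borel_measure (R := R) d)^*)%mu).

(** The identity is measurable from the Lebesgue to the Borel sigma-algebra; pushing forward along
    it transfers integrals from one to the other. *)
Let idm : measurable_fun (setT : set caraE) (fun x : caraE => (x : E)).
Proof. by move=> _ B mB; rewrite setTI; exact: borel_lebesgue_measurable. Qed.

Let integral_hull_ge0 (f : E -> \bar R) : measurable_fun setT f -> (forall x, (0 <= f x)%E) ->
  (\int[leb]_(x in Om) f x = \int[mu]_(x in A) f x)%E.
Proof.
move=> mf f0.
transitivity (\int[leb]_(x in A) f x)%E.
  have mcA := borel_lebesgue_measurable mA.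
  have mN : rV_lebesgue_measurable (A `\` Om).
    exact: (@measurableD _ caraE).
  have mfA : measurable_fun (A : set caraE) (f : caraE -> \bar R).
    apply: (@measurable_funS _ _ caraE _ setT) => //.
    exact: (measurableT_comp mf idm).
  rewrite [RHS](@ge0_negligible_integral _ caraE R leb A (A `\` Om) f)//.
  by rewrite setDD setIidr.
rewrite -[LHS](@ge0_integral_pushforward _ _ caraE E R _ idm leb A f)//; last first.
  exact: measurable_funS mf.
by apply: eq_measure_integral => B mB _; exact: lebE.
Qed.

Lemma integral_borel_hull (f : E -> \bar R) : measurable_fun setT f ->
  (\int[leb]_(x in Om) f x = \int[mu]_(x in A) f x)%E.
Proof.
move=> mf; rewrite integralE [RHS]integralE !integral_hull_ge0//.
- exact: measurable_funeneg.
- exact: measurable_funepos.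
Qed.

End borel_hull.

(** * Balls *)

Section ball_from_potential.
Context {R : realType} {d : nat}.
Local Notation E := 'rV[R]_d.
Local Notation mu := (lebd d).
Implicit Types (A : set E) (x y z e b : E).

(** From a point of this half, moving by t e increases the squared radius by at least t^2. On the
    whole sphere a line can return, hence the restriction to a half. *)
Lemma half_sphere_null e b (rho : R) : dotp e e = 1 ->
  mu.-negligible [set x | enorm (x - b) = rho /\ 0 <= dotp (x - b) e].
Proof.
move=> e1; set H := mkset _.
have mnb : measurable_fun setT (fun x => enorm (x - b)).
  exact: (measurableT_comp (@measurable_enorm R d) (measurable_rV_shift (- b))).
have mdb : measurable_fun setT (fun x => dotp (x - b) e).
  exact: (measurableT_comp (measurable_dotp e) (measurable_rV_shift (- b))).
have HE : H = [set x | enorm (x - b) <= rho] `\` [set x | enorm (x - b) < rho] `\`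
    [set x | dotp (x - b) e < 0].
  apply/seteqP; split => x /=.
    by move=> [-> h]; rewrite lexx ltxx; split => //; apply/negP; rewrite -leNgt.
  move=> [[h1 /negP h2] /negP h3]; rewrite -!leNgt in h2 h3; split => //.
  by apply/eqP; rewrite eq_le h1.
have mH : measurable H.
  rewrite HE; apply: measurableD; [apply: measurableD|].
  - exact: measurable_sublevelW.
  - exact: measurable_sublevel.
  - exact: measurable_sublevel.
have bH : bborel H.
  apply: (sub_bborel (bborel_ball b (rho + 1))) => // x [xr _].
  rewrite ball_rVE/= distrC (le_lt_trans (norm_le_enorm _))// xr ltrDl//.
apply/(negligibleP _ mH); apply: vol_eq0 => //; apply: (translates_null (e := e) bH ltr01) => x t [xr xe] t0 _ [xtr _].
have : dotp (x + t *: e - b) (x + t *: e - b) = dotp (x - b) (x - b).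
  by rewrite -!sqr_enorm xtr xr.
rewrite addrAC !(dotpDl (x - b)) !(dotpDr (x - b)) !dotpZl !dotpZr e1 (dotpC e) mulr1 => h.
have := mulr_ge0 (ltW t0) xe; have := mulr_gt0 t0 t0; lra.
Qed.

Lemma sphere_null b (rho : R) : (0 < d)%N -> mu.-negligible [set x | enorm (x - b) = rho].
Proof.
move=> d0; pose e : E := delta_mx ord0 (Ordinal d0).
have e1 : dotp e e = 1.
  rewrite /dotp (bigD1 (Ordinal d0))//= big1 ?addr0 ?mxE ?eqxx ?mulr1// => i /negPf ni.
  by rewrite mxE ni andbF mul0r.
have ne1 : dotp (- e) (- e) = 1 by rewrite dotpNl dotpNr opprK.
have h1 := half_sphere_null b rho e1; have h2 := half_sphere_null b rho ne1.
apply: negligibleS (negligibleU h1 h2) => x /= xr.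
by have [h|h] := leP 0 (dotp (x - b) e);
  [left|right; rewrite dotpNr oppr_ge0; split => //; exact: ltW].
Qed.

Variables (A : set E) (b : E) (v : E -> R) (c : R).
Hypotheses (d0 : (0 < d)%N) (bA : bborel A) (A0 : 0 < vol A).
Hypothesis vc : forall x, mbd A x -> v x = c.
Hypothesis vlt : forall x x', enorm (x - b) < enorm (x' - b) -> v x' < v x.

Let mA : measurable A. Proof. exact: bborel_measurable. Qed.

Let mbd_radius x y : mbd A x -> mbd A y -> enorm (x - b) = enorm (y - b).
Proof.
move=> /vc xc /vc yc; apply/eqP; rewrite eq_le; apply/andP; split; rewrite leNgt;
  by apply/negP => /vlt; rewrite xc yc ltxx.
Qed.

(** Otherwise A would be covered by S and by its own points in the exterior of A, two null sets. *)
Let meets S : mu.-negligible S -> exists2 y, ~ S y & ~ inn (~` A) y.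
Proof.
move=> S0; apply: contrapT => nex.
have : mu.-negligible A.
  have mN : measurable (inn (~` A) `\` ~` A).
    by apply: measurableD; [apply: measurable_inn; exact: measurableC|exact: measurableC].
  have N0 : mu.-negligible (inn (~` A) `\` ~` A).
    by apply/(negligibleP _ mN); apply: innD_null; exact: measurableC.
  apply: negligibleS (negligibleU S0 N0) => x Ax.
  have [?|nS] := pselect (S x); [by left|right]; split; last by apply.
  by apply: contrapT => ?; apply: nex; exists x.
move=> /(negligibleP _ mA) h; move: A0; rewrite -lte_fin -volE// h ltxx//.
Qed.

Let far : exists M, forall x, M < `|x| -> ~ inn A x.
Proof.
have [_ [M AM]] := bA; exists M => x Mx xA; apply: (inn_disjoint mA xA).
exists (`|x| - M); first by rewrite subr_gt0.
rewrite (_ : _ `\` _ = set0) ?measure0// -subset0 => y [].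
rewrite ball_rVE/= => xy nnAy; have /AM yM : A y by apply: contrapT.
have := ler_normD (x - y) y; rewrite subrK; lra.
Qed.

(** All boundary points lie on one sphere about b. Joining suitable points along a segment would
    otherwise produce a boundary point strictly outside or strictly inside it. *)
Lemma level_ball : exists2 rho, 0 < rho &
  (forall x, enorm (x - b) < rho -> inn A x) /\ (forall x, rho < enorm (x - b) -> inn (~` A) x).
Proof.
have [M MA] := far.
have ray x s : b + s *: (x - b) - b = s *: (x - b) by rewrite addrC addKr.
have far_on_ray x : x != b -> exists k, 1 <= k /\ ~ inn A (b + k *: (x - b)).
  move=> xb; have n0 : 0 < `|x - b| by rewrite normr_gt0 subr_eq0.
  exists (1 + (`|M| + `|b| + 1) / `|x - b|).
  have k0 : 0 <= (`|M| + `|b| + 1) / `|x - b| by rewrite divr_ge0// addr_ge0// addr_ge0.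
  split; first by rewrite lerDl.
  apply: MA; set z := b + _.
  have : `|z - b| = `|x - b| + (`|M| + `|b| + 1).
    by rewrite ray normrZ ger0_norm ?addr_ge0// mulrDl mul1r divfK// gt_eqF.
  have := ler_normB z b; have := ler_norm M; lra.
have [p pA] : exists p, mbd A p.
  have [y _ ny] := meets (negligible_set0 mu).
  pose x : E := b + (`|M| + `|b| + 1) *: const_mx 1.
  have [z nz] : exists z, ~ inn A z.
    have [y0 yb] : exists y0 : E, y0 != b.
      exists (b + delta_mx ord0 (Ordinal d0)).
      rewrite -subr_eq0 addrC addKr; apply/eqP => /rowP/(_ (Ordinal d0)).
      by rewrite !mxE !eqxx => /eqP; rewrite oner_eq0.
    by have [k [_ ?]] := far_on_ray _ yb; eexists; eassumption.
  by have [s [_ _ ?]] := segment_mbd mA nz ny; eexists; eassumption.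
pose rho := enorm (p - b).
have bd x : mbd A x -> enorm (x - b) = rho by move=> xA; exact: mbd_radius.
have out x : rho < enorm (x - b) -> inn (~` A) x.
  move=> xr; apply: contrapT => nx.
  have xb : x != b.
    by apply: contraTneq xr => ->; rewrite subrr enorm0 -leNgt enorm_ge0.
  have [k [k1 nk]] := far_on_ray _ xb.
  have [s [s0 s1 /bd]] := segment_mbd mA nk nx.
  have -> : b + k *: (x - b) + s *: (x - (b + k *: (x - b))) - b = (k + s * (1 - k)) *: (x - b).
    by apply/rowP => i; rewrite !mxE; ring.
  have ks : 1 <= k + s * (1 - k) by nra.
  rewrite enormZ ger0_norm; last by rewrite (le_trans ler01).
  by move=> h; move: xr; rewrite -h; apply/negP; rewrite -leNgt ler_peMl// enorm_ge0.
(* Off the sphere and not exterior, [y0] lies strictly inside; this also shows that the radius is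
   not 0. *)
have [y0 yS ny0] := meets (sphere_null b rho d0).
have y0r : enorm (y0 - b) < rho.
  rewrite lt_neqAle; apply/andP; split; first by apply/eqP.
  by rewrite leNgt; apply/negP => /out.
exists rho; first exact: le_lt_trans (enorm_ge0 _) y0r.
split => // x xr; apply: contrapT => nx.
(* If b is interior, a non-interior x inside the sphere is joined to b; if not, b is joined to [y0].
   Both segments stay strictly inside the sphere. *)
have [bin|nb] := pselect (inn A b).
  have nbo : ~ inn (~` A) b by move=> h; exact: inn_disjoint bin h.
  have [s [s0 s1 /bd]] := segment_mbd mA nx nbo.
  have -> : x + s *: (b - x) - b = (1 - s) *: (x - b).
    by apply/rowP => i; rewrite !mxE; ring.
  rewrite enormZ ger0_norm ?subr_ge0// => h.
  have := enorm_ge0 (x - b); nra.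
have [s [s0 s1 /bd]] := segment_mbd mA nb ny0.
rewrite ray enormZ ger0_norm// => h.
have := enorm_ge0 (y0 - b); nra.
Qed.

Lemma level_ball_ae : exists2 rho, 0 < rho & mu.-negligible ((A `\` eball b rho) `|` (eball b rho `\` A)).
Proof.
have [rho r0 [inA outA]] := level_ball; exists rho => //.
have mC := measurableC mA.
have N1 : mu.-negligible (inn A `\` A).
  by apply/negligibleP; [apply: measurableD => //; exact: measurable_inn|exact: innD_null].
have N2 : mu.-negligible (inn (~` A) `\` ~` A).
  by apply/negligibleP; [apply: measurableD => //; exact: measurable_inn|exact: innD_null].
apply: negligibleS (negligibleU (negligibleU N1 N2) (sphere_null b rho d0)).
move=> x [[Ax /negP]|[xr nAx]]; last by left; left; split => //; exact: inA.
rewrite -leNgt le_eqVlt => /predU1P[?|/outA xo]; first by right.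
by left; right; split.
Qed.

End ball_from_potential.

(** * From the hypotheses on Omega to the ball *)

Section nonlocal_critical.
Context {R : realType} {d : nat}.
Local Notation E := 'rV[R]_d.
Local Notation mu := (lebd d).
Local Notation leb := (rV_lebesgue R d).
Implicit Types (A Om : set E) (x y : E).

Lemma radial_kernel_of_profile (phi : R -> R) (h : E -> R) M :
  (forall x, h x = phi (enorm x)) -> (forall x, 0 < h x) -> (forall x, h x <= M) ->
  (forall s t : R, 0 <= s -> s < t -> phi t < phi s) -> radial_kernel M h.
Proof.
move=> hphi h0 hM hdec; split.
(* The profile decreases only on nonnegative reals; precomposed with max(., 0) it is monotone on the
   whole line and unchanged on norms. *)
- rewrite (_ : h = (fun s => phi (Num.max s 0)) \o enorm); last first.
    by apply/funext => x /=; rewrite max_l ?enorm_ge0.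
  apply: measurableT_comp; last exact: measurable_enorm.
  apply: nonincreasing_measurable => // s t st.
  have : Num.max s 0 <= Num.max t 0 by rewrite ge_max !le_max st lexx orbT.
  rewrite le_eqVlt => /predU1P[->//|]; move=> /hdec/ltW; apply.
  by rewrite le_max lexx orbT.
- by move=> x; rewrite h0 hM.
- by move=> x y xy; rewrite !hphi xy.
- by move=> x y xy; rewrite !hphi; apply: hdec => //; exact: enorm_ge0.
Qed.

Lemma h_critical_mbd (h : E -> R) M Om A : radial_kernel M h -> borel_hull Om A ->
  h_critical h Om -> exists c, forall x, mbd A x -> pot h A x = c.
Proof.
move=> hM hA [c c0 hc]; exists c => x xA; have [bA _ _ _] := hA.
apply/eqP; rewrite -subr_eq0 -normr_le0 leNgt; apply/negP => gap.
have [del del0 close] := continuous_rV_norm x (pot_continuous hM bA) gap.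
have [p px hp] := mbd_half_dense bA xA del0.
have /hc := half_dense_essential bA (borel_hull_lebI hA) (borel_hull_lebIC hA) hp.
rewrite (integral_borel_hull hA); last first.
  apply/measurable_EFinP; apply: measurable_convk_kernel; first by case: hM.
move=> /(congr1 fine) /= pc; have := close p px.
by rewrite /pot [X in `|X - _|]pc distrC ltxx.
Qed.

Lemma measurable_divergence (T : E -> E) : C1c T -> measurable_fun setT (divergence T).
Proof.
move=> [_ Tc _]; apply: measurable_sum => i; apply: continuous_measurable_rV => x.
exact: (continuous_comp (Tc x) (@coord_continuous _ _ _ i i _)).
Qed.

Lemma perimeter_hull Om A : borel_hull Om A -> finite_perimeter Om ->
  exists Mp : R, forall T : E -> E, C1c T -> (forall x, enorm (T x) <= 1) ->
    \int[mu]_(x in A) divergence T x <= Mp.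
Proof.
(* The maximum with 0 accommodates the value 0 that [fine] gives to an infinite integral. *)
move=> hA fp; exists (Num.max 0 (fine (perimeter Om))) => T CT T1.
rewrite /Rintegral -(integral_borel_hull hA); last first.
  by apply/measurable_EFinP; exact: measurable_divergence.
have : (\int[leb]_(x in Om) (divergence T x)%:E <= perimeter Om)%E.
  by apply: ereal_sup_ubound; exists T.
move: fp; rewrite /finite_perimeter.
case: (integral _ _ _) => [s| |] /=; [|by rewrite le_max lexx..].
by case: (perimeter Om) => [p| |]//= _; rewrite lee_fin le_max => ->; rewrite orbT.
Qed.

Definition barycenter A : E := \row_i ((\int[mu]_(y in A) y ord0 i) / vol A).

Lemma dotp_barycenter A e : bborel A -> 0 < vol A ->
  \int[mu]_(y in A) dotp y e = dotp (barycenter A) e * vol A.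
Proof.
move=> bA A0; have [mA [M AM]] := bA.
have M0 y : A y -> `|M| = M by move=> /AM yM; rewrite ger0_norm// (le_trans (normr_ge0 y))// ltW.
rewrite (Rint_sum _ bA (F := fun i y => y ord0 i * e ord0 i) (K := `|M| * `|e|)).
- rewrite /dotp mulr_suml; apply: eq_bigr => i _.
  rewrite RintegralZr//; last first.
    apply: (bborel_integrable (M := `|M|)) => //; first exact: measurable_coord.
    by move=> y Ay; rewrite (le_trans (coord_le_norm _ _))// (M0 _ Ay) ltW// AM.
  by rewrite mxE mulrAC divfK ?gt_eqF.
- move=> i; apply: measurable_funM; first exact: measurable_coord.
  exact: measurable_cst.
- move=> i y Ay; rewrite normrM ler_pM ?coord_le_norm//.
  by rewrite (le_trans (coord_le_norm _ _))// (M0 _ Ay) ltW// AM.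
Qed.

(** With e the direction from x to x', the hyperplane bisecting the two points has on its left
    exactly the points nearer to x, among them the barycenter. *)
Lemma pot_decr_barycenter (h : E -> R) M c A : radial_kernel M h -> bborel A -> 0 < vol A ->
  (forall x, mbd A x -> pot h A x = c) ->
  (forall e, dotp e e = 1 -> forall l0, (forall l, l0 <= l -> vol (capD A e l) = 0) ->
    (forall l, l0 <= l -> 0 < vol (capG A e l)) -> exists B ell, sweeps A e l0 B ell) ->
  forall x x', enorm (x - barycenter A) < enorm (x' - barycenter A) -> pot h A x' < pot h A x.
Proof.
move=> hM bA A0 vc SW x x'; set b := barycenter A => xx'.
have nxx : 0 < enorm (x' - x).
  rewrite lt_neqAle enorm_ge0 andbT eq_sym; apply/negP => /eqP n0.
  have : dotp (x' - x) (x' - x) = 0 by rewrite -sqr_enorm n0 expr0n.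
  by move=> /dotp_eq0/eqP; rewrite subr_eq0 => /eqP E1; rewrite E1 ltxx in xx'.
set t := enorm (x' - x) in nxx.
have [e te e1] : exists2 e, t *: e = x' - x & dotp e e = 1.
  exists (t^-1 *: (x' - x)); first by rewrite scalerA divff ?gt_eqF// scale1r.
  by rewrite dotpZl dotpZr -sqr_enorm -/t mulrA -expr2 -exprMn mulVf ?gt_eqF// expr1n.
have -> : x' = x + t *: e by rewrite te addrC subrK.
apply: (pot_decr_bary hM bA e1 vc A0 (SW e e1) nxx).
rewrite dotp_barycenter// ltr_pM2r// -subr_gt0.
move: xx'; rewrite enorm_lt (_ : x' - b = (x - b) + t *: e); last by rewrite te [RHS]addrC addrA subrK.
rewrite (dotpDl (x - b) (t *: e)) !(dotpDr (x - b) (t *: e)) !dotpZl !dotpZr e1 mulr1 (dotpC e) (dotpBl x b e).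
move=> hh; rewrite -(pmulr_rgt0 _ nxx); lra.
Qed.

End nonlocal_critical.

Theorem mainTheorem2 (R : realType) (d : nat) (d_gt0 : (0 < d)%N)
    (phi : R -> R) (h : 'rV[R]_d -> R)
    (h_radial : forall x, h x = phi (enorm x))
    (h_pos : forall x, 0 < h x)
    (h_bounded : exists M : R, forall x, h x <= M)
    (phi_decr : forall s t : R, 0 <= s -> s < t -> phi t < phi s)
    (Omega : set 'rV[R]_d)
    (Omega_pos : (0 < rV_lebesgue R d Omega)%E)
    (Omega_reg : (bounded_set Omega /\ open Omega) \/
       [/\ bounded_set Omega, rV_lebesgue_measurable Omega
         & finite_perimeter Omega])
    (Omega_crit : h_critical h Omega) :
  equivalent_to_ball Omega.
Proof.
have [M hM] := h_bounded.
have rh := radial_kernel_of_profile h_radial h_pos hM phi_decr.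
(* An open Omega is its own hull, so that openness is kept; in the other case the hull inherits the
   bound on the flux of test fields. *)
have [A hA hreg] : exists2 A, borel_hull Omega A & open A \/ exists Mp : R,
    forall T : 'rV[R]_d -> 'rV[R]_d, C1c T -> (forall x, enorm (T x) <= 1) ->
    \int[lebd d]_(x in A) divergence T x <= Mp.
  case: Omega_reg => [[bO oO]|[bO mO fO]].
    exists Omega; last by left.
    have mO := open_measurable_rV oO; split => //.
    - split => //; have [M0 [_ OM0]] := bO; exists (`|M0| + 2) => x Ox.
      rewrite (le_lt_trans (OM0 (`|M0| + 1) _ x Ox))// ?ltrD2l ?ltr1n//.
      by rewrite (le_lt_trans (ler_norm M0))// ltrDl.
    - exact: borel_lebesgue_measurable.
    - by rewrite setDv; exact: measure0.
  by have [A hA] := exists_borel_hull bO mO; exists A => //; right; exact: perimeter_hull hA fO.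
have [bA OA mO AO0] := hA; have mA := bborel_measurable bA.
have A0 : 0 < vol A.
  rewrite -lte_fin -volE// -lebE//; apply: lt_le_trans Omega_pos _; exact: leb_le.
have [c vc] := h_critical_mbd rh hA Omega_crit.
have SW e : dotp e e = 1 -> forall l0, (forall l, l0 <= l -> vol (capD A e l) = 0) ->
    (forall l, l0 <= l -> 0 < vol (capG A e l)) -> exists B ell, sweeps A e l0 B ell.
  move=> e1 l0 D0 G0; case: hreg => [oA|[Mp per]].
    exact: (sweeps_open bA e1 rh vc oA D0 G0).
  exact: (sweeps_lipschitz bA e1 (perimeter_lipschitz bA e1 per) (G0 _ (lexx l0))).
have [rho rho0 N0] := level_ball_ae d_gt0 bA A0 vc (pot_decr_barycenter rh bA A0 vc SW).
exists (barycenter A), rho; split => //; set B := eball _ _.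
have mB : measurable B by exact: measurable_eball.
have mN : measurable ((A `\` B) `|` (B `\` A)) by apply: measurableU; exact: measurableD.
apply/eqP; rewrite eq_le leb_ge0 andbT.
have BA0 : rV_lebesgue R d ((A `\` B) `|` (B `\` A)) = 0%E by rewrite lebE//; apply/(negligibleP _ mN).
rewrite -[leRHS]adde0 -{1}BA0 -AO0.
apply: le_trans (lebU_le _ _); apply: leb_le => x [[Ox nB]|[Bx nO]].
  by left; left; split => //; exact: OA.
by have [Ax|nA] := pselect (A x); [right|left; right].
Qed.
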